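(* Let $\alpha,\beta>-1$. There is a constant $C_{\alpha,\beta}$ such that for every $f\in L^1([-1,1],J^{\alpha,\beta})$ and every $\lambda>0$, $$J^{\alpha,\beta}\{x\in[-1,1]: f^*_{\alpha,\beta}(x)>\lambda\}\le\frac{C_{\alpha,\beta}}{\lambda}\|f\|_{1,\alpha,\beta},$$ i.e. the Jacobi maximal function $f^*_{\alpha,\beta}$ is weak-$(1,1)$ continuous with respect to the Jacobi measure.
   Context: The Jacobi measure is $J^{\alpha,\beta}(dx)=(1-x)^\alpha(1+x)^\beta dx$ on $[-1,1]$, and $\|f\|_{1,\alpha,\beta}=\int_{-1}^1|f|\,dJ^{\alpha,\beta}$. $P_n^{\alpha,\beta}$ are the Jacobi polynomials, orthogonal with respect to $J^{\alpha,\beta}$, normalized by $P_n^{\alpha,\beta}(1)=\binom{n+\alpha}{n}$, and $h_n^{(\alpha,\beta)}=\int_{-1}^1[P_n^{\alpha,\beta}]^2dJ^{\alpha,\beta}$. The Watson kernel is $K^{\alpha,\beta}(r,x,y)=\sum_{n=0}^\infty r^n\frac{P_n^{\alpha,\beta}(x)P_n^{\alpha,\beta}(y)}{h_n^{(\alpha,\beta)}}$, $0<r<1$. The Jacobi maximal function is $f^*_{\alpha,\beta}(x)=\sup_{0<r<1}\left|\int_{-1}^1K^{\alpha,\beta}(r,x,y)f(y)\,J^{\alpha,\beta}(dy)\right|$. *)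

(* Defs.v *)
From HB Require Import structures.
From mathcomp Require Import all_boot all_order all_algebra.
From mathcomp Require Import all_classical all_reals all_analysis.
From mathcomp Require Import measurable_realfun.

Set Implicit Arguments.
Unset Strict Implicit.
Unset Printing Implicit Defensive.

Import Order.TTheory GRing.Theory Num.Theory.
Import numFieldNormedType.Exports.

Local Open Scope classical_set_scope.
Local Open Scope ring_scope.

(* At an endpoint, [powR] sends a negative power of 0 to 0; this affects
   only a Lebesgue-null set. *)
Definition jacobi_weight {R : realType} (alpha beta x : R) : R :=
  (1 - x) `^ alpha * (1 + x) `^ beta.

(* A measure on the whole line, carried by [-1, 1]. *)
Definition jacobi_measure {R : realType} (alpha beta : R) :
    set (measurableTypeR R) -> \bar R :=
  fun A => (\int[lebesgue_measure]_(x in A `&` `[(-1)%R, 1%R])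
              (jacobi_weight alpha beta x)%:E)%E.

Section jacobi_measure_is_measure.
Variables (R : realType) (alpha beta : R).

Lemma jacobi_weight_ge0 (x : R) : 0 <= jacobi_weight alpha beta x.
Proof. by rewrite mulr_ge0// powR_ge0. Qed.

Lemma measurable_jacobi_weight :
  measurable_fun [set: R] (jacobi_weight alpha beta).
Proof.
apply: measurable_funM.
- apply: (measurableT_comp (f := @powR R ^~ alpha)) => //.
  exact: measurable_funB.
- apply: (measurableT_comp (f := @powR R ^~ beta)) => //.
  exact: measurable_funD.
Qed.

Let jacobi_measure0 : jacobi_measure alpha beta set0 = 0%E.
Proof. by rewrite /jacobi_measure set0I integral_set0. Qed.

Let jacobi_measure_ge0 A : (0 <= jacobi_measure alpha beta A)%E.
Proof. by apply: integral_ge0 => x _; rewrite lee_fin jacobi_weight_ge0. Qed.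

Let jacobi_measure_sigma_additive :
  semi_sigma_additive (jacobi_measure alpha beta).
Proof.
move=> /= A mA tA mUA.
rewrite /jacobi_measure setI_bigcupl ge0_integral_bigcup//=.
- apply: is_cvg_ereal_nneg_natsum_cond => n _ _.
  by apply: integral_ge0 => x _; rewrite lee_fin jacobi_weight_ge0.
- by move=> n; apply: measurableI => //; exact: mA.
- apply: measurable_funTS; apply: measurableT_comp => //; exact: measurable_jacobi_weight.
- by move=> x _; rewrite lee_fin jacobi_weight_ge0.
- exact: trivIset_setIr.
Qed.

HB.instance Definition _ := isMeasure.Build _ _ _ (jacobi_measure alpha beta)
  jacobi_measure0 jacobi_measure_ge0 jacobi_measure_sigma_additive.

End jacobi_measure_is_measure.

(* The binomial coefficient (n + alpha choose n) for real alpha. *)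
Definition binomial_shift {R : realType} (alpha : R) (n : nat) : R :=
  (\prod_(1 <= k < n.+1) (alpha + k%:R)) / n`!%:R.

(* For alpha, beta > -1 these conditions determine the family P. *)
Definition jacobi_polynomials {R : realType} (alpha beta : R)
    (P : nat -> {poly R}) : Prop :=
  [/\ forall n, size (P n) = n.+1,
      forall m n, m <> n ->
        \int[jacobi_measure alpha beta]_(x in `[-1, 1])
          ((P m).[x] * (P n).[x]) = 0 &
      forall n, (P n).[1] = binomial_shift alpha n].

Section jacobi_maximal_function.
Context {R : realType} (alpha beta : R) (P : nat -> {poly R}).

Definition jacobi_h (n : nat) : R :=
  \int[jacobi_measure alpha beta]_(x in `[-1, 1]) ((P n).[x] ^+ 2).

Definition watson_kernel (r x y : R) : R :=
  limn (series (fun n => r ^+ n * ((P n).[x] * (P n).[y] / jacobi_h n))).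

Definition jacobi_maximal (f : R -> R) (x : R) : \bar R :=
  ereal_sup [set (`| \int[jacobi_measure alpha beta]_(y in `[(-1)%R, 1%R])
                       (watson_kernel r x y * f y)%:E |)%E
            | r in `]0%R, 1%R[].

End jacobi_maximal_function.

(* Main.v *)
(* The Jacobi operator has eigenvalues n (n + 2a) = (n + a)^2 - a^2, a = (alpha + beta + 1) / 2,
   so for n > 0 the Abel multiplier exp(-t n) = exp(t a) exp(-t (n + a)) is a subordinated
   value of the heat multipliers. The subordinating density is at most a decreasing function
   of bounded mass; hence, for t <= 1, the Abel means of f are dominated by the ergodic
   averages of the heat semigroup applied to |f|, up to a multiple of the norm of f, and these
   averages are of weak type (1,1) by Hopf's maximal lemma.
   The heat kernel is nonnegative because, by the maximum principle, the resolvents of the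
   Jacobi operator preserve nonnegative polynomials on [-1, 1]. The convergence of the kernels,
   and the boundedness of the Watson kernel for t >= 1, rest on the bound
   P_n^2 <= A (n + 1)^k h_n, obtained from a Markov inequality |P_n'| <= C n^2 max |P_n| that
   follows by integrating the differential equation from the endpoints. *)
From HB Require Import structures.
Require Import Defs.
From mathcomp Require Import all_boot all_order all_algebra.
From mathcomp Require Import all_classical all_reals all_analysis.
From mathcomp Require Import measurable_realfun ring lra zify.

Set Implicit Arguments.
Unset Strict Implicit.
Unset Printing Implicit Defensive.

Import Order.TTheory GRing.Theory Num.Theory.
Import numFieldNormedType.Exports.

Local Open Scope classical_set_scope.
Local Open Scope ring_scope.

(** The subordination integral is never formed. It is discretized at heat times that are multiples
    of 1/M, so that the heat operators involved are iterates of one operator and the discrete form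
    of Hopf's lemma applies. These times run from 1/M to M, and the bounds on the weights are
    uniform in M. The discretized multiplier tends to exp(-t n) only as M grows, and how large M
    must be depends on t, so a single M is available only for finitely many radii. The estimate is
    therefore proved for finite sets of radii with a constant independent of their number, extended
    to a countable dense set by continuity of the measure along increasing unions, and to all radii
    by continuity in r. The discarded multiple of the norm of f is harmless because the measure is
    finite: for lam below a fixed multiple of the norm, the total mass already gives the bound.
    Positivity is first obtained on polynomials, where resolvents act coefficientwise, and passes to
    the kernel by testing it against polynomials that concentrate at a point. The constant is chosen
    before the family [P], so the bounds on P_n^2 / h_n are uniform over all such families. *)

Section calculus.
Context {R : realType}.
Implicit Types (f g : R -> R) (x a b : R).

(** * Scalar derivative rules, monotonicity, and a primitive of the Gaussian *)

Lemma is_derive_addf f g x (df dg : R) : is_derive x 1 f df -> is_derive x 1 g dg ->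
  is_derive x 1 (fun y => f y + g y) (df + dg).
Proof. by move=> hf hg; exact: is_deriveD. Qed.

Lemma is_derive_subf f g x (df dg : R) : is_derive x 1 f df -> is_derive x 1 g dg ->
  is_derive x 1 (fun y => f y - g y) (df - dg).
Proof. by move=> hf hg; exact: is_deriveB. Qed.

Lemma is_derive_mulf f g x (df dg : R) : is_derive x 1 f df -> is_derive x 1 g dg ->
  is_derive x 1 (fun y => f y * g y) (df * g x + f x * dg).
Proof.
move=> hf hg; apply: is_derive_eq (is_deriveM hf hg) _.
by rewrite addrC; congr (_ + _); rewrite /GRing.scale/= mulrC.
Qed.

Lemma is_derive_scalef f (c : R) x (df : R) : is_derive x 1 f df ->
  is_derive x 1 (fun y => c * f y) (c * df).
Proof. by move=> hf; exact: is_deriveZ. Qed.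

Lemma is_derive_invf f x (df : R) : f x != 0 -> is_derive x 1 f df ->
  is_derive x 1 (fun y => (f y)^-1) (- df / f x ^+ 2).
Proof.
move=> fx hf; apply: is_derive_eq (is_deriveV fx hf) _.
by rewrite /GRing.scale/= mulrC mulrN mulNr.
Qed.

Lemma is_derive_comp f g x (df dg : R) :
  is_derive (g x) 1 f df -> is_derive x 1 g dg ->
  is_derive x 1 (fun y => f (g y)) (df * dg).
Proof. by move=> hf hg; exact: is_derive1_comp. Qed.

Lemma is_derive_continuous f x (df : R) : is_derive x 1 f df -> {for x, continuous f}.
Proof.
by move=> [hf _]; exact/differentiable_continuous/derivable1_diffP.
Qed.

Lemma is_derive_ge0_le f (df : R -> R) a b : a <= b ->
  {within `[a, b], continuous f} ->
  (forall x, a < x < b -> is_derive x 1 f (df x)) ->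
  (forall x, a < x < b -> 0 <= df x) -> f a <= f b.
Proof.
move=> ab cf hf df0; move: ab; rewrite le_eqVlt => /predU1P[->//|ab].
have dfi : forall x, x \in `]a, b[ -> is_derive x 1 f (df x).
  by move=> x; rewrite in_itv; exact: hf.
have [c cab fE] := MVT ab dfi cf.
move: cab; rewrite in_itv => cab.
by rewrite -subr_ge0 fE mulr_ge0 ?df0// subr_ge0 ltW.
Qed.

Lemma is_derive_ge0_le_cc f (df : R -> R) a b : a <= b ->
  (forall x, a <= x <= b -> is_derive x 1 f (df x)) ->
  (forall x, a <= x <= b -> 0 <= df x) -> f a <= f b.
Proof.
move=> ab hf df0; apply: (@is_derive_ge0_le f df) => //.
- by apply: derivable_within_continuous => x; rewrite in_itv => /hf[].
- by move=> x /andP[/ltW ax /ltW xb]; apply: hf; rewrite ax xb.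
- by move=> x /andP[/ltW ax /ltW xb]; apply: df0; rewrite ax xb.
Qed.

(** The subordination formula sees the Gaussian integral only through a bounded monotone primitive
    with two distinct limits; their difference is the normalizing constant. *)
Lemma exists_gauss_primitive : exists E : R -> R, exists e0 e1 : R,
  [/\ forall x, is_derive x 1 E (expR (- x ^+ 2)),
      E x @[x --> -oo] --> e0, E x @[x --> +oo] --> e1,
      e0 < e1 & forall x, e0 <= E x <= e1].
Proof.
pose E x := \int[@lebesgue_measure R]_(t in `]-oo, x]) gauss_fun t.
have dE x : is_derive x 1 E (expR (- x ^+ 2)).
  have iE : (@lebesgue_measure R).-integrable `]-oo, x + 1] (EFin \o gauss_fun).
    by apply: (integrableS measurableT) => //; exact: integrableT_gauss.
  have [dEx E'x] : derivable E x 1 /\ derive1 E x = gauss_fun x.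
    apply: (@continuous_FTC1 R gauss_fun -oo%O x (x + 1) _ iE (ltNyr x)).
      by rewrite ltrDl.
    exact: continuous_gauss_fun.
  split; first exact: dEx.
  by rewrite -derive1E E'x.
have ndE : {homo E : x y / x <= y}.
  move=> x y xy; apply: (@is_derive_ge0_le_cc E (fun x => expR (- x ^+ 2))) => // z _.
have [T ET] : exists T, forall x, E x <= T.
  exists (\int[@lebesgue_measure R]_t gauss_fun t) => x.
  rewrite /E Rintegral_mkcond; apply: le_Rintegral => //.
  - rewrite -restrict_EFin; apply/integrable_restrict => //.
    rewrite setTI; apply: (integrableS measurableT) => //.
    exact: integrableT_gauss.
  - exact: integrableT_gauss.
  - by move=> y _; rewrite patchE; case: ifP => // _; exact: gauss_fun_ge0.
have E0 x : 0 <= E x by apply: Rintegral_ge0 => y _; exact: gauss_fun_ge0.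
(* The lower limit is minus the supremum of the reflected function -E(-x), which reduces the limit
   at -oo to a monotone limit at +oo. *)
clearbody E; exists E, (- sup (range (fun x => - E (- x)))), (sup (range E)).
have ubE : has_ubound (range E) by exists T => _ [x _ <-].
have ubN : has_ubound (range (fun x => - E (- x))).
  by exists 0 => _ [x _ <-]; rewrite oppr_le0.
have leE x : E x <= sup (range E) by apply: ub_le_sup => //; exists x.
have geE x : - sup (range (fun x => - E (- x))) <= E x.
  rewrite lerNl; apply: ub_le_sup => //; exists (- x) => //.
  by rewrite opprK.
split => //.
- have h : - E (- x) @[x --> +oo] --> sup (range (fun x => - E (- x))).
    by apply: nondecreasing_cvgr => // x y xy; rewrite lerN2 ndE// lerN2.
  apply/cvgNy_compNP.
  rewrite (_ : E \o -%R = (fun x => - - E (- x))); first exact: cvgN h.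
  by apply/funext => x /=; rewrite opprK.
- exact: nondecreasing_cvgr.
- apply: le_lt_trans (geE 0) _; apply: lt_le_trans (leE 1).
  rewrite lt_neqAle ndE// andbT; apply/negP => /eqP E01.
  have [|c c01] := @MVT _ E (fun x => expR (- x ^+ 2)) 0 1 ltr01 (fun x _ => dE x).
    by apply: derivable_within_continuous => x _; have [] := dE x.
  by rewrite E01 subrr subr0 mulr1 => /eqP; rewrite eq_sym (gt_eqF (expR_gt0 _)).
- by move=> x; rewrite geE leE.
Qed.

End calculus.

Section dominated.
Context d (T : measurableType d) (R : realType) (mu : {measure set T -> \bar R}).
Variables (D : set T) (mD : measurable D).
Local Notation L1 f := (mu.-integrable D (EFin \o f)).

Lemma cvg_Rintegral_dominated (u : nat -> T -> R) (v g : T -> R) :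
  (forall n, measurable_fun D (u n)) -> measurable_fun D v -> L1 g ->
  {ae mu, forall x, D x -> u n x @[n --> \oo] --> v x} ->
  (forall n x, D x -> `|u n x| <= g x) ->
  L1 v /\ \int[mu]_(x in D) u n x @[n --> \oo] --> \int[mu]_(x in D) v x.
Proof.
move=> mu_ mv gi uv ug.
have [|||||iv _ h] := @dominated_convergence _ T R mu D mD
    (fun n => EFin \o u n) (EFin \o v) (EFin \o g).
- by move=> n; exact/measurable_EFinP.
- exact/measurable_EFinP.
- apply: (@filterS _ _ (ae_filter_ringOfSetsType mu) _ _ _ uv) => x uvx Dx.
  by apply/fine_cvgP; split; [exact: nearW|exact: uvx].
- exact: gi.
- by apply: aeW => x n Dx; rewrite /= lee_fin ug.
split => //; apply: fine_cvg; rewrite fineK; first exact: h.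
exact: integrable_fin_num.
Qed.

End dominated.

(** * The Jacobi measure *)

Section weight.
Context {R : realType} (alpha beta : R).
Hypotheses (halpha : -1 < alpha) (hbeta : -1 < beta).
Local Notation w := (jacobi_weight alpha beta).
Local Notation mu := (jacobi_measure alpha beta).
Local Notation D := (`[-1, 1]%classic : set R).
Local Notation leb := (@lebesgue_measure R).

Lemma is_derive_powR_onem (a x : R) : x < 1 ->
  is_derive x 1 (fun y : R => (1 - y) `^ a) (- (a * (1 - x) `^ (a - 1))).
Proof.
move=> x1; have x0 : 0 < 1 - x by rewrite subr_gt0.
have d1 := is_derive_subf (is_derive_cst (1 : R) x 1) (is_derive_id x (1 : R)).
rewrite (_ : - _ = a * (1 - x) `^ (a - 1) * (0 - 1)); last by ring.
exact: (@is_derive_comp _ (@powR R ^~ a) (fun y => 1 - y) _ _ _ (is_derive1_powR a x0) d1).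
Qed.

Lemma is_derive_powR_oned (a x : R) : -1 < x ->
  is_derive x 1 (fun y : R => (1 + y) `^ a) (a * (1 + x) `^ (a - 1)).
Proof.
move=> x1; have x0 : 0 < 1 + x by lra.
have d1 := is_derive_addf (is_derive_cst (1 : R) x 1) (is_derive_id x (1 : R)).
rewrite (_ : a * _ = a * (1 + x) `^ (a - 1) * (0 + 1)); last by ring.
exact: (@is_derive_comp _ (@powR R ^~ a) (fun y => 1 + y) _ _ _ (is_derive1_powR a x0) d1).
Qed.

Lemma jacobi_weight_continuous (x : R) : -1 < x < 1 -> {for x, continuous w}.
Proof.
move=> /andP[x1 x2]; apply: is_derive_continuous.
exact: is_derive_mulf (is_derive_powR_onem alpha x2) (is_derive_powR_oned beta x1).
Qed.

Lemma powR_le2 (a x : R) : 1 <= x <= 2 -> x `^ a <= 2 `^ `|a|.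
Proof.
move=> /andP[x1 x2]; apply: (@le_trans _ _ (x `^ `|a|)).
  by rewrite ler_powR// ler_norm.
by rewrite ge0_ler_powR// ?nnegrE; lra.
Qed.

(** On each side of 0 only one factor of the weight can be singular; the base of the other lies in
    [1, 2]. Adding the two one-sided bounds gives a majorant with an explicit primitive. *)
Lemma jacobi_weight_le (x : R) : -1 < x < 1 ->
  w x <= 2 `^ `|beta| * (1 - x) `^ alpha + 2 `^ `|alpha| * (1 + x) `^ beta.
Proof.
move=> /andP[x1 x2]; rewrite /jacobi_weight.
have [x0|x0] := leP 0 x.
  rewrite -[leLHS]addr0 lerD ?mulr_ge0 ?powR_ge0// mulrC ler_wpM2r ?powR_ge0//.
  by apply: powR_le2; lra.
rewrite -[leLHS]add0r lerD ?mulr_ge0 ?powR_ge0// ler_wpM2r ?powR_ge0//.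
by apply: powR_le2; lra.
Qed.

(** The weight can blow up at -1 and 1, so the fundamental theorem is applied only on compact
    subintervals of the open interval; the end points are reached by a limit. *)
Lemma interior_FTC2 (f F : R -> R) (a b : R) : -1 < a -> a < b -> b < 1 ->
  (forall x : R, -1 < x < 1 -> is_derive x 1 F (f x)) ->
  (forall x : R, -1 < x < 1 -> {for x, continuous f}) ->
  (\int[leb]_(x in `[a, b]) (f x)%:E = (F b - F a)%:E)%E.
Proof.
move=> a1 ab b1 dF cf; rewrite EFinB; apply: continuous_FTC2 => //.
- apply: continuous_in_subspaceT => x; rewrite inE/= in_itv/= => /andP[ax xb].
  by apply: cf; rewrite (lt_le_trans a1 ax) (le_lt_trans xb b1).
- split.
  + move=> x; rewrite in_itv/= => /andP[ax xb].
    have x01 : -1 < x < 1 by rewrite (lt_trans a1 ax) (lt_trans xb b1).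
    by have [] := dF x x01.
  + apply: cvg_at_right_filter; apply: is_derive_continuous (dF a _).
    by rewrite a1 (lt_trans ab).
  + apply: cvg_at_left_filter; apply: is_derive_continuous (dF b _).
    by rewrite b1 (lt_trans a1).
- move=> x; rewrite in_itv/= => /andP[ax xb]; rewrite derive1E.
  have x01 : -1 < x < 1 by rewrite (lt_trans a1 ax) (lt_trans xb b1).
  by have [_ ->] := dF x x01.
Qed.

(** The shift [n.+2] gives e n <= 1/2, so the exhausting intervals [-1 + e n, 1 - e n] are nonempty
    from n = 0 on. *)
Let e (n : nat) : R := n.+2%:R^-1.

Let e_gt0 n : 0 < e n. Proof. by rewrite invr_gt0 ltr0n. Qed.
Let e_lt1 n : e n <= 2^-1.
Proof. by rewrite lef_pV2 ?posrE ?ltr0n// ler_nat. Qed.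

Let e_cvg0 : e n @[n --> \oo] --> 0.
Proof.
have := @cvg_harmonic R; rewrite -cvg_shiftS.
by apply: cvg_trans; apply: near_eq_cvg; near=> n.
Unshelve. all: by end_near. Qed.

Let Dn (n : nat) : set R := `[-1 + e n, 1 - e n]%classic.

Let Dn_nd : nondecreasing_seq Dn.
Proof.
apply/nondecreasing_seqP => n; apply/subsetPset => x; rewrite /Dn /= !in_itv/=.
have : e n.+1 <= e n by rewrite lef_pV2 ?posrE ?ltr0n// ler_nat.
lra.
Qed.

Let bigcup_Dn : \bigcup_n Dn n = `]-1, 1[%classic.
Proof.
apply/seteqP; split => x /=.
  by move=> [n _]; rewrite /Dn /= !in_itv/=; have := e_gt0 n; lra.
rewrite in_itv/= => /andP[x1 x2].
have m0 : 0 < Num.min (1 - x) (1 + x) by rewrite lt_min; lra.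
move/cvgrPdist_le : e_cvg0 => /(_ _ m0)[n _ /(_ n (leqnn n))] /=.
rewrite sub0r normrN gtr0_norm// le_min => h.
by exists n => //; rewrite /Dn /= in_itv/=; lra.
Qed.

Let Dn_sub n x : Dn n x -> -1 < x < 1.
Proof. by rewrite /Dn /= in_itv/=; have := e_gt0 n; lra. Qed.

Let mw (A : set R) : measurable_fun A (EFin \o w).
Proof. by apply/measurable_EFinP/measurable_funTS; exact: measurable_jacobi_weight. Qed.

Lemma jacobi_measureE (A : set R) : A `<=` D ->
  (mu A = \int[leb]_(x in A) (w x)%:E)%E.
Proof. by move=> AD; rewrite /jacobi_measure setIidl. Qed.

Let Dn_Dn n : -1 < -1 + e n /\ -1 + e n < 1 - e n /\ 1 - e n < 1.
Proof. by have := e_gt0 n; have := e_lt1 n; split; [|split]; lra. Qed.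

(** The majorant of [jacobi_weight_le] has the primitive [G] with exponents alpha + 1 and beta + 1.
    They are positive, so [G] is bounded and the integrals over the exhausting intervals stay below
    [K]. *)
Lemma jacobi_measure_lty : (mu D < +oo)%E.
Proof.
pose a1 := alpha + 1; pose b1 := beta + 1.
have a10 : 0 < a1 by rewrite -ltrBlDr sub0r.
have b10 : 0 < b1 by rewrite -ltrBlDr sub0r.
pose g x := 2 `^ `|beta| * (1 - x) `^ alpha + 2 `^ `|alpha| * (1 + x) `^ beta.
pose G x := - (2 `^ `|beta| / a1) * (1 - x) `^ a1 + 2 `^ `|alpha| / b1 * (1 + x) `^ b1.
have dG (x : R) : -1 < x < 1 -> is_derive x 1 G (g x).
  move=> /andP[x1 x2]; apply: is_derive_eq.
    apply: is_derive_addf; apply: is_derive_scalef.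
      exact: is_derive_powR_onem.
    exact: is_derive_powR_oned.
  by rewrite /a1 /b1 !addrK /g; field; rewrite -/a1 -/b1 !gt_eqF.
have cg (x : R) : -1 < x < 1 -> {for x, continuous g}.
  move=> /andP[x1 x2].
  exact: is_derive_continuous (is_derive_addf
    (is_derive_scalef (2 `^ `|beta|) (is_derive_powR_onem alpha x2))
    (is_derive_scalef (2 `^ `|alpha|) (is_derive_powR_oned beta x1))).
have mg : measurable_fun setT g.
  apply: measurable_funD; apply: measurable_funM => //.
    apply: (measurableT_comp (f := @powR R ^~ alpha)) => //.
    exact: measurable_funB.
  apply: (measurableT_comp (f := @powR R ^~ beta)) => //.
  exact: measurable_funD.
rewrite jacobi_measureE// (@integral_itv_bndoo R (-1) 1 (EFin \o w) true false (@mw _)) -bigcup_Dn.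
pose K := 2 `^ `|beta| / a1 * 2 `^ a1 + 2 `^ `|alpha| / b1 * 2 `^ b1.
apply: (@le_lt_trans _ _ K%:E); last exact: ltry.
have h : (\int[leb]_(x in Dn n) (EFin \o w) x)%E @[n --> \oo] -->
    (\int[leb]_(x in \bigcup_n Dn n) (EFin \o w) x)%E.
  apply: ge0_nondecreasing_set_cvg_integral => //.
  - by move=> n; exact: measurable_itv.
  - by move=> n; exact: mw.
  - by move=> n x _; rewrite lee_fin jacobi_weight_ge0.
apply: (cvge_to_le h).
near=> n; have [e1 [e2 e3]] := Dn_Dn n.
apply: (@le_trans _ _ (\int[leb]_(x in Dn n) (g x)%:E)%E).
  apply: ge0_le_integral => //.
  - exact: measurable_itv.
  - by move=> x _; rewrite lee_fin jacobi_weight_ge0.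
  - exact: mw.
  - by apply/measurable_EFinP; apply: measurable_funTS.
  - by move=> x /Dn_sub; rewrite lee_fin; exact: jacobi_weight_le.
rewrite (interior_FTC2 e1 e2 e3 dG cg) lee_fin /G /K.
have e2' : 0 < e n <= 1 by rewrite e_gt0 (le_trans (e_lt1 n))// invf_le1// ler1n.
have le2 (c x : R) : 0 < c -> 0 <= x <= 2 -> 0 <= x `^ c <= 2 `^ c.
  by move=> c0 x2; rewrite powR_ge0 ge0_ler_powR ?nnegrE//; lra.
have hc (c d x : R) : 0 <= c -> 0 <= x <= d -> 0 <= c * x <= c * d.
  by move=> c0 /andP[x0 xd]; rewrite mulr_ge0//= ler_wpM2l.
have k1 := hc (2 `^ `|beta| / a1) _ _ (divr_ge0 (powR_ge0 _ _) (ltW a10)).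
have k2 := hc (2 `^ `|alpha| / b1) _ _ (divr_ge0 (powR_ge0 _ _) (ltW b10)).
have h1 : 0 <= 1 - (1 - e n) <= 2 by lra.
have h2 : 0 <= 1 - (-1 + e n) <= 2 by lra.
have h3 : 0 <= 1 + (1 - e n) <= 2 by lra.
have h4 : 0 <= 1 + (-1 + e n) <= 2 by lra.
have := k1 _ _ (le2 _ _ a10 h1); have := k1 _ _ (le2 _ _ a10 h2).
have := k2 _ _ (le2 _ _ b10 h3); have := k2 _ _ (le2 _ _ b10 h4).
rewrite !mulNr; lra.
Unshelve. all: by end_near. Qed.

Lemma jacobi_measure_setT : mu setT = mu D.
Proof. by rewrite /jacobi_measure setTI setIid. Qed.

Let jacobi_fin : fin_num_fun mu.
Proof.
move=> U mU; rewrite ge0_fin_numE//; apply: le_lt_trans jacobi_measure_lty.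
by rewrite -jacobi_measure_setT le_measure// inE.
Qed.

HB.instance Definition _ := @Measure_isFinite.Build _ _ _ mu jacobi_fin.

Let jacobi_dom : mu `<< leb.
Proof.
apply/null_content_dominatesP => A mA muA0.
rewrite /jacobi_measure; apply: null_set_integral => //; first exact: measurableI.
  exact: mw.
apply/eqP; rewrite eq_le measure_ge0 andbT -[leRHS]muA0.
by apply: le_measure; rewrite ?inE//; exact: measurableI.
Qed.

Lemma jacobi_integralE (f : R -> \bar R) (U : set R) : measurable U -> U `<=` D ->
  mu.-integrable U f ->
  (\int[mu]_(x in U) f x = \int[leb]_(x in U) (f x * (w x)%:E))%E.
Proof.
move=> mU UD fi; rewrite -(Radon_Nikodym_change_of_variables jacobi_dom)//=.
have mf := measurable_int _ fi.
apply: ae_eq_integral => //.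
- apply: emeasurable_funM => //; apply: (measurable_int leb).
  apply: (integrableS _ _ (@subsetT _ _)) => //=.
  by apply: Radon_Nikodym_integrable; exact: jacobi_dom.
- by apply: emeasurable_funM => //; exact: mw.
(* The Radon-Nikodym derivative and [w] have the same integral over every measurable subset of [U],
   hence agree almost everywhere there. *)
- apply: ae_eqe_mul2l => /=.
  rewrite Radon_NikodymE//=; case: cid => /= h [h1 h2 h3].
  apply: integral_ae_eq => //=.
  + by apply: integrableS h2.
  + exact: mw.
  + by move=> E EU mE; rewrite -h3//= -jacobi_measureE//; exact: subset_trans UD.
Qed.

Local Notation I f := (\int[mu]_(x in D) f x).
Local Notation L1 f := (mu.-integrable D (EFin \o f)).

Lemma jacobi_integrable_cst (c : R) : L1 (cst c).
Proof. exact: finite_measure_integrable_cst. Qed.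

Lemma jacobi_integrable_bounded (f : R -> R) (K : R) : measurable_fun D f ->
  (forall x, -1 <= x <= 1 -> `|f x| <= K) -> L1 f.
Proof.
move=> mf fK; apply: (le_integrable _ _ _ (jacobi_integrable_cst K)) => //.
  exact/measurable_EFinP.
move=> x /=; rewrite in_itv/= lee_fin => /fK h.
by apply: le_trans h _; exact: ler_norm.
Qed.

Lemma jacobi_integrable_poly (p : {poly R}) : L1 (horner p).
Proof.
have [K hK] : exists K, forall x : R, -1 <= x <= 1 -> `|p.[x]| <= K.
  exists (\sum_(i < size p) `|p`_i|) => x x1.
  rewrite horner_coef (le_trans (ler_norm_sum _ _ _))//; apply: ler_sum => i _.
  by rewrite normrM ler_piMr// normrX exprn_ile1// ler_norml; lra.
apply: jacobi_integrable_bounded hK.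
by apply: measurable_funTS; apply: continuous_measurable_fun; exact: continuous_horner.
Qed.

(** For g = p' this is the divergence form of the Jacobi operator: the derivative of (1 - x^2) w p'
    is w times the operator applied to p. *)
Lemma is_derive_jacobi_flux (g : {poly R}) (x : R) : -1 < x < 1 ->
  is_derive x 1 (fun y => (1 - y) `^ (alpha + 1) * (1 + y) `^ (beta + 1) * g.[y])
   (((1 - 'X ^+ 2) * g^`() + ((beta - alpha)%:P - (alpha + beta + 2) *: 'X) * g).[x]
    * w x).
Proof.
move=> /andP[x1 x2].
have d1 := is_derive_mulf (is_derive_mulf (is_derive_powR_onem (alpha + 1) x2)
  (is_derive_powR_oned (beta + 1) x1)) (is_derive_poly g x).
apply: is_derive_eq d1 _.
have px : ((1 - 'X ^+ 2) * g^`() + ((beta - alpha)%:P - (alpha + beta + 2) *: 'X) * g).[x]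
    = (1 - x ^+ 2) * g^`().[x] + (beta - alpha - (alpha + beta + 2) * x) * g.[x].
  by rewrite !hornerE.
have a10 : 0 < alpha + 1 by rewrite -ltrBlDr sub0r.
have b10 : 0 < beta + 1 by rewrite -ltrBlDr sub0r.
rewrite px /jacobi_weight !addrK.
have -> : (1 - x) `^ (alpha + 1) = (1 - x) * (1 - x) `^ alpha.
  by rewrite -[in RHS](addrK 1 alpha) mulr_powRB1//; lra.
have -> : (1 + x) `^ (beta + 1) = (1 + x) * (1 + x) `^ beta.
  by rewrite -[in RHS](addrK 1 beta) mulr_powRB1//; lra.
ring.
Qed.

(** The integrand times the weight is the derivative of the flux of [g], and the flux tends to 0 at
    both ends because alpha + 1 and beta + 1 are positive. *)
Lemma jacobi_divergence (p g : {poly R}) :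
  p = (1 - 'X ^+ 2) * g^`() + ((beta - alpha)%:P - (alpha + beta + 2) *: 'X) * g ->
  I (horner p) = 0.
Proof.
move=> pE.
pose a1 := alpha + 1; pose b1 := beta + 1.
have a10 : 0 < a1 by rewrite -ltrBlDr sub0r.
have b10 : 0 < b1 by rewrite -ltrBlDr sub0r.
pose F x := (1 - x) `^ a1 * (1 + x) `^ b1 * g.[x].
pose f x := p.[x] * w x.
have dF (x : R) : -1 < x < 1 -> is_derive x 1 F (f x).
  by move=> x01; rewrite /f pE; exact: is_derive_jacobi_flux.
have cf (x : R) : -1 < x < 1 -> {for x, continuous f}.
  move=> x01; apply: cvgM; first exact: continuous_horner.
  exact: jacobi_weight_continuous.
have In n : I (fun x => p.[x] * \1_(Dn n) x) = F (1 - e n) - F (-1 + e n).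
  have [e1 [e2 e3]] := Dn_Dn n.
  have DnD : Dn n `<=` D by move=> x /Dn_sub /=; rewrite in_itv/=; lra.
  rewrite -[RHS]/(fine (F (1 - e n) - F (-1 + e n))%:E) -(interior_FTC2 e1 e2 e3 dF cf).
  congr fine.
  have mDn : measurable (Dn n) by exact: measurable_itv.
  transitivity (\int[mu]_(x in Dn n) (p.[x])%:E)%E; last first.
    by rewrite jacobi_integralE//; apply: integrableS (jacobi_integrable_poly p).
  rewrite -[Dn n in RHS](setIidr DnD) integral_mkcondr.
  apply: eq_integral => x _; rewrite patchE indicE.
  by case: ifP => _; rewrite ?mulr1 ?mulr0.
have mDn n : measurable_fun D (\1_(Dn n) : R -> R).
  by apply: measurable_indic; exact: measurable_itv.
have mp : measurable_fun D (horner p).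
  by apply/measurable_EFinP; exact: measurable_int (jacobi_integrable_poly p).
have D0 (x : R) : D x -> -1 < x < 1 \/ (x = -1 \/ x = 1).
  rewrite /= in_itv/= => /andP[]; rewrite !le_eqVlt eq_sym => /predU1P[->|x1]; first by right; left.
  by move=> /predU1P[->|x2]; [right; right|left; rewrite x1].
have mu_pt (x : R) : mu [set x] = 0.
  by apply: (null_content_dominatesP _ _).1 jacobi_dom _ _ _ => //; exact: lebesgue_measure_set1.
have muN : mu [set -1; 1] = 0.
  apply/eqP; rewrite eq_le measure_ge0 andbT -[leRHS](adde0 0%E) -{1}(mu_pt (-1)) -(mu_pt 1).
  by apply: measureU2.
have [||||_ cvgI] := @cvg_Rintegral_dominated _ _ R mu D (measurable_itv _)
    (fun n x => p.[x] * \1_(Dn n) x) (horner p) (fun x => `|p.[x]|) _ mp.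
- by move=> n; apply: measurable_funM => //; exact: mDn.
- by have := integrable_abse (jacobi_integrable_poly p); apply: eq_integrable.
(* The indicators of the exhausting intervals tend to 1 only inside the open interval; the two end
   points form a null set. *)
- exists [set -1; 1]; split => //; first by apply: measurableU; exact: measurable_set1.
  move=> x /= h; have [x01|x01] := pselect (-1 < x < 1).
    exfalso; apply: h => _.
    have : (\bigcup_n Dn n) x by rewrite bigcup_Dn /= in_itv/=.
    move=> [N _ DNx]; apply: cvg_near_cst; near=> n.
    rewrite indicE mem_set ?mulr1//.
    have /subsetPset : (Dn N <= Dn n)%O by apply: Dn_nd; near: n; exact: nbhs_infty_ge.
    exact.
  case: (pselect (D x)) => [/D0[//|[->|->]]|nDx]; [by left|by right|].
  by exfalso; apply: h.
- by move=> n x _; rewrite normrM ler_piMr// indicE normr_nat lern1 leq_b1.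
have cvgF : F (1 - e n) - F (-1 + e n) @[n --> \oo] --> 0.
  have e0r (c : R) : 0 < c -> e n `^ c @[n --> \oo] --> 0.
    move=> c0; have /cvg_at_rightP := powR_cvg0 c0; apply.
    by split; [exact: e_gt0|exact: e_cvg0].
  have e2r (c : R) : (2 - e n) `^ c @[n --> \oo] --> 2 `^ c.
    have e2 : 2 - e n @[n --> \oo] --> (2 : R).
      by rewrite -[X in _ --> X]subr0; apply: cvgB; [exact: cvg_cst|exact: e_cvg0].
    have c2 : {for (2 : R), continuous (fun x : R => x `^ c)}.
      by apply: is_derive_continuous (is_derive1_powR c _); rewrite ltr0n.
    exact: cvg_comp e2 c2.
  have gr : g.[1 - e n] @[n --> \oo] --> g.[1 - 0].
    apply: continuous_cvg; first exact: continuous_horner.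
    by apply: cvgB; [exact: cvg_cst|exact: e_cvg0].
  have gl : g.[-1 + e n] @[n --> \oo] --> g.[-1 + 0].
    apply: continuous_cvg; first exact: continuous_horner.
    by apply: cvgD; [exact: cvg_cst|exact: e_cvg0].
  have h : e n `^ a1 * (2 - e n) `^ b1 * g.[1 - e n] -
      (2 - e n) `^ a1 * e n `^ b1 * g.[-1 + e n] @[n --> \oo] -->
      0 * 2 `^ b1 * g.[1 - 0] - 2 `^ a1 * 0 * g.[-1 + 0].
    by apply: cvgB; (apply: cvgM; last by []); apply: cvgM => //; exact: e0r.
  rewrite mulr0 !mul0r subr0 in h.
  apply: cvg_trans h; apply: near_eq_cvg; near=> n; rewrite /F /=.
  have -> : 1 - (1 - e n) = e n by ring.
  have -> : 1 + (1 - e n) = 2 - e n by ring.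
  have -> : 1 - (-1 + e n) = 2 - e n by ring.
  by have -> : 1 + (-1 + e n) = e n by ring.
apply: (cvg_unique (@Rhausdorff R) cvgI); move: cvgF; apply: cvg_trans.
by apply: near_eq_cvg; near=> n; rewrite In.
Unshelve. all: by end_near. Qed.

(** On the middle third of [u, v] both 1 - x and 1 + x are at least h = (v - u) / 3. There s^a = 2^a
    (s/2)^a >= 2^a (s/2)^k, since s/2 <= 1 and a <= k. *)
Lemma jacobi_measure_itv_ge : exists c : R, exists k : nat, 0 < c /\
  forall u v : R, -1 <= u -> u <= v -> v <= 1 ->
    c * (v - u) ^+ k <= fine (mu `[u, v]%classic).
Proof.
pose k := (Num.truncn `|alpha| + Num.truncn `|beta|).+1.
have ka : alpha <= k%:R.
  apply: le_trans (ler_norm _) _; apply: le_trans (ltW (truncnS_gt `|alpha|)) _.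
  by rewrite ler_nat ltnS leq_addr.
have kb : beta <= k%:R.
  apply: le_trans (ler_norm _) _; apply: le_trans (ltW (truncnS_gt `|beta|)) _.
  by rewrite ler_nat ltnS leq_addl.
have half_ge (a s : R) : a <= k%:R -> 0 < s <= 2 -> 2 `^ a * (s / 2) ^+ k <= s `^ a.
  move=> ak s2; have -> : s `^ a = 2 `^ a * (s / 2) `^ a.
    by rewrite -powRM; [congr (_ `^ _); field| |]; lra.
  rewrite ler_wpM2l ?powR_ge0// -powR_mulrn; last by lra.
  by apply: ger_powR => //; lra.
pose c0 := 2 `^ alpha * 2 `^ beta.
have c00 : 0 < c0 by rewrite mulr_gt0 ?powR_gt0.
(* Each of the two factors of the weight contributes (h/2)^k = ((v - u)/6)^k, and the middle third
   contributes its length (v - u)/3. *)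
exists (c0 * 6^-1 ^+ (k + k) / 3), (k + k).+1; split.
  by rewrite !mulr_gt0// exprn_gt0.
move=> u v u1 uv v1; move: uv; rewrite le_eqVlt => /predU1P[->|uv].
  by rewrite subrr expr0n mulr0 fine_ge0.
pose h := (v - u) / 3; have h0 : 0 < h by rewrite divr_gt0// subr_gt0.
have vE : v = u + 3 * h by rewrite /h; field.
pose A := `[u + h, v - h]%classic.
have AD : A `<=` D by move=> x; rewrite /A /= !in_itv/=; lra.
have Auv : A `<=` `[u, v]%classic by move=> x; rewrite /A /= !in_itv/=; lra.
apply: (@le_trans _ _ (fine (mu A))); last first.
  apply: fine_le; [by apply: fin_num_measure; exact: measurable_itv..|].
  by apply: le_measure => //; rewrite inE; exact: measurable_itv.
have wA x : A x -> c0 * (h / 2) ^+ (k + k) <= w x.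
  rewrite /A /= in_itv/= => xA; rewrite /jacobi_weight exprD mulrACA.
  have hk (s : R) : h <= s -> (h / 2) ^+ k <= (s / 2) ^+ k.
    by move=> hs; rewrite lerXn2r// ?nnegrE; lra.
  apply: ler_pM; rewrite ?mulr_ge0 ?powR_ge0 ?exprn_ge0//; try lra.
  - apply: le_trans (half_ge _ _ ka _); last by lra.
    by rewrite ler_wpM2l ?powR_ge0// hk//; lra.
  - apply: le_trans (half_ge _ _ kb _); last by lra.
    by rewrite ler_wpM2l ?powR_ge0// hk//; lra.
rewrite -lee_fin fineK ?fin_num_measure//; last exact: measurable_itv.
rewrite jacobi_measureE//.
apply: (@le_trans _ _ (\int[leb]_(x in A) (c0 * (h / 2) ^+ (k + k))%:E)%E); last first.
  apply: ge0_le_integral => //.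
  - exact: measurable_itv.
  - by move=> x _; rewrite lee_fin !mulr_ge0 ?exprn_ge0 ?(ltW c00)//; lra.
  - exact: mw.
rewrite integral_cst//; last exact: measurable_itv.
have lA : leb A = h%:E.
  rewrite /A lebesgue_measure_itv/= lte_fin ifT; last by lra.
  by rewrite -EFinB; congr EFin; rewrite vE; ring.
rewrite [X in (_ <= _ * X)%E]lA -EFinM lee_fin.
rewrite le_eqVlt; apply/orP; left; apply/eqP.
have -> : h / 2 = 6^-1 * (v - u) by rewrite /h; field.
by rewrite exprMn exprS /h; field.
Qed.

End weight.

(** * Jacobi polynomials *)

Section poly_facts.
Context {R : realType}.
Implicit Types p q : {poly R}.

Lemma horner_ge0_right p (c d : R) : c < d ->
  (forall t, c < t < d -> 0 <= p.[t]) -> 0 <= p.[c].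
Proof.
move=> cd h.
have pc : p.[t] @[t --> c^'+] --> p.[c].
  by apply: cvg_at_right_filter; exact: continuous_horner.
apply: (cvgr_to_ge pc); near=> t; apply: h; apply/andP; split; near: t.
  exact: nbhs_right_gt.
exact: nbhs_right_lt.
Unshelve. all: by end_near. Qed.

Lemma horner_ge0_left p (c d : R) : d < c ->
  (forall t, d < t < c -> 0 <= p.[t]) -> 0 <= p.[c].
Proof.
move=> cd h.
have pc : p.[t] @[t --> c^'-] --> p.[c].
  by apply: cvg_at_left_filter; exact: continuous_horner.
apply: (cvgr_to_ge pc); near=> t; apply: h; apply/andP; split; near: t.
  exact: nbhs_left_gt.
exact: nbhs_left_lt.
Unshelve. all: by end_near. Qed.

Lemma horner_min p : exists2 c : R, -1 <= c <= 1 &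
  forall t, -1 <= t <= 1 -> p.[c] <= p.[t].
Proof.
have [|c + cmin] := @EVT_min R (horner p) (-1) 1 ltac:(lra).
  by apply: continuous_subspaceT => x; exact: continuous_horner.
rewrite in_itv/= => c1; exists c => // t t1; apply: cmin; by rewrite in_itv.
Qed.

Lemma horner_norm_max p : exists2 c : R, -1 <= c <= 1 &
  forall t, -1 <= t <= 1 -> `|p.[t]| <= `|p.[c]|.
Proof.
have [c c1 cmin] := horner_min (- (p * p)); exists c => // t t1.
have := cmin _ t1; rewrite !hornerN !hornerM lerN2 => h.
by rewrite -ler_sqr ?nnegrE// !real_normK ?num_real// !expr2.
Qed.

Lemma horner_lipschitz p (K : R) : (forall t, -1 <= t <= 1 -> `|p^`().[t]| <= K) ->
  forall x y, -1 <= x <= 1 -> -1 <= y <= 1 -> `|p.[x] - p.[y]| <= K * `|x - y|.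
Proof.
move=> hK; suff h : forall x y, -1 <= x <= 1 -> -1 <= y <= 1 -> x <= y ->
    `|p.[x] - p.[y]| <= K * `|x - y|.
  move=> x y x1 y1; have [xy|/ltW yx] := leP x y; first exact: h.
  by rewrite distrC [`|x - y|]distrC; exact: h.
move=> x y x1 y1 xy; rewrite distrC [`|x - y|]distrC.
have [|c] := @MVT_segment R (horner p) (fun t => p^`().[t]) x y xy
    (fun t _ => is_derive_poly p t).
  by apply: continuous_subspaceT => z; exact: continuous_horner.
rewrite in_itv/= => cxy ->; rewrite normrM ler_wpM2r// hK//; lra.
Qed.

Lemma horner_eq0_itv p : (forall x, 0 < x <= 1 -> p.[x] = 0) -> p = 0.
Proof.
move=> h; apply/eqP/negPn/negP => p0.
pose s := [seq (i.+1%:R^-1 : R) | i <- iota 0 (size p)].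
have su : uniq s.
  rewrite map_inj_uniq ?iota_uniq// => i j /invr_inj/eqP.
  by rewrite eqr_nat eqSS => /eqP.
have sr : all (root p) s.
  apply/allP => _ /mapP[i _ ->]; apply/eqP/h.
  by rewrite invr_gt0 ltr0n/= invf_le1 ?ltr0n// ler1n.
by have := max_poly_roots p0 sr su; rewrite size_map size_iota ltnn.
Qed.

End poly_facts.

(** * The Jacobi operator: symmetry, maximum principle, Markov inequality *)

Section jacobi_op.
Context {R : realType} (alpha beta : R).
Hypotheses (halpha : -1 < alpha) (hbeta : -1 < beta).
Local Notation w := (jacobi_weight alpha beta).
Local Notation mu := (jacobi_measure alpha beta).
Local Notation D := (`[-1, 1]%classic : set R).
Local Notation J p := (\int[mu]_(x in D) (p : {poly R}).[x]).
Implicit Types p q : {poly R}.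

Definition jacobi_op p : {poly R} :=
  (1 - 'X ^+ 2) * p^`()^`() + ((beta - alpha)%:P - (alpha + beta + 2) *: 'X) * p^`().

Definition jacobi_eig (n : nat) : R := n%:R * (n%:R + alpha + beta + 1).

Lemma jacobi_eig_ge0 n : 0 <= jacobi_eig n.
Proof.
rewrite /jacobi_eig; case: n => [|n]; first by rewrite mul0r.
rewrite mulr_ge0//.
have a10 : 0 < alpha + 1 by rewrite -ltrBlDr sub0r.
have b10 : 0 < beta + 1 by rewrite -ltrBlDr sub0r.
have : 0 <= n%:R :> R by rewrite ler0n.
rewrite -addn1 natrD; lra.
Qed.

Lemma jacobi_integralD p q : J (p + q) = J p + J q.
Proof.
transitivity (\int[mu]_(x in D) (p.[x] + q.[x])).
  by apply: eq_Rintegral => x _; rewrite hornerD.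
by apply: RintegralD; [exact: measurable_itv|exact: jacobi_integrable_poly..].
Qed.

Lemma jacobi_integralZ c p : J (c *: p) = c * J p.
Proof.
transitivity (\int[mu]_(x in D) (c * p.[x])).
  by apply: eq_Rintegral => x _; rewrite hornerZ.
by apply: RintegralZl; [exact: measurable_itv|exact: jacobi_integrable_poly].
Qed.

Lemma jacobi_integral_sum (F : nat -> {poly R}) n : J (\sum_(i < n) F i) = \sum_(i < n) J (F i).
Proof.
elim: n => [|n ih]; last by rewrite !big_ord_recr /= jacobi_integralD ih.
by rewrite !big_ord0 -(scale0r 0) jacobi_integralZ mul0r.
Qed.

(** Both sides equal minus the Dirichlet form J((1 - X^2) p' q'), by [jacobi_divergence] applied to
    p' q and to q' p. *)
Lemma jacobi_op_sym p q : J (jacobi_op p * q) = J (p * jacobi_op q).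
Proof.
have h (u v : {poly R}) : J (jacobi_op u * v) + J ((1 - 'X ^+ 2) * (u^`() * v^`())) = 0.
  rewrite -jacobi_integralD; apply: (jacobi_divergence halpha hbeta (g := u^`() * v)).
  rewrite /jacobi_op derivM; ring.
have := h p q; rewrite [p^`() * _]mulrC -(h q p) => /addIr ->.
by rewrite mulrC.
Qed.

Lemma coef_jacobi_op p i :
  (jacobi_op p)`_i = p^`()^`()`_i + (beta - alpha) * p^`()`_i - jacobi_eig i * p`_i.
Proof.
rewrite /jacobi_op !mulrBl mul1r mul_polyC -scalerAl !coefD !coefN !coefZ coefXM coefXnM.
rewrite /jacobi_eig; case: i => [|[|i]] /=.
- ring.
- rewrite !coef_deriv !mulr1n; ring.
- rewrite !subSS subn0 !coef_deriv; ring.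
Qed.

Lemma size_jacobi_op p n : (size p <= n)%N -> (size (jacobi_op p) <= n)%N.
Proof.
move=> /leq_sizeP pn; apply/leq_sizeP => i ni; rewrite coef_jacobi_op.
rewrite !coef_deriv !pn ?(leqW (leqW ni)) ?(leqW ni)//.
by rewrite !mul0rn mulr0 mulr0 subr0 addr0.
Qed.

(** At a minimum point c of p on [-1, 1] the operator is nonnegative, so p(c) is at least eps times
    a nonnegative number. The sign is read off algebraically from p = p(c) + s (X - c), for which
    p'(c) = s(c) and p''(c) = 2 s'(c). *)
Lemma jacobi_op_max p (eps : R) : 0 <= eps ->
  (forall x, -1 <= x <= 1 -> 0 <= (p - eps *: jacobi_op p).[x]) ->
  forall x, -1 <= x <= 1 -> 0 <= p.[x].
Proof.
move=> eps0 hp x x1; have [c c1 cmin] := horner_min p.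
apply: le_trans (cmin _ x1).
suff Lc : 0 <= (jacobi_op p).[c].
  have := hp c c1; rewrite hornerD hornerN hornerZ subr_ge0; apply: le_trans.
  by rewrite mulr_ge0.
have a10 : 0 < alpha + 1 by rewrite -ltrBlDr sub0r.
have b10 : 0 < beta + 1 by rewrite -ltrBlDr sub0r.
have /factor_theorem[s sE] : root (p - p.[c]%:P) c.
  by rewrite /root hornerD hornerN hornerC subrr.
have pE : p = s * ('X - c%:P) + p.[c]%:P by rewrite -sE subrK.
have p' : p^`() = s^`() * ('X - c%:P) + s.
  by rewrite {1}pE derivD derivM derivXsubC derivC mulr1 addr0.
have p'' : p^`()^`() = s^`()^`() * ('X - c%:P) + s^`() *+ 2.
  by rewrite p' derivD derivM derivXsubC mulr1 -addrA -mulr2n.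
have LpE : (jacobi_op p).[c] = (1 - c ^+ 2) * (s^`().[c] *+ 2) +
    (beta - alpha - (alpha + beta + 2) * c) * s.[c].
  rewrite /jacobi_op hornerD !hornerM p'' p' !(hornerD, hornerM, hornerN, hornerZ, hornerX,
    hornerC, hornerMn, hornerXn); ring.
have st t : -1 <= t <= 1 -> 0 <= s.[t] * (t - c).
  by move=> /cmin; rewrite {2}pE hornerD hornerM hornerXsubC hornerC lerDr.
have sr : c < 1 -> 0 <= s.[c].
  move=> c2; apply: (horner_ge0_right c2) => t tc.
  by have := st t; rewrite pmulr_lge0; [apply; lra|lra].
have sl : -1 < c -> s.[c] <= 0.
  move=> c2; rewrite -oppr_ge0 -hornerN; apply: (horner_ge0_left c2) => t tc.
  by have := st t; rewrite nmulr_lge0 ?hornerN ?oppr_ge0; [apply; lra|lra].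
(* At c = 1 the second-order term drops out and -2 (alpha + 1) s(1) remains, with s(1) <= 0; at c =
   -1 it is 2 (beta + 1) s(-1), with s(-1) >= 0. *)
have [c2|c2] := leP 1 c.
  have cE : c = 1 by lra.
  by rewrite LpE cE; have := sl ltac:(lra); rewrite cE; nra.
have [c3|c3] := leP c (-1).
  have cE : c = -1 by lra.
  by rewrite LpE cE; have := sr ltac:(lra); rewrite cE; nra.
(* At an interior minimum s(c) is both nonnegative and nonpositive, so p = p(c) + u (X - c)^2 with
   u(c) >= 0. *)
have sc0 : s.[c] = 0 by apply/eqP; rewrite eq_le sl// sr.
have /factor_theorem[u uE] : root s c by apply/eqP.
have s'c : s^`().[c] = u.[c].
  by rewrite uE derivM derivXsubC hornerD !hornerM hornerXsubC subrr mulr0 add0r hornerC mulr1.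
rewrite LpE sc0 mulr0 addr0 s'c mulr_ge0//; first by nra.
rewrite mulrn_wge0//; apply: (horner_ge0_right c2) => t tc.
have := st t; rewrite uE hornerM hornerXsubC -mulrA -expr2 pmulr_lge0; first by apply; lra.
by rewrite exprn_gt0// subr_gt0; lra.
Qed.

(* The flux (1-x)^(alpha+1) (1+x)^(beta+1) p' vanishes at 1 and has derivative
   -lam w p, hence it is controlled by (1-x)^(alpha+1). *)
Lemma markov_right p (lam M : R) : 0 <= lam -> jacobi_op p = - lam *: p ->
  (forall x, -1 <= x <= 1 -> `|p.[x]| <= M) ->
  forall x, 0 <= x <= 1 -> `|p^`().[x]| <= lam * M * (2 `^ `|beta| / (alpha + 1)).
Proof.
move=> lam0 pL pM.
have a10 : 0 < alpha + 1 by rewrite -ltrBlDr sub0r.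
have b10 : 0 < beta + 1 by rewrite -ltrBlDr sub0r.
set K := lam * M * _.
pose G x := (1 - x) `^ (alpha + 1) * (1 + x) `^ (beta + 1) * p^`().[x].
have dG (x : R) : -1 < x < 1 -> is_derive x 1 G (- lam * p.[x] * w x).
  by move=> x1; rewrite -hornerZ -pL; exact: is_derive_jacobi_flux.
pose dh (x : R) := lam * M * 2 `^ `|beta| * (1 - x) `^ alpha.
have dK (x : R) : x < 1 ->
    is_derive x 1 (fun y : R => - K * (1 - y) `^ (alpha + 1)) (dh x).
  move=> x1.
  have d := is_derive_scalef (- K) (is_derive_powR_onem (alpha + 1) x1).
  by apply: is_derive_eq d _; rewrite addrK /K /dh; field; rewrite gt_eqF.
have wle (x : R) : 0 <= x < 1 -> `|- lam * p.[x] * w x| <= dh x.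
  move=> x01; have w0 : 0 <= w x by exact: jacobi_weight_ge0.
  have -> : `|- lam * p.[x] * w x| = lam * (`|p.[x]| * w x).
    by rewrite -mulrA mulNr normrN normrM (ger0_norm lam0) [X in _ * X]normrM (ger0_norm w0).
  rewrite /dh -!mulrA ler_wpM2l//.
  have M0 : 0 <= M by apply: le_trans (pM 0 _) => //; lra.
  apply: ler_pM => //; first by apply: pM; lra.
  by rewrite /jacobi_weight mulrC ler_wpM2r ?powR_ge0// powR_le2; lra.
(* Both functions -K (1 - y)^(alpha+1) + G y and -K (1 - y)^(alpha+1) - G y are nondecreasing, since
   [dh] dominates the derivative of [G] in absolute value. The term |G z| disappears as z tends to
   1. *)
have step (x z : R) : 0 <= x -> x <= z -> z < 1 ->
    `|G x| <= K * (1 - x) `^ (alpha + 1) + `|G z|.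
  move=> x0 xz z1.
  have K0 : 0 <= K * (1 - z) `^ (alpha + 1).
    rewrite mulr_ge0 ?powR_ge0// /K !mulr_ge0 ?powR_ge0 ?invr_ge0 ?(ltW a10)//.
    by apply: le_trans (pM 0 _) => //; lra.
  have h1 : - K * (1 - x) `^ (alpha + 1) + G x <= - K * (1 - z) `^ (alpha + 1) + G z.
    apply: (@is_derive_ge0_le_cc _ (fun y => - K * (1 - y) `^ (alpha + 1) + G y)
      (fun y => dh y + - lam * p.[y] * w y) _ _ xz) => y xyz.
      by apply: is_derive_addf; [apply: dK|apply: dG]; lra.
    have := wle y ltac:(lra); rewrite ler_norml; lra.
  have h2 : - K * (1 - x) `^ (alpha + 1) - G x <= - K * (1 - z) `^ (alpha + 1) - G z.
    apply: (@is_derive_ge0_le_cc _ (fun y => - K * (1 - y) `^ (alpha + 1) - G y)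
      (fun y => dh y - - lam * p.[y] * w y) _ _ xz) => y xyz.
      by apply: is_derive_subf; [apply: dK|apply: dG]; lra.
    have := wle y ltac:(lra); rewrite ler_norml; lra.
  have h3 := ler_norm (G z); have := ler_norm (- G z); rewrite normrN => h4.
  rewrite ler_norml; lra.
have [c c1 cmax] := horner_norm_max p^`().
(* Any bound on p' will do here, as only the limit e -> 0 is used; the maximum of |p'| over [-1, 1]
   is taken. *)
have Gsmall (e : R) : 0 < e -> e <= 1 ->
    `|G (1 - e)| <= e `^ (alpha + 1) * (2 `^ (beta + 1) * `|p^`().[c]|).
  move=> e0 e1; rewrite /G !normrM !(ger0_norm (powR_ge0 _ _)).
  have -> : 1 - (1 - e) = e by ring.
  rewrite -mulrA ler_wpM2l ?powR_ge0// ler_pM ?powR_ge0//; last by apply: cmax; lra.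
  by rewrite ge0_ler_powR ?nnegrE//; lra.
have Gle (x : R) : 0 <= x < 1 -> `|G x| <= K * (1 - x) `^ (alpha + 1).
  move=> x01; rewrite -subr_le0.
  have lim0 : e `^ (alpha + 1) * (2 `^ (beta + 1) * `|p^`().[c]|) @[e --> 0^'+] --> 0.
    by rewrite -[X in _ --> X](mul0r (2 `^ (beta + 1) * `|p^`().[c]|)); apply: cvgMl; exact: powR_cvg0.
  apply: (cvgr_to_ge lim0); near=> e.
  have e0 : 0 < e by near: e; exact: nbhs_right_gt.
  have e1 : e < 1 - x by near: e; apply: nbhs_right_lt; lra.
  have := step x (1 - e) ltac:(lra) ltac:(lra) ltac:(lra).
  have := Gsmall e ltac:(lra) ltac:(lra); lra.
(* Divide by (1 - x)^(alpha+1); on [0, 1) the other factor (1 + x)^(beta+1) is at least 1. The point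
   x = 1 follows by continuity. *)
have main (x : R) : 0 <= x < 1 -> `|p^`().[x]| <= K.
  move=> x01; have := Gle x x01; rewrite /G !normrM !(ger0_norm (powR_ge0 _ _)).
  rewrite [K * _]mulrC -mulrA ler_pM2l; last by rewrite powR_gt0; lra.
  apply: le_trans; rewrite ler_peMl// -[leLHS](powRr0 (1 + x)) ler_powR ?(ltW b10)//; lra.
move=> x x01; have [x1|x1] := ltP x 1; first by apply: main; lra.
have {x1}-> : x = 1 by lra.
have h1 : 0 <= (K%:P - p^`()).[1].
  apply: (@horner_ge0_left _ _ _ 0) => // t t01.
  have := main t ltac:(lra); rewrite hornerD hornerN hornerC ler_norml; lra.
have h2 : 0 <= (K%:P + p^`()).[1].
  apply: (@horner_ge0_left _ _ _ 0) => // t t01.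
  have := main t ltac:(lra); rewrite hornerD hornerC ler_norml; lra.
move: h1 h2; rewrite !hornerD hornerN hornerC ler_norml; lra.
Unshelve. all: by end_near. Qed.

End jacobi_op.

(** * Eigenvalue equation and pointwise bounds for Jacobi polynomials *)

Section jacobi_bound.
Context {R : realType} (alpha beta : R).
Hypotheses (halpha : -1 < alpha) (hbeta : -1 < beta).
Local Notation mu := (jacobi_measure alpha beta).
Local Notation D := (`[-1, 1]%classic : set R).
Local Notation J p := (\int[mu]_(x in D) (p : {poly R}).[x]).
Implicit Types p q : {poly R}.

(** The reflection x -> -x exchanges alpha and beta, so the derivative bound on [0, 1] also gives
    the one on [-1, 0]. *)
Lemma jacobi_op_reflect p : jacobi_op beta alpha (p \Po - 'X) = jacobi_op alpha beta p \Po - 'X.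
Proof.
rewrite /jacobi_op !(deriv_comp, derivN, derivX, derivM, derivC).
rewrite comp_polyD !comp_polyM !comp_polyB comp_polyZ !comp_polyC comp_polyX comp_Xn_poly.
by rewrite [beta + alpha]addrC polyC1 sqrrN !polyCB -!mul_polyC; ring.
Qed.

Lemma markov_jacobi : exists2 K0 : R, 1 <= K0 &
  forall p (lam M : R), 0 <= lam -> jacobi_op alpha beta p = - lam *: p ->
  (forall x, -1 <= x <= 1 -> `|p.[x]| <= M) ->
  forall x, -1 <= x <= 1 -> `|p^`().[x]| <= lam * M * K0.
Proof.
have a10 : 0 < alpha + 1 by rewrite -ltrBlDr sub0r.
have b10 : 0 < beta + 1 by rewrite -ltrBlDr sub0r.
pose k1 := 2 `^ `|beta| / (alpha + 1); pose k2 := 2 `^ `|alpha| / (beta + 1).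
have k10 : 0 <= k1 by rewrite divr_ge0 ?powR_ge0 ?ltW.
have k20 : 0 <= k2 by rewrite divr_ge0 ?powR_ge0 ?ltW.
(* The summand 1 makes the constant at least 1, which later ensures that the length [eta] in
   [jacobi_bound] is at most 1. *)
exists (k1 + k2 + 1); first by rewrite lerDr addr_ge0.
move=> p lam M lam0 pL pM x x1.
have M0 : 0 <= M by apply: le_trans (pM 0 _) => //; lra.
have lM0 : 0 <= lam * M by rewrite mulr_ge0.
have [x0|x0] := leP 0 x.
  apply: le_trans (markov_right halpha hbeta lam0 pL pM (x := x) _) _; first by lra.
  by rewrite -/k1 ler_wpM2l//; lra.
have qL : jacobi_op beta alpha (p \Po - 'X) = - lam *: (p \Po - 'X).
  by rewrite jacobi_op_reflect pL comp_polyZ.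
have qM y : -1 <= y <= 1 -> `|(p \Po - 'X).[y]| <= M.
  by move=> y1; rewrite horner_comp hornerN hornerX; apply: pM; lra.
have := markov_right hbeta halpha lam0 qL qM (x := - x) ltac:(lra).
rewrite deriv_comp derivN derivX hornerM hornerN hornerC horner_comp hornerN hornerX opprK.
rewrite mulrN1 normrN -/k2 => /le_trans; apply; rewrite ler_wpM2l//; lra.
Qed.

Lemma jacobi_integral_ge p (u v m : R) (c : R) k : -1 <= u -> u <= v -> v <= 1 -> 0 <= m ->
  (c * (v - u) ^+ k <= fine (mu `[u, v]%classic)) ->
  (forall x, -1 <= x <= 1 -> 0 <= p.[x]) -> (forall x, u <= x <= v -> m <= p.[x]) ->
  m * (c * (v - u) ^+ k) <= J p.
Proof.
move=> u1 uv v1 m0 hc p0 pm.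
pose A : set R := `[u, v]%classic.
have AD : A `<=` D by move=> x; rewrite /A /= !in_itv/=; lra.
have mA : measurable A by exact: measurable_itv.
apply: (le_trans (ler_wpM2l m0 hc)).
rewrite -lee_fin.
have ip := jacobi_integrable_poly halpha hbeta p.
have muA : (mu A \is a fin_num).
  rewrite ge0_fin_numE// (le_lt_trans _ (jacobi_measure_lty halpha hbeta))//.
  by rewrite le_measure// inE; exact: measurable_itv.
rewrite EFinM fineK// /Rintegral fineK; last exact: integrable_fin_num ip.
apply: (@le_trans _ _ (\int[mu]_(x in A) (p.[x])%:E)%E).
  have := @integral_cst _ _ R mu A mA m%:E; rewrite /= => <-.
  apply: ge0_le_integral => //.
  exact: measurable_funS (measurable_itv _) AD (measurable_int _ ip).
apply: ge0_subset_integral => //.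
exact: measurable_int ip.
Qed.

(** By the Lipschitz bound, |p| >= |p(x0)| / 2 within distance [eta] of x0. On the side of x0 that
    points towards 0, an interval of full length eta <= 1 stays inside [-1, 1]. *)
Lemma jacobi_integral_sqr_ge : exists c : R, exists k : nat, 0 < c /\
  forall p (x0 K eta : R), -1 <= x0 <= 1 -> 0 < eta <= 1 ->
  (forall x, -1 <= x <= 1 -> `|p^`().[x]| <= K) -> K * eta <= `|p.[x0]| / 2 ->
  c * eta ^+ k * p.[x0] ^+ 2 <= J (p * p).
Proof.
have [c [k [c0 hc]]] := jacobi_measure_itv_ge halpha hbeta.
exists (c / 4), k; split; first by rewrite divr_gt0.
move=> p x0 K eta x01 eta01 hK Keta.
have K0 : 0 <= K by apply: le_trans (hK x0 x01).
have low x : -1 <= x <= 1 -> `|x - x0| <= eta -> p.[x0] ^+ 2 / 4 <= (p * p).[x].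
  move=> x1 xx0; have := horner_lipschitz hK x1 x01 => h.
  have h2 : `|p.[x0]| / 2 <= `|p.[x]|.
    have := ler_wpM2l K0 xx0; have := ler_distD p.[x] p.[x0] 0.
    rewrite !subr0 distrC; lra.
  rewrite hornerM -expr2 -[_ ^+ 2]real_normK ?num_real// -[leRHS]real_normK ?num_real//.
  have := lerXn2r 2 (_ : `|p.[x0]| / 2 \is Num.nneg) (_ : `|p.[x]| \is Num.nneg) h2.
  by rewrite !nnegrE => /(_ _ _)/le_trans; rewrite expr_div_n -natrX; apply; rewrite ?divr_ge0.
have pp0 x : -1 <= x <= 1 -> 0 <= (p * p).[x] by rewrite hornerM -expr2 sqr_ge0.
have m0 : 0 <= p.[x0] ^+ 2 / 4 by rewrite divr_ge0 ?sqr_ge0.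
have -> : c / 4 * eta ^+ k * p.[x0] ^+ 2 = p.[x0] ^+ 2 / 4 * (c * eta ^+ k) by field.
have [x00|x00] := leP 0 x0.
  have {1}-> : eta = x0 - (x0 - eta) by ring.
  apply: jacobi_integral_ge => //; try lra; first by apply: hc; lra.
  by move=> x xx; apply: low; [lra|rewrite ler_norml; lra].
have {1}-> : eta = x0 + eta - x0 by ring.
apply: jacobi_integral_ge => //; try lra; first by apply: hc; lra.
by move=> x xx; apply: low; [lra|rewrite ler_norml; lra].
Qed.

Lemma jacobi_integral_sqr_eq0 p : J (p * p) = 0 -> p = 0.
Proof.
move=> Jp; apply: horner_eq0_itv => x x01; apply/eqP/negPn/negP => px0.
have [c [k [c0 hc]]] := jacobi_integral_sqr_ge.
have [d d1 dmax] := horner_norm_max p^`().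
pose K := `|p^`().[d]| + `|p.[x]|.
have p0 : 0 < `|p.[x]| by rewrite normr_gt0.
have K0 : 0 < K by rewrite /K ltr_wpDl.
pose eta := `|p.[x]| / 2 / K.
have eta0 : 0 < eta by rewrite !divr_gt0.
have eta1 : eta <= 1.
  rewrite ler_pdivrMr// mul1r /K; have := normr_ge0 p^`().[d]; lra.
have := hc p x K eta ltac:(lra) _ _ _; rewrite Jp => h.
have : 0 < c * eta ^+ k * p.[x] ^+ 2.
  have p2 : 0 < p.[x] ^+ 2 by rewrite -real_normK ?num_real// exprn_gt0.
  by apply: mulr_gt0 p2; rewrite mulr_gt0// exprn_gt0.
rewrite ltNge h//; first by rewrite eta0.
- by move=> y y1; rewrite (le_trans (dmax y y1))// lerDl.
- by rewrite mulrC divfK// gt_eqF.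
Qed.


Section family.
Variable P : nat -> {poly R}.
Hypothesis hP : jacobi_polynomials alpha beta P.
Local Notation h := (jacobi_h alpha beta P).
Local Notation eig := (jacobi_eig alpha beta).
Local Notation L := (jacobi_op alpha beta).

Lemma size_jacobi n : size (P n) = n.+1. Proof. by case: hP. Qed.

Lemma jacobi_neq0 n : P n != 0.
Proof. by rewrite -size_poly_eq0 size_jacobi. Qed.

Lemma jacobi_coef_neq0 n : (P n)`_n != 0.
Proof.
have := jacobi_neq0 n; rewrite -lead_coef_eq0 lead_coefE size_jacobi.
exact.
Qed.

Lemma jacobi_orth m n : m != n -> J (P m * P n) = 0.
Proof.
move=> /eqP mn; have [_ ho _] := hP; rewrite -[RHS](ho _ _ mn).
by apply: eq_Rintegral => x _; rewrite hornerM.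
Qed.

Lemma jacobi_hE n : h n = J (P n * P n).
Proof. by apply: eq_Rintegral => x _; rewrite hornerM expr2. Qed.

Lemma jacobi_basis n q : (size q <= n)%N ->
  exists d : nat -> R, q = \sum_(i < n) d i *: P i.
Proof.
elim: n q => [|n ih] q sq.
  by exists (fun=> 0); rewrite big_ord0; apply/eqP; rewrite -size_poly_leq0.
pose d := q`_n / (P n)`_n.
have /ih[d' qE] : (size (q - d *: P n)%R <= n)%N.
  apply/leq_sizeP => j; rewrite leq_eqVlt => /predU1P[<-|nj].
    by rewrite coefB coefZ /d divfK ?subrr ?jacobi_coef_neq0.
  have := leq_trans sq nj; move=> /leq_sizeP/(_ _ (leqnn _)) q0.
  have : (size (P n) <= j)%N by rewrite size_jacobi.
  by move=> /leq_sizeP/(_ _ (leqnn _)) P0; rewrite coefB coefZ q0 P0 mulr0 subrr.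
exists (fun i => if i == n then d else d' i).
rewrite big_ord_recr/= eqxx -[LHS](subrK (d *: P n)) qE; congr (_ + _).
by apply: eq_bigr => i _; rewrite ltn_eqF.
Qed.

Lemma jacobi_orth_lt n q : (size q <= n)%N -> J (P n * q) = 0.
Proof.
move=> /jacobi_basis[d ->]; rewrite mulr_sumr.
rewrite (jacobi_integral_sum halpha hbeta (fun i => P n * (d i *: P i))) big1// => i _.
by rewrite -scalerAr jacobi_integralZ// jacobi_orth ?mulr0// gtn_eqF.
Qed.

(** The leading terms of L P_n + eig n P_n cancel, so this remainder r has degree below n. Symmetry
    turns J(r r) into integrals of P_n against r and L r, both of degree below n; hence J(r r) = 0
    and r = 0. *)
Lemma jacobi_opE n : L (P n) = - eig n *: P n.
Proof.
suff : L (P n) + eig n *: P n = 0.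
  by move=> /eqP; rewrite addr_eq0 scaleNr => /eqP.
set r := (X in X = 0).
have sr : (size r <= n)%N.
  apply/leq_sizeP => j; rewrite leq_eqVlt => /predU1P[<-|nj].
    have z1 : (P n)`_n.+1 = 0 by rewrite nth_default// size_jacobi.
    have z2 : (P n)`_n.+2 = 0 by rewrite nth_default// size_jacobi.
    rewrite /r coefD coefZ coef_jacobi_op !coef_deriv z1 z2.
    by rewrite !mul0rn mulr0 addr0 add0r addrC subrr.
  have h1 : (size (L (P n)) <= n.+1)%N by apply: size_jacobi_op; rewrite size_jacobi.
  by rewrite /r coefD coefZ !nth_default ?mulr0 ?addr0// ?size_jacobi// (leq_trans h1).
apply: jacobi_integral_sqr_eq0.
have -> : r * r = L (P n) * r + eig n *: (P n * r).
  by rewrite {1}/r mulrDl scalerAl.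
rewrite jacobi_integralD// jacobi_integralZ// jacobi_op_sym// !jacobi_orth_lt ?mulr0 ?addr0//.
exact: size_jacobi_op.
Qed.

End family.

(** Let M be the maximum of |P_n|. The Markov inequality keeps |P_n| above M/2 on an interval of
    length of order (n + 1)^-2, whose measure is at least a power of that length; so h_n dominates
    M^2 times a power of 1/(n + 1). [A] and [k] do not depend on the family. *)
Lemma jacobi_bound : exists A : R, exists k : nat, 0 < A /\
  forall P, jacobi_polynomials alpha beta P -> forall n,
  0 < jacobi_h alpha beta P n /\ forall x, -1 <= x <= 1 ->
    (P n).[x] ^+ 2 <= A * n.+1%:R ^+ k * jacobi_h alpha beta P n.
Proof.
have [K0 K01 markov] := markov_jacobi.
have [c [k [c0 low]]] := jacobi_integral_sqr_ge.
(* Since eig n <= (|alpha + beta + 1| + 2) (n + 1)^2, the length eta = 1 / (S (n + 1)^2) satisfies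
   eig n K0 eta <= 1/2. *)
pose S := 2 * K0 * (`|alpha + beta + 1| + 2).
have S1 : 1 <= S.
  rewrite /S; have := normr_ge0 (alpha + beta + 1); nra.
have S0 : 0 < S by lra.
exists (S ^+ k / c), (2 * k)%N; split; first by rewrite divr_gt0// exprn_gt0.
move=> P hP n.
have [x0 x01 xmax] := horner_norm_max (P n).
have e0 := jacobi_eig_ge0 halpha hbeta n.
set M := `|(P n).[x0]|.
have M0 : 0 < M.
  rewrite normr_gt0; apply/negP => /eqP Px0; move: (jacobi_neq0 hP n) => /eqP; apply.
  apply: horner_eq0_itv => x x01'; apply/normr0_eq0/eqP; rewrite eq_le normr_ge0 andbT.
  by have := xmax x ltac:(lra); rewrite Px0 normr0.
pose eta := (S * n.+1%:R ^+ 2)^-1.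
have n1 : 1 <= n.+1%:R :> R by rewrite ler1n.
have n2 : 1 <= n.+1%:R ^+ 2 :> R by rewrite expr_ge1.
have Sn : 0 < S * n.+1%:R ^+ 2 by nra.
have eta0 : 0 < eta <= 1 by rewrite invr_gt0 Sn/= invf_le1//; nra.
have lamS : jacobi_eig alpha beta n * K0 <= S * n.+1%:R ^+ 2 / 2.
  have nn : 0 <= n%:R :> R by rewrite ler0n.
  have : jacobi_eig alpha beta n <= (`|alpha + beta + 1| + 2) * n.+1%:R ^+ 2.
    rewrite /jacobi_eig -[n.+1]addn1 natrD; have := ler_norm (alpha + beta + 1).
    move: (`|_|) (normr_ge0 (alpha + beta + 1)) => s s0 hs.
    have : n%:R * (n%:R + alpha + beta + 1) <= n%:R * (n%:R + s) by rewrite ler_wpM2l//; lra.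
    by move=> h; apply: (le_trans h); nra.
  move=> h; have K00 : 0 <= K0 by lra.
  have := ler_wpM2r K00 h; rewrite /S; lra.
have h : c * eta ^+ k * (P n).[x0] ^+ 2 <= jacobi_h alpha beta P n.
  rewrite jacobi_hE; apply: (low _ _ (jacobi_eig alpha beta n * M * K0)) => //.
    exact: markov e0 (jacobi_opE hP n) xmax.
  have : jacobi_eig alpha beta n * K0 * eta <= 2^-1.
    by rewrite /eta ler_pdivrMr// [leRHS]mulrC.
  move=> /(ler_wpM2l (ltW M0)); rewrite -/M; lra.
have Px2 : 0 < (P n).[x0] ^+ 2 by rewrite -real_normK ?num_real// exprn_gt0.
have ek : 0 < eta ^+ k by rewrite exprn_gt0//; case/andP: eta0.
split; first exact: lt_le_trans (mulr_gt0 (mulr_gt0 c0 ek) Px2) h.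
move=> x x1; apply: (@le_trans _ _ ((P n).[x0] ^+ 2)).
  by rewrite -[leLHS]real_normK ?num_real// -[leRHS]real_normK ?num_real// lerXn2r ?nnegrE// xmax.
have -> : S ^+ k / c * n.+1%:R ^+ (2 * k) = (c * eta ^+ k)^-1.
  rewrite /eta exprVn exprM invfM invrK (exprMn k S (n.+1%:R ^+ 2)).
  by rewrite mulrA [S ^+ k / c]mulrC.
by rewrite ler_pdivlMl ?mulr_gt0.
Qed.

End jacobi_bound.

(** * Hopf's maximal inequality *)

Section hopf.
Context d (X : measurableType d) (R : realType) (mu : {measure set X -> \bar R}).
Variables (D : set X) (mD : measurable D) (muD : (mu D < +oo)%E).
Local Notation L1 f := (mu.-integrable D (EFin \o f)).
Local Notation I f := (\int[mu]_(x in D) f x).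

(** A doubly stochastic operator. The identities are required at every point of [D], which the heat
    operators satisfy because their series converge pointwise. *)
Definition positive_contraction (T : (X -> R) -> X -> R) := [/\
  forall f, L1 f -> L1 (T f),
  forall f g, L1 f -> L1 g -> forall x, D x -> T (f \+ g) x = T f x + T g x,
  forall f, L1 f -> (forall x, D x -> 0 <= f x) -> forall x, D x -> 0 <= T f x,
  forall f, L1 f -> I (T f) = I f &
  forall c x, D x -> T (cst c) x = c].

Variables (T : (X -> R) -> X -> R) (hT : positive_contraction T).

Definition ergodic_sum (f : X -> R) (n : nat) (x : X) : R :=
  \sum_(0 <= j < n) iter j T f x.

Lemma L1_eq f g : (forall x, D x -> f x = g x) -> L1 f -> L1 g.
Proof.
move=> fg; apply: eq_integrable => // x; rewrite inE => Dx /=.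
by rewrite fg.
Qed.

Lemma L1D f g : L1 f -> L1 g -> L1 (f \+ g).
Proof. by move=> fi gi; have := integrableD mD fi gi; apply: L1_eq. Qed.

Lemma L1N f : L1 f -> L1 (\- f).
Proof. by move=> fi; have := integrableN fi; apply: L1_eq. Qed.

Lemma L1Z c f : L1 f -> L1 (fun x => c * f x).
Proof. by move=> fi; have := integrableZl mD c fi; apply: L1_eq. Qed.

Lemma L1cst c : L1 (cst c).
Proof.
apply/integrableP; split; first exact/measurable_EFinP.
by rewrite /= integral_cst//= lte_mul_pinfty.
Qed.

Lemma L1B f g : L1 f -> L1 g -> L1 (f \- g).
Proof. by move=> fi gi; exact: L1D fi (L1N gi). Qed.

Lemma L1_normr f : L1 f -> L1 (fun x => `|f x|).
Proof. by move=> fi; have := integrable_abse fi; apply: L1_eq. Qed.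

Lemma L1_max f g : L1 f -> L1 g -> L1 (f \max g).
Proof.
move=> fi gi.
have h : L1 (fun x => 2^-1 * (f x + g x + `|f x - g x|)).
  by apply/L1Z/L1D; [exact: L1D|exact/L1_normr/L1B].
apply: L1_eq h => x _ /=; rewrite maxr_absE; lra.
Qed.

Lemma L1_sum f n : (forall i, L1 (f i)) -> L1 (fun x => \sum_(0 <= i < n) f i x).
Proof.
move=> fi; elim: n => [|n ih].
  by apply: (@L1_eq (cst 0)) (L1cst 0) => x _; rewrite big_nil.
by apply: L1_eq (L1D ih (fi n)) => x _ /=; rewrite big_nat_recr.
Qed.

Lemma L1_indic A : measurable A -> L1 (\1_A : X -> R).
Proof.
move=> mA; apply: (le_integrable mD _ _ (L1cst 1)).
  by apply/measurable_EFinP; exact: measurable_indic.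
by move=> x _ /=; rewrite lee_fin !indicE normr1 normr_nat lern1 leq_b1.
Qed.

Let TL1 f : L1 f -> L1 (T f). Proof. by case: hT => h _ _ _ _; exact: h. Qed.

Lemma contraction_le f g : L1 f -> L1 g -> (forall x, D x -> f x <= g x) ->
  forall x, D x -> T f x <= T g x.
Proof.
move=> fi gi fg x Dx; have [_ Ta Tp _ _] := hT.
have -> : g = f \+ (g \- f) by apply/funext => y /=; rewrite subrKC.
rewrite Ta//; last exact: L1B.
by rewrite lerDl Tp//; [exact: L1B|move=> y Dy /=; rewrite subr_ge0 fg].
Qed.

(** [T] acts on functions on the whole space, so equality on [D] has to be carried through [T];
    monotonicity in both directions does this. *)
Lemma contraction_eq f g : L1 f -> L1 g -> (forall x, D x -> f x = g x) ->
  forall x, D x -> T f x = T g x.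
Proof.
move=> fi gi fg x Dx; apply/eqP; rewrite eq_le !contraction_le//;
  by move=> y Dy; rewrite fg.
Qed.

Lemma contraction_norm f x : L1 f -> D x -> `|T f x| <= T (fun y => `|f y|) x.
Proof.
move=> fi Dx; have [_ Ta Tp _ Tc] := hT.
have fn := L1_normr fi.
have TN : T (\- f) x = - T f x.
  apply/eqP; rewrite -addr_eq0 addrC -Ta//; last exact: L1N.
  apply/eqP; rewrite -(Tc 0 x Dx); apply: contraction_eq => //.
  - exact/L1D/L1N.
  - exact: L1cst.
  - by move=> y _ /=; rewrite subrr.
rewrite ler_norml; apply/andP; split.
  rewrite lerNl -TN; apply: contraction_le => //; first exact: L1N.
  by move=> y _ /=; rewrite -normrN ler_norm.
by apply: contraction_le => // y _; exact: ler_norm.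
Qed.

Lemma L1_iter f j : L1 f -> L1 (iter j T f).
Proof. by move=> fi; elim: j => //= j; exact: TL1. Qed.

Lemma iter_contraction_ge0 f j : L1 f -> (forall x, D x -> 0 <= f x) ->
  forall x, D x -> 0 <= iter j T f x.
Proof.
move=> fi f0; elim: j => [//|j ih] x Dx /=; have [_ _ Tp _ _] := hT.
by apply: Tp => //; exact: L1_iter.
Qed.

Lemma iter_contraction_norm f j : L1 f -> forall x, D x ->
  `|iter j T f x| <= iter j T (fun y => `|f y|) x.
Proof.
move=> fi; elim: j => [//|j ih] x Dx /=.
apply: (le_trans (contraction_norm (L1_iter j fi) Dx)).
apply: contraction_le => //; first exact/L1_normr/L1_iter.
exact/L1_iter/L1_normr.
Qed.

Lemma L1_ergodic_sum f n : L1 f -> L1 (ergodic_sum f n).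
Proof. by move=> fi; apply: L1_sum => i; exact: L1_iter. Qed.

Lemma ergodic_sumS f n x : L1 f -> D x ->
  ergodic_sum f n.+1 x = f x + T (ergodic_sum f n) x.
Proof.
move=> fi Dx; have [_ Ta _ _ Tc] := hT.
elim: n => [|n ih].
  rewrite [LHS]big_nat1 /= -[LHS]addr0; congr (_ + _).
  rewrite -[LHS](Tc 0 x Dx); apply: contraction_eq => //; first exact: L1cst.
    exact: L1_ergodic_sum.
  by move=> y _; rewrite /ergodic_sum big_nil.
have -> : ergodic_sum f n.+1 = ergodic_sum f n \+ iter n T f.
  by apply/funext => y; rewrite /ergodic_sum big_nat_recr.
rewrite Ta//; [|exact: L1_ergodic_sum|exact: L1_iter].
by rewrite addrA -ih /ergodic_sum big_nat_recr.
Qed.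

Fixpoint ergodic_max (f : X -> R) (n : nat) : X -> R :=
  if n is m.+1 then ergodic_max f m \max ergodic_sum f n else cst 0.

Lemma L1_ergodic_max f n : L1 f -> L1 (ergodic_max f n).
Proof.
move=> fi; elim: n => [|n ih] /=; first exact: L1cst.
by apply: L1_max => //; exact: L1_ergodic_sum.
Qed.

Lemma ergodic_max_ge0 f n x : 0 <= ergodic_max f n x.
Proof. by elim: n => //= n ih; rewrite le_max ih. Qed.

Lemma ergodic_max_ge f n k x : (k <= n)%N -> ergodic_sum f k x <= ergodic_max f n x.
Proof.
elim: n k => [|n ih] k; first by rewrite leqn0 => /eqP ->; rewrite /ergodic_sum big_nil.
rewrite leq_eqVlt => /predU1P[->|kn] /=; first by rewrite le_max lexx orbT.
by rewrite le_max ih.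
Qed.

Lemma ergodic_maxP f n x : 0 < ergodic_max f n x ->
  exists k, (k < n)%N /\ ergodic_max f n x = ergodic_sum f k.+1 x.
Proof.
elim: n => [|n ih] /=; first by rewrite ltxx.
case: (leP (ergodic_max f n x) (ergodic_sum f n.+1 x)) => [_ _|_ M0].
  by exists n.
have [k [kn kE]] := ih M0.
by exists k; split => //; exact: ltnW.
Qed.

(* Garsia's proof of Hopf's lemma: where the maximum M of the partial sums is
   positive it is attained at some S_(k+1) = f + T S_k <= f + T M. *)
Theorem hopf_maximal (g : X -> R) (n : nat) (lam : R) :
  L1 g -> (forall x, D x -> 0 <= g x) ->
  let E := [set x | D x /\ exists2 k, (0 < k <= n)%N &
                           lam * k%:R < ergodic_sum g k x] in
  measurable E /\ lam * fine (mu E) <= I g.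
Proof.
move=> gi g0 E; have [_ Ta Tp Ti Tc] := hT.
(* The partial sums of f are those of g minus lam k, because [T] fixes constants; so [E] becomes the
   set where the maximum [M] is positive. *)
pose f := g \+ cst (- lam).
have fi : L1 f by apply: L1D gi (L1cst _).
have iterf j x : D x -> iter j T f x = iter j T g x - lam.
  elim: j x => [//|j ih] x Dx /=.
  rewrite (@contraction_eq _ (iter j T g \+ cst (- lam)))//.
  - by rewrite Ta ?Tc//; [exact: L1_iter|exact: L1cst].
  - exact: L1_iter.
  - by apply: L1D; [exact: L1_iter|exact: L1cst].
have sumf k x : D x -> ergodic_sum f k x = ergodic_sum g k x - lam * k%:R.
  move=> Dx; rewrite /ergodic_sum.
  under eq_bigr do rewrite iterf//.
  by rewrite sumrB big_const_nat subn0 iter_addr_0 mulr_natr.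
pose M := ergodic_max f n.
have Mi : L1 M by exact: L1_ergodic_max.
have EE : E = D `&` (M @^-1` `]0, +oo[).
  apply/seteqP; split => x /=; rewrite in_itv/= andbT.
    move=> [Dx [k /andP[k0 kn] lk]]; split => //.
    by apply: lt_le_trans (ergodic_max_ge f x kn); rewrite sumf// subr_gt0.
  move=> [Dx M0]; have [k [kn kE]] := ergodic_maxP M0; split => //.
  exists k.+1 => //; rewrite -subr_gt0 -sumf//.
  by rewrite -kE.
have mE : measurable E.
  by rewrite EE; have /measurable_EFinP := measurable_int _ Mi; apply.
split => //.
have Ei : L1 (fun x => lam * \1_E x) by exact/L1Z/L1_indic.
have MTi : L1 (M \- T M) by apply: L1B => //; exact: TL1.
have I0 : I (M \- T M) = 0.
  by rewrite RintegralB//; [rewrite Ti// subrr|exact: TL1].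
have IE : I (fun x => lam * \1_E x) = lam * fine (mu E).
  rewrite RintegralZl//; last exact: L1_indic.
  rewrite /Rintegral integral_indic// setIidl// => x; by case.
(* It remains to integrate M - T M + lam 1_E <= g. On [E], M <= f + T M = g - lam + T M; off [E], M
   = 0 while T M and g are nonnegative. *)
rewrite -IE -[leLHS]add0r -I0 -RintegralD//.
apply: le_Rintegral => //; first exact: L1D.
move=> x Dx /=; rewrite indicE.
have TM0 : 0 <= T M x by apply: Tp => // y _; exact: ergodic_max_ge0.
case: (boolP (x \in E)) => [|xE]; last first.
  rewrite mulr0 addr0; apply: (@le_trans _ _ 0); last exact: g0.
  have [M0|] := ltP 0 (M x); last by move=> M0; rewrite subr_le0 (le_trans M0).
  by move: xE; rewrite EE notin_setE /=; case; split => //; rewrite in_itv/= M0.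
rewrite mulr1 EE inE /= in_itv/= andbT => -[_ /ergodic_maxP[k [kn Mk]]].
rewrite [X in X - _]Mk ergodic_sumS//.
have : T (ergodic_sum f k) x <= T M x.
  apply: contraction_le => //; first exact: L1_ergodic_sum.
  by move=> y _; apply: ergodic_max_ge; exact: ltnW.
rewrite /f /=; lra.
Qed.

End hopf.

(** * Subordination to the one-sided 1/2-stable law *)

Section abel.
Context {R : realType}.

(** Summation by parts: the partial sums S k of a i - B are nonpositive, so replacing the factor psi
    k.-1 by the smaller psi k can only increase the product with S k. *)
Lemma abel_sum_le (psi a : nat -> R) (B : R) (n : nat) :
  (forall i, psi i.+1 <= psi i) -> (forall i, 0 <= psi i) ->
  (forall k, (k <= n)%N -> \sum_(0 <= i < k) a i <= k%:R * B) ->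
  \sum_(0 <= i < n) psi i * a i <= B * \sum_(0 <= i < n) psi i.
Proof.
move=> dpsi psi0 ha.
pose S k := \sum_(0 <= i < k) (a i - B).
have S0 k : (k <= n)%N -> S k <= 0.
  move=> /ha; rewrite /S sumrB big_const_nat subn0 iter_addr_0 subr_le0.
  by rewrite mulr_natl.
suff : forall k, (k <= n)%N -> \sum_(0 <= i < k) psi i * (a i - B) <= psi k.-1 * S k.
  move=> /(_ n (leqnn n)); under eq_bigr do rewrite mulrBr.
  rewrite sumrB -mulr_suml => h; rewrite -subr_le0 mulrC (le_trans h)//.
  by rewrite mulr_ge0_le0// S0.
elim=> [|k ih] kn; first by rewrite /S !big_nil mulr0.
rewrite /S !big_nat_recr//= [leRHS]mulrDr lerD2r.
apply: (le_trans (ih (ltnW kn))); apply: ler_wnM2r; first exact/S0/ltnW.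
by case: k {ih kn}.
Qed.

End abel.

Section subordination.
Context {R : realType}.
Variables (E : R -> R) (e0 e1 : R).
Hypotheses (dE : forall x : R, is_derive x 1 E (expR (- x ^+ 2)))
  (E0 : E x @[x --> -oo] --> e0) (E1 : E x @[x --> +oo] --> e1)
  (e01 : e0 < e1) (Eb : forall x, e0 <= E x <= e1).
Let N := e1 - e0.
Let N0 : 0 < N. Proof. by rewrite subr_gt0. Qed.

(* Up to an additive constant, [hit t m z] is the integral over 0 < s < z^2 of
   exp(-m^2 s) against the first-passage density t / (2 sqrt(pi) s^(3/2)) exp(-t^2/(4 s)),
   whose Laplace transform at m^2 is exp(-t m); [e1 - e0] plays the role of sqrt(pi). *)
Definition hit (t m z : R) : R :=
  - N^-1 * (expR (- (t * m)) * E (t / 2 * z^-1 - m * z) +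
            expR (t * m) * E (t / 2 * z^-1 + m * z)).

Let dhit (t m z : R) : R :=
  t / N * z ^- 2 * expR (- (t / 2 * z^-1) ^+ 2 - (m * z) ^+ 2).

(** With u = t / (2 z) and v = m z one has t m = 2 u v, so both Gaussian terms carry the same factor
    exp(-u^2 - v^2) and the contributions of +m and -m cancel. *)
Lemma is_derive_hit (t m z : R) : 0 < z -> is_derive z 1 (hit t m) (dhit t m z).
Proof.
move=> z0; have zn0 : z != 0 by rewrite gt_eqF.
have dinv : is_derive z 1 (fun y : R => t / 2 * y^-1) (t / 2 * (- 1 / z ^+ 2)).
  by apply: is_derive_scalef; apply: (@is_derive_invf _ id) => //; exact: is_derive_id.
have dlin : is_derive z 1 (fun y : R => m * y) (m * 1).
  by apply: is_derive_scalef; exact: is_derive_id.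
have d1 := is_derive_comp (dE _) (is_derive_subf dinv dlin).
have d2 := is_derive_comp (dE _) (is_derive_addf dinv dlin).
have d3 := is_derive_scalef (- N^-1) (is_derive_addf
  (is_derive_scalef (expR (- (t * m))) d1) (is_derive_scalef (expR (t * m)) d2)).
apply: is_derive_eq d3 _.
rewrite /dhit mulr1.
set u := t / 2 * z^-1; set v := m * z.
have tm : t * m = 2 * u * v by rewrite /u /v; field.
have -> : expR (- (t * m)) * (expR (- (u - v) ^+ 2) * (t / 2 * (-1 / z ^+ 2) - m)) =
    expR (- u ^+ 2 - v ^+ 2) * (t / 2 * (-1 / z ^+ 2) - m).
  by rewrite mulrA -expRD; congr (expR _ * _); rewrite tm; ring.
have -> : expR (t * m) * (expR (- (u + v) ^+ 2) * (t / 2 * (-1 / z ^+ 2) + m)) =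
    expR (- u ^+ 2 - v ^+ 2) * (t / 2 * (-1 / z ^+ 2) + m).
  by rewrite mulrA -expRD; congr (expR _ * _); rewrite tm; ring.
by field; rewrite zn0 gt_eqF.
Qed.

Lemma hit_incr (t m z1 z2 : R) : 0 <= t -> 0 < z1 -> z1 <= z2 -> hit t m z1 <= hit t m z2.
Proof.
move=> t0 z10 z12.
apply: (@is_derive_ge0_le_cc _ (hit t m) (dhit t m) _ _ z12) => z /andP[z1z _].
  by apply: is_derive_hit; exact: lt_le_trans z1z.
by rewrite /dhit !mulr_ge0 ?expR_ge0 ?invr_ge0 ?exprn_ge0 ?(ltW N0)// ltW// (lt_le_trans z10).
Qed.

(** The derivative for m is exp(-(m z)^2) times the one for m = 0, and this factor decreases from z1
    to z2. *)
Lemma hit_diff (t m z1 z2 : R) : 0 <= t -> 0 < z1 -> z1 <= z2 ->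
  expR (- (m * z2) ^+ 2) * (hit t 0 z2 - hit t 0 z1) <= hit t m z2 - hit t m z1 <=
  expR (- (m * z1) ^+ 2) * (hit t 0 z2 - hit t 0 z1).
Proof.
move=> t0 z10 z12.
have dh m' z : z1 <= z -> is_derive z 1 (hit t m') (dhit t m' z).
  by move=> z1z; apply: is_derive_hit; exact: lt_le_trans z1z.
have pos z : z1 <= z -> 0 <= t / N * z ^- 2 * expR (- (t / 2 * z^-1) ^+ 2).
  move=> z1z.
  by rewrite !mulr_ge0 ?expR_ge0 ?invr_ge0 ?exprn_ge0 ?(ltW N0)// ltW// (lt_le_trans z10).
have split_exp m' z : expR (- (t / 2 * z^-1) ^+ 2 - (m' * z) ^+ 2) =
    expR (- (t / 2 * z^-1) ^+ 2) * expR (- (m' * z) ^+ 2) by rewrite -expRD.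
have sqr_le x y : 0 <= x <= y -> (m * x) ^+ 2 <= (m * y) ^+ 2.
  move=> /andP[x0 xy]; rewrite !exprMn ler_wpM2l ?sqr_ge0//.
  by rewrite lerXn2r ?nnegrE// (le_trans x0).
apply/andP; split.
- rewrite -subr_ge0.
  have -> : hit t m z2 - hit t m z1 - expR (- (m * z2) ^+ 2) * (hit t 0 z2 - hit t 0 z1)
    = (hit t m z2 - expR (- (m * z2) ^+ 2) * hit t 0 z2) -
      (hit t m z1 - expR (- (m * z2) ^+ 2) * hit t 0 z1) by ring.
  rewrite subr_ge0.
  apply: (@is_derive_ge0_le_cc _ (fun z => hit t m z - expR (- (m * z2) ^+ 2) * hit t 0 z)
    (fun z => dhit t m z - expR (- (m * z2) ^+ 2) * dhit t 0 z) _ _ z12) => z /andP[z1z zz2].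
    by apply: is_derive_subf; [exact: dh|apply: is_derive_scalef; exact: dh].
  rewrite /dhit !split_exp mul0r expr0n/= oppr0 expR0 mulr1.
  rewrite [leRHS](_ : _ = t / N * z ^- 2 * expR (- (t / 2 * z^-1) ^+ 2) *
    (expR (- (m * z) ^+ 2) - expR (- (m * z2) ^+ 2))); last by ring.
  rewrite mulr_ge0 ?pos// subr_ge0 ler_expR lerN2 sqr_le// zz2 andbT.
  exact: le_trans (ltW z10) z1z.
- rewrite -subr_ge0.
  have -> : expR (- (m * z1) ^+ 2) * (hit t 0 z2 - hit t 0 z1) - (hit t m z2 - hit t m z1)
    = (expR (- (m * z1) ^+ 2) * hit t 0 z2 - hit t m z2) -
      (expR (- (m * z1) ^+ 2) * hit t 0 z1 - hit t m z1) by ring.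
  rewrite subr_ge0.
  apply: (@is_derive_ge0_le_cc _ (fun z => expR (- (m * z1) ^+ 2) * hit t 0 z - hit t m z)
    (fun z => expR (- (m * z1) ^+ 2) * dhit t 0 z - dhit t m z) _ _ z12) => z /andP[z1z zz2].
    by apply: is_derive_subf; [apply: is_derive_scalef; exact: dh|exact: dh].
  rewrite /dhit !split_exp mul0r expr0n/= oppr0 expR0 mulr1.
  rewrite [leRHS](_ : _ = t / N * z ^- 2 * expR (- (t / 2 * z^-1) ^+ 2) *
    (expR (- (m * z1) ^+ 2) - expR (- (m * z) ^+ 2))); last by ring.
  by rewrite mulr_ge0 ?pos// subr_ge0 ler_expR lerN2 sqr_le// z1z (ltW z10).
Qed.

(** The variable z is the square root of time, so the nodes correspond to the times (i + 1) / M;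
    [hitw] is the mass of the hitting-time law between two consecutive times. *)
Definition node (M i : nat) : R := Num.sqrt (i.+1%:R / M%:R).

Definition hitw (t : R) (M i : nat) : R := hit t 0 (node M i.+1) - hit t 0 (node M i).

(** A left-endpoint sum for the Laplace transform at m^2. With M^2 - 1 intervals the times run from
    1/M to M, so the mesh shrinks while the range exhausts the half-line. *)
Definition hitsum (t m : R) (M : nat) : R :=
  \sum_(0 <= i < (M ^ 2).-1) hitw t M i * expR (- (m ^+ 2 * (i.+1%:R / M%:R))).

Lemma node_gt0 M i : (0 < M)%N -> 0 < node M i.
Proof. by move=> M0; rewrite sqrtr_gt0 divr_gt0 ?ltr0n. Qed.

Lemma node_le M i : (0 < M)%N -> node M i <= node M i.+1.
Proof.
move=> M0; rewrite ler_sqrt ?divr_ge0 ?ler0n// ler_pM2r ?invr_gt0 ?ltr0n//.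
by rewrite ler_nat.
Qed.

Lemma sqr_node m M i : (m * node M i) ^+ 2 = m ^+ 2 * (i.+1%:R / M%:R).
Proof. by rewrite exprMn sqr_sqrtr// divr_ge0 ?ler0n. Qed.

Lemma hitw_ge0 t M i : 0 <= t -> (0 < M)%N -> 0 <= hitw t M i.
Proof. by move=> t0 M0; rewrite subr_ge0 hit_incr ?node_gt0 ?node_le. Qed.

Lemma hitsum_ge t m M : 0 <= t -> (0 < M)%N ->
  hit t m (node M (M ^ 2).-1) - hit t m (node M 0) <= hitsum t m M.
Proof.
move=> t0 M0; rewrite -(telescope_sumr (fun i => hit t m (node M i)))//.
apply: ler_sum => i _; rewrite -sqr_node mulrC.
by have /andP[_] := hit_diff m t0 (node_gt0 i M0) (node_le i M0).
Qed.

(** On each interval the left-endpoint exponential is the right-endpoint one times exp(m^2 / M), as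
    consecutive times differ by 1/M. *)
Lemma hitsum_le t m M : 0 <= t -> (0 < M)%N ->
  hitsum t m M <=
  expR (m ^+ 2 / M%:R) * (hit t m (node M (M ^ 2).-1) - hit t m (node M 0)).
Proof.
move=> t0 M0; rewrite -(telescope_sumr (fun i => hit t m (node M i)))// mulr_sumr.
apply: ler_sum => i _.
have /andP[h _] := hit_diff m t0 (node_gt0 i M0) (node_le i M0).
apply: le_trans (ler_wpM2l (expR_ge0 (m ^+ 2 / M%:R)) h).
rewrite [leRHS]mulrA -expRD sqr_node mulrC; apply: ler_wpM2r; first exact: hitw_ge0.
rewrite ler_expR -[i.+2]addn1 natrD le_eqVlt; apply/orP; left; apply/eqP.
by field; rewrite pnatr_eq0 -lt0n.
Qed.

(* 4 u^3 <= 4 expR (u^2) for u = t / (2 z) bounds the density of the hitting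
   time in the variable z^2. *)
Lemma hitw_le_cst (t : R) M i : 0 < t -> (0 < M)%N ->
  hitw t M i <= 4 / (N * t ^+ 2 * M%:R).
Proof.
move=> t0 M0; pose K := 4 / (N * t ^+ 2).
have z0 := node_gt0 i M0.
have -> : 4 / (N * t ^+ 2 * M%:R) = K * node M i.+1 ^+ 2 - K * node M i ^+ 2.
  rewrite !sqr_sqrtr ?divr_ge0 ?ler0n// /K -[i.+2]addn1 natrD.
  by field; rewrite pnatr_eq0 -lt0n M0 !gt_eqF.
suff : K * node M i ^+ 2 - hit t 0 (node M i) <=
    K * node M i.+1 ^+ 2 - hit t 0 (node M i.+1) by rewrite /hitw; lra.
apply: (@is_derive_ge0_le_cc _ (fun z => K * z ^+ 2 - hit t 0 z)
  (fun z => K * (2 * z) - dhit t 0 z) _ _ (node_le i M0)) => z /andP[z1 z2].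
  apply: is_derive_subf; last by apply: is_derive_hit; exact: lt_le_trans z1.
  apply: is_derive_scalef; apply: is_derive_eq (is_deriveX 2 (is_derive_id z 1)) _.
  by rewrite /GRing.scale/= mulr1 expr1.
have {z1 z2}z0' : 0 < z by exact: lt_le_trans z1.
rewrite /dhit mul0r expr0n/= subr0; set u := t / 2 * z^-1.
have u0 : 0 < u by rewrite /u !mulr_gt0 ?invr_gt0.
have tE : t = 2 * u * z by rewrite /u; field; rewrite gt_eqF.
(* From exp(u^2) >= (1 + u^2/2)^2 and (1 + u^2/2)^2 - u^3 = 1 + (u (1 - u/2))^2. *)
have ue : u ^+ 3 * expR (- u ^+ 2) <= 1.
  rewrite expRN ler_pdivrMr ?expR_gt0// mul1r.
  have -> : u ^+ 2 = u ^+ 2 / 2 + u ^+ 2 / 2 by field.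
  rewrite expRD; have h := expR_ge1Dx (u ^+ 2 / 2).
  have h0 : 0 <= 1 + u ^+ 2 / 2 by rewrite addr_ge0 ?divr_ge0 ?sqr_ge0.
  apply: le_trans (ler_pM h0 h0 h h).
  suff : 0 <= 1 + (u * (1 - u / 2)) ^+ 2 by nra.
  by rewrite addr_ge0// sqr_ge0.
have -> : K * (2 * z) - t / N * z ^- 2 * expR (- u ^+ 2) =
    2 / (N * z * u ^+ 2) * (1 - u ^+ 3 * expR (- u ^+ 2)).
  by rewrite /K tE; field; rewrite !gt_eqF.
by rewrite mulr_ge0 ?subr_ge0// divr_ge0// !mulr_ge0 ?sqr_ge0// ?ltW ?invr_gt0.
Qed.

(** The Gaussian factor of the density is bounded by 1, leaving the integral of t / (N z^2). This
    serves for times beyond t^2, the constant bound for times before it. *)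
Lemma hitw_le_inv (t : R) M i : 0 < t -> (0 < M)%N ->
  hitw t M i <= t / N * ((node M i)^-1 - (node M i.+1)^-1).
Proof.
move=> t0 M0; have z0 := node_gt0 i M0; have z1 := node_gt0 i.+1 M0.
have xy : t / 2 * (node M i.+1)^-1 <= t / 2 * (node M i)^-1.
  by rewrite ler_pM2l ?divr_gt0// lef_pV2 ?posrE// node_le.
have h : t / 2 * (node M i.+1)^-1 - E (t / 2 * (node M i.+1)^-1) <=
    t / 2 * (node M i)^-1 - E (t / 2 * (node M i)^-1).
  apply: (@is_derive_ge0_le_cc _ (fun x => x - E x) (fun x => 1 - expR (- x ^+ 2))
    _ _ xy) => x _.
  by rewrite subr_ge0 expR_le1 oppr_le0 sqr_ge0.
rewrite /hitw /hit !mul0r !subr0 !addr0 mulr0 oppr0 expR0 !mul1r.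
rewrite -subr_ge0 [leRHS](_ : _ = 2 / N *
  ((t / 2 * (node M i)^-1 - E (t / 2 * (node M i)^-1)) -
   (t / 2 * (node M i.+1)^-1 - E (t / 2 * (node M i.+1)^-1)))); last first.
  by field; rewrite !gt_eqF.
by rewrite mulr_ge0 ?subr_ge0// divr_ge0// ltW.
Qed.

(** A decreasing majorant of the weights with bounded mass; the weights themselves need not be
    monotone, as the hitting-time density first rises. *)
Let psi (t : R) M i :=
  Num.min (4 / (N * t ^+ 2 * M%:R)) (t / N * ((node M i)^-1 - (node M i.+1)^-1)).

Let psi_ge0 (t : R) M i : 0 < t -> (0 < M)%N -> 0 <= psi t M i.
Proof.
move=> t0 M0; have h : 0 <= 4 / (N * t ^+ 2 * M%:R).
  by rewrite divr_ge0// mulr_ge0// mulr_ge0 ?sqr_ge0// ltW.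
rewrite le_min h/= mulr_ge0 ?divr_ge0 ?(ltW N0) ?(ltW t0)// subr_ge0.
by rewrite lef_pV2 ?posrE ?node_gt0// node_le.
Qed.

Let psi_decr (t : R) M i : 0 < t -> (0 < M)%N -> psi t M i.+1 <= psi t M i.
Proof.
move=> t0 M0; suff h : t / N * ((node M i.+1)^-1 - (node M i.+2)^-1) <=
    t / N * ((node M i)^-1 - (node M i.+1)^-1).
  by rewrite le_min !ge_min lexx/= h orbT.
rewrite ler_wpM2l ?divr_ge0 ?(ltW N0) ?(ltW t0)//.
have x0 := node_gt0 i M0; have y0 := node_gt0 i.+1 M0; have z0 := node_gt0 i.+2 M0.
have xy := node_le i M0; have yz := node_le i.+1 M0.
have Mn0 : M%:R != 0 :> R by rewrite pnatr_eq0 -lt0n.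
have step j : node M j.+1 ^+ 2 - node M j ^+ 2 = M%:R^-1.
  rewrite !sqr_sqrtr ?divr_ge0 ?ler0n// -[j.+2]addn1 natrD; by field.
(* The squares of consecutive nodes differ by 1/M, so the differences of reciprocals have a fixed
   numerator and an increasing denominator. *)
have diff (x y : R) : 0 < x -> 0 < y -> y ^+ 2 - x ^+ 2 = M%:R^-1 ->
    x^-1 - y^-1 = M%:R^-1 / (x * y * (x + y)).
  by move=> x0' y0' <-; field; rewrite !gt_eqF// addr_gt0.
rewrite !diff// ler_pM2l ?invr_gt0 ?ltr0n// lef_pV2 ?posrE ?mulr_gt0 ?addr_gt0//.
have [x0' y0'] := (ltW x0, ltW y0).
apply: ler_pM; rewrite ?lerD ?addr_ge0 ?mulr_ge0//.
by rewrite mulrC ler_wpM2l// (le_trans xy).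
Qed.

(** The first j0 <= t^2 M terms are each at most 4 / (N t^2 M), in total 4/N. The others telescope
    to at most t / (N node j0) <= 1/N, since node j0 >= t. *)
Let psi_sum (t : R) M n : 0 < t -> (0 < M)%N ->
  \sum_(0 <= i < n) psi t M i <= 5 / N.
Proof.
move=> t0 M0; pose j0 := Num.truncn (t ^+ 2 * M%:R).
have tM0 : 0 <= t ^+ 2 * M%:R by rewrite mulr_ge0 ?sqr_ge0.
have tM1 : 0 < t ^+ 2 * M%:R by rewrite mulr_gt0 ?exprn_gt0 ?ltr0n.
have /andP[j0le j0gt] := truncn_itv tM0; rewrite -/j0 in j0le j0gt.
have head k : (k <= j0)%N -> \sum_(0 <= i < k) psi t M i <= 4 / N.
  move=> kj; apply: (@le_trans _ _ (\sum_(0 <= i < k) 4 / (N * t ^+ 2 * M%:R))).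
    by apply: ler_sum => i _; rewrite ge_min lexx.
  rewrite big_const_nat subn0 iter_addr_0 -[leLHS]mulr_natr.
  have -> : 4 / (N * t ^+ 2 * M%:R) = 4 / N * (t ^+ 2 * M%:R)^-1.
    by field; rewrite pnatr_eq0 -lt0n M0 !gt_eqF.
  rewrite -mulrA ger_pMr ?divr_gt0// mulrC ler_pdivrMr// mul1r.
  by apply: le_trans j0le; rewrite ler_nat.
have [nj|jn] := leqP n j0.
  apply: le_trans (head _ nj) _; rewrite ler_pM2r ?invr_gt0//; lra.
rewrite (big_cat_nat (n := j0))//= ?(ltnW jn)//.
have -> : 5 / N = 4 / N + 1 / N by field; rewrite gt_eqF.
apply: lerD; first exact: head.
apply: (@le_trans _ _ (\sum_(j0 <= i < n)
    (- (t / N * (node M i.+1)^-1) - - (t / N * (node M i)^-1)))).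
  by apply: ler_sum => i _; rewrite ge_min mulrBr opprK addrC lexx orbT.
rewrite telescope_sumr ?(ltnW jn)// opprK.

have tnode : t <= node M j0.
  rewrite -[leLHS]ger0_norm ?(ltW t0)// -sqrtr_sqr ler_sqrt ?divr_ge0 ?ler0n//.
  by rewrite ler_pdivlMr ?ltr0n// ltW.
have h1 : 0 <= t / N / node M n.
  by rewrite !divr_ge0 ?(ltW t0) ?(ltW N0)// ltW// node_gt0.
have h2 : t / N / node M j0 <= 1 / N.
  rewrite mulrAC ler_pM2r ?invr_gt0// ler_pdivrMr ?mul1r//.
  exact: lt_le_trans tnode.
lra.
Qed.

Lemma hitw_sum_le (t : R) M (a : nat -> R) (B : R) n : 0 < t -> (0 < M)%N ->
  0 <= B -> (forall i, 0 <= a i) ->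
  (forall k, (k <= n)%N -> \sum_(0 <= i < k) a i <= k%:R * B) ->
  \sum_(0 <= i < n) hitw t M i * a i <= B * (5 / N).
Proof.
move=> t0 M0 B0 a0 ha.
apply: le_trans (ler_wpM2l B0 (psi_sum n t0 M0)).
apply: le_trans (abel_sum_le _ _ ha).
- apply: ler_sum => i _; apply: ler_wpM2r => //.
  by rewrite le_min hitw_le_cst// hitw_le_inv.
- by move=> i; exact: psi_decr.
- by move=> i; exact: psi_ge0.
Qed.

Lemma cvg_sqrt_nat : (Num.sqrt M%:R : R) @[M --> \oo] --> +oo.
Proof.
apply/cvgryPge => A; near=> M.
rewrite (le_trans (ler_norm A))// -sqrtr_sqr ler_wsqrtr//.
near: M; exact: nbhs_infty_ger.
Unshelve. all: by end_near. Qed.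

Lemma cvg_affine_sqrt (a b : R) : 0 < a ->
  a * Num.sqrt M%:R + b * (Num.sqrt M%:R)^-1 @[M --> \oo] --> +oo.
Proof.
move=> a0; apply/cvgryPge => A; near=> M.
have s1 : 1 <= Num.sqrt M%:R :> R.
  by near: M; move/cvgryPge : cvg_sqrt_nat; exact.
have s2 : (A + `|b|) / a <= Num.sqrt M%:R :> R.
  by near: M; move/cvgryPge : cvg_sqrt_nat; exact.
rewrite ler_pdivrMr// mulrC in s2.
have : - `|b| <= b * (Num.sqrt M%:R)^-1.
  rewrite lerNl -mulNr (le_trans (ler_norm _))// normrM normrN ler_piMr// ger0_norm//.
    by rewrite invf_le1// (lt_le_trans ltr01).
lra.
Unshelve. all: by end_near. Qed.

Lemma node_last M : (0 < M)%N -> node M (M ^ 2).-1 = Num.sqrt M%:R.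
Proof.
move=> M0; rewrite /node prednK ?expn_gt0 ?M0// natrX expr2 mulfK//.
by rewrite pnatr_eq0 -lt0n.
Qed.

Lemma node_first M : node M 0 = (Num.sqrt M%:R)^-1.
Proof. by rewrite /node mul1r sqrtrV ?ler0n. Qed.

(** The limits of [hit] for z -> +oo and z -> 0. Their difference exp(-t m) is the Laplace transform
    of the hitting-time law. *)
Let hit_infty (t m : R) := - N^-1 * (expR (- (t * m)) * e0 + expR (t * m) * e1).
Let hit_zero (t m : R) := - N^-1 * (expR (- (t * m)) * e1 + expR (t * m) * e1).

Let hit_infty_zero (t m : R) : hit_infty t m - hit_zero t m = expR (- (t * m)).
Proof. by rewrite /hit_infty /hit_zero /N; field; rewrite gt_eqF. Qed.

Lemma cvg_hit_infty (t m : R) : 0 < m ->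
  hit t m (node M (M ^ 2).-1) @[M --> \oo] --> hit_infty t m.
Proof.
move=> m0.
apply: (@cvg_trans _ (hit t m (Num.sqrt M%:R) @[M --> \oo])).
  by apply: near_eq_cvg; near=> M; rewrite node_last//; near: M; exists 1%N.
apply: cvgMr; apply: cvgD; apply: cvgMr.
- have /cvgNy_compNP h := E0.
  rewrite (_ : (fun M => _) = (E \o -%R) \o
      (fun M => m * Num.sqrt M%:R + (- (t / 2)) * (Num.sqrt M%:R)^-1)).
    exact: cvg_comp (cvg_affine_sqrt _ m0) h.
  by apply/funext => M /=; congr E; ring.
- rewrite (_ : (fun M => _) = E \o
      (fun M => m * Num.sqrt M%:R + (t / 2) * (Num.sqrt M%:R)^-1)).
    exact: cvg_comp (cvg_affine_sqrt _ m0) E1.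
  by apply/funext => M /=; congr E; ring.
Unshelve. all: by end_near. Qed.

Lemma cvg_hit_zero (t m : R) : 0 < t ->
  hit t m (node M 0) @[M --> \oo] --> hit_zero t m.
Proof.
move=> t0; have t20 : 0 < t / 2 by rewrite divr_gt0.
apply: cvgMr; apply: cvgD; apply: cvgMr.
- rewrite (_ : (fun M => _) = E \o
      (fun M => t / 2 * Num.sqrt M%:R + - m * (Num.sqrt M%:R)^-1)).
    exact: cvg_comp (cvg_affine_sqrt _ t20) E1.
  by apply/funext => M /=; rewrite node_first invrK mulNr.
- rewrite (_ : (fun M => _) = E \o
      (fun M => t / 2 * Num.sqrt M%:R + m * (Num.sqrt M%:R)^-1)).
    exact: cvg_comp (cvg_affine_sqrt _ t20) E1.
  by apply/funext => M /=; rewrite node_first invrK.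
Qed.

Lemma cvg_hitsum (t m : R) : 0 < t -> 0 < m ->
  hitsum t m M @[M --> \oo] --> expR (- (t * m)).
Proof.
move=> t0 m0; have t0' := ltW t0.
have hd : hit t m (node M (M ^ 2).-1) - hit t m (node M 0) @[M --> \oo] -->
    expR (- (t * m)).
  rewrite -hit_infty_zero; apply: cvgB; first exact: cvg_hit_infty.
  exact: cvg_hit_zero.
have he : expR (m ^+ 2 / M%:R) @[M --> \oo] --> (1 : R).
  rewrite -[X in _ --> X]expR0; apply: continuous_cvg; first exact: continuous_expR.
  rewrite -[X in _ --> X](mulr0 (m ^+ 2)); apply: cvgMr.
  have Mgt0 : \forall M \near \oo, 0 < M%:R :> R.
    by near=> M; rewrite ltr0n; near: M; exists 1%N.
  exact: (gtr0_cvgV0 Mgt0).2 cvgr_idn.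
have hu : expR (m ^+ 2 / M%:R) *
    (hit t m (node M (M ^ 2).-1) - hit t m (node M 0)) @[M --> \oo] --> expR (- (t * m)).
  by rewrite -[X in _ --> X]mul1r; apply: cvgM.
apply: (squeeze_cvgr _ hd hu); near=> M.
have M0 : (0 < M)%N by near: M; exists 1%N.
by rewrite hitsum_ge// hitsum_le.
Unshelve. all: by end_near. Qed.

Lemma hit_diff_le (t m z1 z2 : R) : 0 < t -> 0 < m -> 0 < z1 -> 0 < z2 ->
  hit t m z2 - hit t m z1 <= expR (- (t * m)).
Proof.
move=> t0 m0 z10 z20; rewrite -hit_infty_zero; apply: lerB.
  apply: (cvgr_to_ge (cvg_hit_infty m0)); near=> M.
  have M0 : (0 < M)%N by near: M; exists 1%N.
  rewrite hit_incr ?(ltW t0)// node_last//.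
  by near: M; move/cvgryPge : cvg_sqrt_nat; exact.
apply: (cvgr_to_le (cvg_hit_zero t0)); near=> M.
have M0 : (0 < M)%N by near: M; exists 1%N.
rewrite hit_incr ?(ltW t0) ?node_gt0// node_first -[leRHS]invrK.
rewrite lef_pV2 ?posrE ?invr_gt0 ?sqrtr_gt0 ?ltr0n//.
by near: M; move/cvgryPge : cvg_sqrt_nat; exact.
Unshelve. all: by end_near. Qed.

(** As i + 2 <= 2 (i + 1), each left-endpoint exponential for m is at most the right-endpoint one
    for m / sqrt 2, so the sum is below an increment of [hit] for m / sqrt 2. The bound is uniform
    in M and decays exponentially in m. *)
Lemma hitsum_dom (t m : R) M : 0 < t -> 0 < m -> (0 < M)%N ->
  hitsum t m M <= expR (- (t * (m / Num.sqrt 2))).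
Proof.
move=> t0 m0 M0; have m'0 : 0 < m / Num.sqrt 2 by rewrite divr_gt0// sqrtr_gt0.
apply: le_trans (hit_diff_le t0 m'0 (node_gt0 0 M0) (node_gt0 (M ^ 2).-1 M0)).
rewrite -(telescope_sumr (fun i => hit t (m / Num.sqrt 2) (node M i)))//.
apply: ler_sum => i _.
have /andP[+ _] := hit_diff (m / Num.sqrt 2) (ltW t0) (node_gt0 i M0) (node_le i M0).
apply: le_trans; rewrite mulrC; apply: ler_wpM2r; first by rewrite hitw_ge0// ltW.
rewrite ler_expR lerN2 sqr_node exprMn exprVn sqr_sqrtr// -mulrA.
rewrite ler_wpM2l ?sqr_ge0// mulrA ler_pM2r ?invr_gt0 ?ltr0n//.
rewrite ler_pdivrMl// -natrM ler_nat; lia.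
Qed.

(** Valid for every sign of m, hence also for the term n = 0. At m = 0, [hit] is -2/N times a value
    of [E], and [E] varies by at most N. *)
Lemma hitsum_le2 (t m : R) M : 0 < t -> (0 < M)%N -> 0 <= hitsum t m M <= 2.
Proof.
move=> t0 M0; apply/andP; split.
  by apply: sumr_ge0 => i _; rewrite mulr_ge0 ?expR_ge0// hitw_ge0// ltW.
apply: (@le_trans _ _ (\sum_(0 <= i < (M ^ 2).-1) (hit t 0 (node M i.+1) - hit t 0 (node M i)))).
  apply: ler_sum => i _; rewrite ler_piMr ?hitw_ge0 ?(ltW t0)//.
  by rewrite expR_le1 oppr_le0 mulr_ge0 ?sqr_ge0// divr_ge0 ?ler0n.
rewrite telescope_sumr// /hit !mul0r !subr0 !addr0 mulr0 oppr0 expR0 !mul1r.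
have /andP[h1 h2] := Eb (t / 2 * (node M (M ^ 2).-1)^-1).
have /andP[h3 h4] := Eb (t / 2 * (node M 0)^-1).
have d1 : N^-1 * (E (t / 2 * (node M 0)^-1) - E (t / 2 * (node M (M ^ 2).-1)^-1)) <= 1.
  by rewrite mulrC ler_pdivrMr// mul1r lerB.
lra.
Qed.

End subordination.

(** All that is kept of the hitting-time law: nonnegative weights, domination by Cesaro averages,
    and convergence with bounds uniform in M. *)
Theorem half_stable_subordination (R : realType) :
  exists w : R -> nat -> nat -> R, exists2 C : R, 0 <= C &
  [/\ forall t M i, 0 < t -> (0 < M)%N -> 0 <= w t M i,
      forall t M n (a : nat -> R) B, 0 < t -> (0 < M)%N -> 0 <= B ->
        (forall i, 0 <= a i) ->
        (forall k, (k <= n)%N -> \sum_(0 <= i < k) a i <= k%:R * B) ->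
        \sum_(0 <= i < n) w t M i * a i <= C * B &
      let S t m M := \sum_(0 <= i < (M ^ 2).-1)
          w t M i * expR (- (m ^+ 2 * (i.+1%:R / M%:R))) in
      [/\ forall t m, 0 < t -> 0 < m -> S t m M @[M --> \oo] --> expR (- (t * m)),
          forall t m M, 0 < t -> 0 < m -> (0 < M)%N ->
            S t m M <= expR (- (t * (m / Num.sqrt 2))) &
          forall t m M, 0 < t -> (0 < M)%N -> 0 <= S t m M <= 2]].
Proof.
have [E [e0 [e1 [dE E0 E1 e01 Eb]]]] := @exists_gauss_primitive R.
exists (hitw E e0 e1), (5 / (e1 - e0)); first by rewrite divr_ge0// subr_ge0 ltW.
split.
- by move=> t M i t0 M0; apply: hitw_ge0 => //; exact: ltW.
- by move=> t M n a B *; rewrite mulrC; exact: hitw_sum_le.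
- split.
  + by move=> t m *; exact: cvg_hitsum.
  + by move=> t m M *; exact: hitsum_dom.
  + by move=> t m M *; exact: hitsum_le2.
Qed.

(** * Comparison and dominated convergence of series *)

Section series_facts.
Context {R : realType}.
Implicit Types (u v : nat -> R).

Lemma cvg_series_abs_le u v : (forall n, `|u n| <= v n) -> cvgn (series v) ->
  cvgn (series u).
Proof.
move=> uv cv; apply: normed_cvg; apply: (@series_le_cvg _ _ v) => // n /=; first exact: normr_ge0.
exact: le_trans (normr_ge0 _) (uv n).
Qed.

Lemma series_le_lim v N : (forall n, 0 <= v n) -> cvgn (series v) ->
  series v N <= limn (series v).
Proof.
move=> v0 cv; apply: nondecreasing_cvgn_le => //.
by apply/nondecreasing_seqP => n; rewrite seriesSr lerDl.
Qed.

Lemma series_norm_le u v : (forall n, `|u n| <= v n) -> cvgn (series v) ->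
  forall N, `|series u N| <= limn (series v).
Proof.
move=> uv cv N; have v0 n : 0 <= v n by exact: le_trans (normr_ge0 _) (uv n).
apply: le_trans (series_le_lim N v0 cv).
by apply: le_trans (ler_norm_sum _ _ _) _; apply: ler_sum => i _.
Qed.

Lemma lim_series_norm_le u v : (forall n, `|u n| <= v n) -> cvgn (series v) ->
  `|limn (series u)| <= limn (series v).
Proof.
move=> uv cv; have cu := cvg_series_abs_le uv cv.
have h := series_norm_le uv cv.
rewrite ler_norml; apply/andP; split.
  by apply: limr_ge => //; near=> N; have := h N; rewrite ler_norml => /andP[].
by apply: limr_le => //; near=> N; have := h N; rewrite ler_norml => /andP[].
Unshelve. all: by end_near. Qed.

Lemma series_tail_le u v : (forall n, `|u n| <= v n) -> cvgn (series v) ->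
  forall N, `|limn (series u) - series u N| <= limn (series v) - series v N.
Proof.
move=> uv cv N; have cu := cvg_series_abs_le uv cv.
have h M : (N <= M)%N -> `|series u M - series u N| <= series v M - series v N.
  move=> NM; rewrite !sub_series_geq//.
  by apply: le_trans (ler_norm_sum _ _ _) _; apply: ler_sum => i _.
have cd : (fun M => `|series u M - series u N|) @ \oo --> `|limn (series u) - series u N|.
  by apply: cvg_norm; apply: cvgB => //; exact: cvg_cst.
have cd' : (fun M => series v M - series v N) @ \oo --> limn (series v) - series v N.
  by apply: cvgB => //; exact: cvg_cst.
apply: ler_cvg_to cd cd' _; near=> M; apply: h; near: M; exact: nbhs_infty_ge.
Unshelve. all: by end_near. Qed.

(** Dominated convergence for series: past some N the tail of v is below e/2, and the finitely many
    remaining terms tend to 0. *)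
Lemma tannery (u : nat -> nat -> R) v : cvgn (series v) ->
  (forall M n, `|u M n| <= v n) -> (forall n, u M n @[M --> \oo] --> 0) ->
  limn (series (fun n => `|u M n|)) @[M --> \oo] --> 0.
Proof.
move=> cv uv u0; apply/cvgr0Pnorm_le => e e0.
have e20 : 0 < e / 2 by rewrite divr_gt0.
have [N _ /(_ N (leqnn N))/= hN] : \forall N \near \oo, `|limn (series v) - series v N| <= e / 2.
  by move/cvgrPdist_le : (cv : series v @ \oo --> limn (series v)); apply.
have cS : series (fun n => `|u M n|) N @[M --> \oo] --> 0.
  rewrite (_ : 0 = \sum_(0 <= n < N) `|0 : R|); last by rewrite normr0 big1.
  rewrite /series /=; elim: N {hN} => [|N ih].
    by rewrite big_nil; under eq_fun do rewrite big_nil; exact: cvg_cst.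
  rewrite big_nat_recr//=; under eq_fun do rewrite big_nat_recr//=.
  by apply: cvgD => //; apply: cvg_norm; exact: u0.
move/cvgr0Pnorm_le : cS => /(_ _ e20) cS; near=> M.
have uv' n : `|(`|u M n|)| <= v n by rewrite normr_id.
have h1 := series_tail_le uv' cv N.
have h2 : `|series (fun n => `|u M n|) N| <= e / 2 by near: M.
have h3 := ler_distD (series (fun n => `|u M n|) N) (limn (series (fun n => `|u M n|))) 0.
rewrite !subr0 in h3; have h4 := ler_norm (limn (series v) - series v N).
lra.
Unshelve. all: by end_near. Qed.

(** For s = r^(1/(k+1)), (n + 1) s^n is at most 1 + s + ... + s^n, hence at most 1/(1 - s). So (n +
    1)^k r^n is bounded by a constant times s^n. *)
Lemma cvg_series_poly_geometric (r : R) k : 0 <= r < 1 ->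
  cvgn (series (fun n => n.+1%:R ^+ k * r ^+ n)).
Proof.
move=> /andP[]; rewrite le_eqVlt => /predU1P[<- _|r0 r1].
  apply: (@cvg_series_abs_le _ (fun n => 0 ^+ n)).
    move=> [|n]; first by rewrite !expr0 expr1n mulr1 normr1.
    by rewrite !exprS !mul0r mulr0 normr0.
  rewrite exprn_geometric; apply: is_cvg_geometric_series; by rewrite normr0.
pose s := r `^ (k.+1%:R^-1).
have s0 : 0 < s by rewrite powR_gt0.
have sk : s ^+ k.+1 = r by rewrite -powR_mulrn ?(ltW s0)// -powRrM mulVf// powRr1// ltW.
have s1 : s < 1.
  rewrite ltNge; apply/negP => s1; have := exprn_ege1 k.+1 s1.
  by rewrite sk leNgt r1.
have bnd n : n.+1%:R * s ^+ n <= (1 - s)^-1.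
  have -> : n.+1%:R * s ^+ n = \sum_(i < n.+1) s ^+ n.
    by rewrite sumr_const card_ord mulr_natl.
  apply: (@le_trans _ _ (\sum_(i < n.+1) s ^+ i)).
    apply: ler_sum => i _; apply: ler_wiXn2l; rewrite ?(ltW s0) ?(ltW s1)//.
    by rewrite -ltnS ltn_ord.
  have := subrX1 s n.+1; rewrite -[s - 1]opprB mulNr => h.
  rewrite -[(1 - s)^-1]mul1r ler_pdivlMr ?subr_gt0// mulrC.
  have := exprn_ge0 n.+1 (ltW s0); lra.
apply: (@cvg_series_abs_le _ (fun n => (1 - s)^-1 ^+ k * s ^+ n)).
  move=> n; rewrite ger0_norm ?mulr_ge0 ?exprn_ge0 ?ler0n ?(ltW r0)//.
  rewrite -sk -exprM mulnC exprM exprSr mulrA -exprMn.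
  rewrite ler_wpM2r ?exprn_ge0 ?(ltW s0)// lerXn2r ?nnegrE ?mulr_ge0 ?exprn_ge0 ?(ltW s0)//.
  by rewrite invr_ge0 subr_ge0 ltW.
by apply: is_cvg_geometric_series; rewrite ger0_norm ?(ltW s0).
Qed.

End series_facts.

(** * Multipliers of Jacobi expansions and the heat semigroup *)

Section expansion.
Context {R : realType} (alpha beta : R).
Hypotheses (halpha : -1 < alpha) (hbeta : -1 < beta).
Variable P : nat -> {poly R}.
Hypothesis hP : jacobi_polynomials alpha beta P.
Local Notation mu := (jacobi_measure alpha beta).
Local Notation D := (`[-1, 1]%classic : set R).
Local Notation L1 f := (mu.-integrable D (EFin \o f)).
Local Notation I f := (\int[mu]_(x in D) f x).
Local Notation h := (jacobi_h alpha beta P).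
Local Notation eig := (jacobi_eig alpha beta).

(** An abstract bound for P_n^2 / h_n, instantiated at the end by A (n + 1)^k. All kernel and
    operator bounds go through the weighted sum [coef_norm]. *)
Variable B : nat -> R.
Hypothesis h_gt0 : forall n, 0 < h n.
Hypothesis P_le : forall n x, -1 <= x <= 1 -> (P n).[x] ^+ 2 <= B n * h n.

Definition jcoef (f : R -> R) (n : nat) : R := I (fun y => (P n).[y] * f y) / h n.

Definition jop (a : nat -> R) (f : R -> R) (x : R) : R :=
  limn (series (fun n => a n * (jcoef f n * (P n).[x]))).

(** For a n = r^n this is [watson_kernel] at r. *)
Definition jker (a : nat -> R) (x y : R) : R :=
  limn (series (fun n => a n * ((P n).[x] * (P n).[y] / h n))).

Definition summable_coef (a : nat -> R) := cvgn (series (fun n => `|a n| * B n)).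

Definition coef_norm (a : nat -> R) : R := limn (series (fun n => `|a n| * B n)).

Local Notation N1 f := (I (fun y => `|f y|)).

Let mD : measurable (D : set (measurableTypeR R)). Proof. exact: measurable_itv. Qed.
Let muD : (mu D < +oo)%E. Proof. exact: jacobi_measure_lty. Qed.

Let in_D (x : R) : D x -> -1 <= x <= 1. Proof. by rewrite /= in_itv. Qed.

Let B_ge0 n : 0 <= B n.
Proof.
have := P_le n (x := 0) ltac:(lra); move=> /(le_trans (sqr_ge0 _)).
by rewrite pmulr_lge0.
Qed.

Lemma jacobi_product_le n x y : -1 <= x <= 1 -> -1 <= y <= 1 ->
  `|(P n).[x] * (P n).[y] / h n| <= B n.
Proof.
move=> /(P_le n) h1 /(P_le n) h2; rewrite normrM normfV (gtr0_norm (h_gt0 n)).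
rewrite ler_pdivrMr// normrM.
have := sqr_ge0 (`|(P n).[x]| - `|(P n).[y]|).
rewrite sqrrB !real_normK ?num_real//; lra.
Qed.

Lemma coef_norm_ge0 a : summable_coef a -> 0 <= coef_norm a.
Proof.
move=> sa; have := @series_le_lim R _ 0%N _ sa; rewrite /series /= big_nil; apply.
by move=> n; rewrite mulr_ge0.
Qed.

Let L1_mul_bounded (g f : R -> R) (K : R) : measurable_fun D g ->
  (forall x, D x -> `|g x| <= K) -> L1 f -> L1 (fun x => g x * f x).
Proof.
move=> mg gK fi; apply: (le_integrable mD _ _ (L1Z mD K fi)).
  apply/measurable_EFinP; apply: measurable_funM => //.
  by apply/measurable_EFinP; exact: measurable_int fi.
move=> x Dx /=; rewrite lee_fin !normrM ler_wpM2r//.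
by apply: le_trans (gK _ Dx) (ler_norm _).
Qed.

Let mP (p : {poly R}) : measurable_fun D (horner p).
Proof. by apply/measurable_EFinP; exact: measurable_int (jacobi_integrable_poly halpha hbeta p). Qed.

Lemma jacobi_integrable_mul_poly (p : {poly R}) f : L1 f -> L1 (fun x => p.[x] * f x).
Proof.
have [c c1 cmax] := horner_norm_max p.
by apply: (@L1_mul_bounded (horner p) f `|p.[c]|) => // x /in_D; exact: cmax.
Qed.

Lemma jcoef_le f n x : L1 f -> -1 <= x <= 1 ->
  `|jcoef f n * (P n).[x]| <= B n * N1 f.
Proof.
move=> fi x1.
have -> : jcoef f n * (P n).[x] = I (fun y => ((P n).[x] * (P n).[y] / h n) * f y).
  transitivity (I (fun y => (P n).[x] / h n * ((P n).[y] * f y))).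
    by rewrite RintegralZl ?jacobi_integrable_mul_poly// /jcoef; ring.
  by apply: eq_Rintegral => y _; ring.
have gi : L1 (fun y => ((P n).[x] * (P n).[y] / h n) * f y).
  apply: (@L1_mul_bounded _ _ (B n)) => //; last by move=> y /in_D; exact: jacobi_product_le.
  by apply: measurable_funM => //; apply: measurable_funM.
apply: le_trans (le_normr_Rintegral mD gi) _.
rewrite -RintegralZl//; last exact: L1_normr.
apply: le_Rintegral => //; first exact: (L1_normr mD gi).
  exact/L1Z/L1_normr.
by move=> y /in_D y1; rewrite normrM ler_wpM2r// jacobi_product_le.
Qed.

Section summable.
Variable a : nat -> R.
Hypothesis sa : summable_coef a.

Let ker_le n x y : -1 <= x <= 1 -> -1 <= y <= 1 ->
  `|a n * ((P n).[x] * (P n).[y] / h n)| <= `|a n| * B n.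
Proof. by move=> x1 y1; rewrite normrM ler_wpM2l// jacobi_product_le. Qed.

Let op_le f n x : L1 f -> -1 <= x <= 1 ->
  `|a n * (jcoef f n * (P n).[x])| <= `|a n| * B n * N1 f.
Proof. by move=> fi x1; rewrite normrM -mulrA ler_wpM2l// jcoef_le. Qed.

Let cvg_scaled (c : R) : cvgn (series (fun n => `|a n| * B n * c)) /\
  limn (series (fun n => `|a n| * B n * c)) = coef_norm a * c.
Proof.
have e : series (fun n => `|a n| * B n * c) = (fun n => series (fun n => `|a n| * B n) n * c).
  by apply/funext => n; rewrite /series/= mulr_suml.
have cl : (fun n => series (fun n => `|a n| * B n) n * c) @ \oo --> coef_norm a * c.
  by apply: cvgMl.
by rewrite e; split; [apply/cvg_ex; eexists; exact: cl|apply/cvg_lim].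
Qed.

Lemma cvg_jker x y : -1 <= x <= 1 -> -1 <= y <= 1 ->
  series (fun n => a n * ((P n).[x] * (P n).[y] / h n)) @ \oo --> jker a x y.
Proof. by move=> x1 y1; exact: (cvg_series_abs_le (fun n => ker_le n x1 y1) sa). Qed.

Lemma jker_le x y : -1 <= x <= 1 -> -1 <= y <= 1 -> `|jker a x y| <= coef_norm a.
Proof. by move=> x1 y1; exact: (lim_series_norm_le (fun n => ker_le n x1 y1) sa). Qed.

Lemma cvg_jop f x : L1 f -> -1 <= x <= 1 ->
  series (fun n => a n * (jcoef f n * (P n).[x])) @ \oo --> jop a f x.
Proof.
move=> fi x1; have [cs _] := cvg_scaled (N1 f).
exact: (cvg_series_abs_le (fun n => op_le n fi x1) cs).
Qed.

Lemma jop_le f x : L1 f -> -1 <= x <= 1 -> `|jop a f x| <= coef_norm a * N1 f.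
Proof.
move=> fi x1; have [cs <-] := cvg_scaled (N1 f).
exact: (lim_series_norm_le (fun n => op_le n fi x1) cs).
Qed.

Lemma jop_series_le f x n : L1 f -> -1 <= x <= 1 ->
  `|series (fun n => a n * (jcoef f n * (P n).[x])) n| <= coef_norm a * N1 f.
Proof.
move=> fi x1; have [cs <-] := cvg_scaled (N1 f).
exact: (series_norm_le (fun n => op_le n fi x1) cs).
Qed.

Lemma measurable_jker x : -1 <= x <= 1 -> measurable_fun D (jker a x).
Proof.
move=> x1; apply: (@measurable_fun_cvg _ _ _ _
  (fun N y => series (fun n => a n * ((P n).[x] * (P n).[y] / h n)) N)).
  move=> N; apply: measurable_sum => n; apply: measurable_funM => //.
  by apply: measurable_funM => //; exact: measurable_funM.
by move=> y /in_D y1; exact: cvg_jker.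
Qed.

Lemma L1_jker f x : L1 f -> -1 <= x <= 1 -> L1 (fun y => jker a x y * f y).
Proof.
move=> fi x1; apply: (@L1_mul_bounded _ _ (coef_norm a)) => //; first exact: measurable_jker.
by move=> y /in_D; exact: jker_le.
Qed.

Lemma measurable_jop f : L1 f -> measurable_fun D (jop a f).
Proof.
move=> fi; apply: (@measurable_fun_cvg _ _ _ _
  (fun N x => series (fun n => a n * (jcoef f n * (P n).[x])) N)).
  move=> N; apply: measurable_sum => n; apply: measurable_funM => //.
  by apply: measurable_funM => //.
by move=> y /in_D y1; exact: cvg_jop.
Qed.

Lemma L1_jop f : L1 f -> L1 (jop a f).
Proof.
move=> fi; apply: (jacobi_integrable_bounded halpha hbeta (K := coef_norm a * N1 f)).
  exact: measurable_jop.
by move=> x x1; exact: jop_le.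
Qed.

Lemma Rintegral_series (F : nat -> R -> R) N : (forall n, L1 (F n)) ->
  I (fun x => series (fun n => F n x) N) = series (fun n => I (F n)) N.
Proof.
move=> Fi; rewrite /series /=; elim: N => [|N ih].
  rewrite big_nil -[RHS](mul0r (fine (mu D))) -Rintegral_cst//.
  by apply: eq_Rintegral => x _; rewrite big_nil.
rewrite big_nat_recr//= -ih -RintegralD//; last exact: L1_sum.
by apply: eq_Rintegral => x _; rewrite big_nat_recr.
Qed.

(** The partial sums of the kernel are bounded by [coef_norm a], so dominated convergence allows
    termwise integration against f. *)
Lemma jkerE f x : L1 f -> -1 <= x <= 1 -> I (fun y => jker a x y * f y) = jop a f x.
Proof.
move=> fi x1.
pose F n y := a n * ((P n).[x] * (P n).[y] / h n) * f y.
have Fi n : L1 (F n).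
  apply: (@L1_mul_bounded _ _ (`|a n| * B n)) => //.
    apply: measurable_funM => //; apply: measurable_funM => //; exact: measurable_funM.
  by move=> y /in_D y1; exact: ker_le.
have [|||||_ cI] := @cvg_Rintegral_dominated _ _ R mu D mD
    (fun N y => series (fun n => F n y) N) (fun y => jker a x y * f y)
    (fun y => coef_norm a * `|f y|).
- by move=> N; apply: measurable_sum => n; apply/measurable_EFinP; exact: measurable_int (Fi n).
- by apply/measurable_EFinP; exact: measurable_int (L1_jker fi x1).
- exact/L1Z/L1_normr.
- apply: aeW => y /in_D y1.
  rewrite (_ : (fun N => _) = (fun N =>
     series (fun n => a n * ((P n).[x] * (P n).[y] / h n)) N * f y)).
    by apply: cvgMl; exact: cvg_jker.
  by apply/funext => N; rewrite /series /= mulr_suml.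
- move=> N y /in_D y1; rewrite /F /series /= -mulr_suml normrM ler_wpM2r//.
  exact: (series_norm_le (fun n => ker_le n x1 y1) sa).
apply: (cvg_unique (@Rhausdorff R) cI).
move: (cvg_jop fi x1); apply: cvg_trans; apply: near_eq_cvg; near=> N.
rewrite Rintegral_series// /series /=; apply: eq_bigr => n _; apply/esym.
transitivity (I (fun y => a n * (P n).[x] / h n * ((P n).[y] * f y))).
  by apply: eq_Rintegral => y _; rewrite /F; ring.
by rewrite RintegralZl ?jacobi_integrable_mul_poly// /jcoef; ring.
Unshelve. all: by end_near. Qed.

Lemma Rintegral_jacobi_product n m : I (fun x => (P n).[x] * (P m).[x]) = if n == m then h m else 0.
Proof.
have -> : I (fun x => (P n).[x] * (P m).[x]) = I (horner (P n * P m)).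
  by apply: eq_Rintegral => x _; rewrite hornerM.
by case: eqP => [->|/eqP nm]; rewrite -?jacobi_hE ?jacobi_orth.
Qed.

Lemma jcoef_jop f m : L1 f -> jcoef (jop a f) m = a m * jcoef f m.
Proof.
move=> fi; rewrite {1}/jcoef; apply: (canLR (mulfK _)); first by rewrite gt_eqF.
pose F n x := a n * (jcoef f n * (P n).[x]) * (P m).[x].
have Fi n : L1 (F n).
  have := L1Z mD (a n * jcoef f n) (jacobi_integrable_poly halpha hbeta (P n * P m)).
  by apply: (L1_eq mD) => x _; rewrite /F hornerM !mulrA.
have [c c1 cmax] := horner_norm_max (P m).
have [|||||_ cI] := @cvg_Rintegral_dominated _ _ R mu D mD
    (fun N x => series (fun n => F n x) N) (fun x => (P m).[x] * jop a f x)
    (fun x => coef_norm a * N1 f * `|(P m).[c]|).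
- by move=> N; apply: measurable_sum => n; apply/measurable_EFinP; exact: measurable_int (Fi n).
- exact: (measurable_funM (mP (P m)) (measurable_jop fi)).
- exact: jacobi_integrable_cst.
- apply: aeW => x /in_D x1; rewrite mulrC.
  rewrite (_ : (fun N => _) = (fun N =>
     series (fun n => a n * (jcoef f n * (P n).[x])) N * (P m).[x])).
    by apply: cvgMl; exact: cvg_jop.
  by apply/funext => N; rewrite /series /= mulr_suml.
- move=> N x /in_D x1; rewrite /F /series /= -mulr_suml normrM.
  by apply: ler_pM => //; [exact: jop_series_le|exact: cmax].
apply: (cvg_unique (@Rhausdorff R) cI).
apply: cvg_near_cst; near=> N.
have mN : (m < N)%N by near: N; exact: nbhs_infty_gt.
rewrite Rintegral_series// /series /=.
have E n : I (F n) = a n * jcoef f n * (if n == m then h m else 0).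
  rewrite -Rintegral_jacobi_product -RintegralZl//.
    by apply: eq_Rintegral => x _; rewrite /F; ring.
  by apply: jacobi_integrable_mul_poly; exact: jacobi_integrable_poly.
under eq_bigr do rewrite E.
rewrite big_mkord (bigD1 (Ordinal mN))//= eqxx big1 ?addr0// => i im.
by rewrite (negbTE (_ : (i != m :> nat))) ?mulr0.
Unshelve. all: by end_near. Qed.

End summable.

Lemma jop_comp a b f x : summable_coef b -> L1 f ->
  jop a (jop b f) x = jop (fun n => a n * b n) f x.
Proof.
move=> sb fi; congr (limn (series _)); apply/funext => n.
by rewrite jcoef_jop// !mulrA.
Qed.

Lemma jop_addf a f g x : summable_coef a -> L1 f -> L1 g -> -1 <= x <= 1 ->
  jop a (f \+ g) x = jop a f x + jop a g x.
Proof.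
move=> sa fi gi x1; have fgi := L1D mD fi gi.
rewrite -!jkerE// -RintegralD; [|exact: mD|exact: L1_jker|exact: L1_jker].
by apply: eq_Rintegral => y _; rewrite mulrDr.
Qed.

Lemma summable_coefD a b : summable_coef a -> summable_coef b ->
  summable_coef (fun n => a n + b n).
Proof.
move=> sa sb; apply: (@cvg_series_abs_le _ _
    ((fun n => `|a n| * B n) + (fun n => `|b n| * B n))).
  by move=> n; rewrite normrM normr_id (ger0_norm (B_ge0 n)) -mulrDl ler_wpM2r// ler_normD.
exact: is_cvg_seriesD.
Qed.

Lemma summable_coefZ (c : R) a : summable_coef a -> summable_coef (fun n => c * a n).
Proof.
move=> sa; apply: (@cvg_series_abs_le _ _ (`|c| *: (fun n => `|a n| * B n))).
  by move=> n; rewrite normrM normr_id (ger0_norm (B_ge0 n)) normrM -mulrA.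
exact: is_cvg_seriesZ.
Qed.

Lemma summable_coef_le a b : (forall n, `|a n| <= b n) -> summable_coef b ->
  summable_coef a.
Proof.
move=> ab; apply: cvg_series_abs_le => n.
by rewrite normrM normr_id (ger0_norm (B_ge0 n)) ler_wpM2r// (le_trans (ab n))// ler_norm.
Qed.

Lemma summable_coef_sum N (c : nat -> R) (a : nat -> nat -> R) :
  (forall i, summable_coef (a i)) ->
  summable_coef (fun n => \sum_(0 <= i < N) c i * a i n).
Proof.
move=> sa; elim: N => [|N ih].
  apply: (@cvg_series_abs_le _ _ (fun n => `|0 * a 0%N n| * B n)).
    by move=> n; rewrite big_nil mul0r normr0 mul0r normr0.
  exact: (summable_coefZ (c := 0) (sa 0%N)).
rewrite (_ : (fun n => _) = (fun n => \sum_(0 <= i < N) c i * a i n + c N * a N n)).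
  by apply: summable_coefD => //; exact: summable_coefZ.
by apply/funext => n; rewrite big_nat_recr.
Qed.

Lemma jop_coefD a b f x : summable_coef a -> summable_coef b -> L1 f -> -1 <= x <= 1 ->
  jop (fun n => a n + b n) f x = jop a f x + jop b f x.
Proof.
move=> sa sb fi x1; apply/cvg_lim => //.
have : (fun N => series (fun n => a n * (jcoef f n * (P n).[x])) N +
    series (fun n => b n * (jcoef f n * (P n).[x])) N) @ \oo --> jop a f x + jop b f x.
  by apply: cvgD; exact: cvg_jop.
apply: cvg_trans.
apply: near_eq_cvg; near=> N; rewrite /series /= -big_split/=.
by apply: eq_bigr => n _; rewrite -mulrDl.
Unshelve. all: by end_near. Qed.

Lemma jop_coefZ (c : R) a f x : summable_coef a -> L1 f -> -1 <= x <= 1 ->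
  jop (fun n => c * a n) f x = c * jop a f x.
Proof.
move=> sa fi x1; apply/cvg_lim => //.
have : (fun N => c * series (fun n => a n * (jcoef f n * (P n).[x])) N) @ \oo -->
    c * jop a f x by apply: cvgMr; exact: cvg_jop.
apply: cvg_trans.
apply: near_eq_cvg; near=> N; rewrite /series /= mulr_sumr.
by apply: eq_bigr => n _; rewrite mulrA.
Unshelve. all: by end_near. Qed.

Lemma jop_coef_sum N (c : nat -> R) (a : nat -> nat -> R) f x :
  (forall i, summable_coef (a i)) -> L1 f -> -1 <= x <= 1 ->
  jop (fun n => \sum_(0 <= i < N) c i * a i n) f x =
  \sum_(0 <= i < N) c i * jop (a i) f x.
Proof.
move=> sa fi x1; elim: N => [|N ih].
  rewrite big_nil; apply/cvg_lim => //; apply: cvg_near_cst; near=> N.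
  by rewrite /series /= big1// => i _; rewrite big_nil mul0r.
rewrite big_nat_recr//= -ih -jop_coefZ// -jop_coefD//; last exact: summable_coefZ.
  by congr (limn (series _)); apply/funext => n; rewrite big_nat_recr.
exact: summable_coef_sum.
Unshelve. all: by end_near. Qed.

Lemma jacobi0E x : (P 0).[x] = (P 0).[0].
Proof.
have := size_jacobi hP 0; move=> s0.
by rewrite [P 0]size1_polyC ?s0// !hornerC.
Qed.

Lemma jacobi0_neq0 : (P 0).[0] != 0.
Proof.
have := jacobi_coef_neq0 hP 0; rewrite {2}[P 0]size1_polyC ?(size_jacobi hP)//.
by rewrite hornerC.
Qed.

(** P_0 is a nonzero constant, so the integral of a function is a fixed multiple of its zeroth
    coefficient, which a multiplier with a 0 = 1 preserves. *)
Lemma Rintegral_jop a f : summable_coef a -> L1 f -> a 0%N = 1 -> I (jop a f) = I f.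
Proof.
move=> sa fi a0.
have e g : L1 g -> I g = jcoef g 0 * h 0 / (P 0).[0].
  move=> gi; rewrite /jcoef divfK ?gt_eqF//.
  rewrite [X in X / _](_ : _ = (P 0).[0] * I g).
    by rewrite mulrC mulKf ?jacobi0_neq0.
  by rewrite -RintegralZl//; apply: eq_Rintegral => y _; rewrite jacobi0E.
by rewrite !e ?jcoef_jop ?a0 ?mul1r//; exact: L1_jop.
Qed.

Lemma jop_cst a c x : a 0%N = 1 -> jop a (cst c) x = c.
Proof.
move=> a0; apply/cvg_lim => //; apply: cvg_near_cst; near=> N.
have N0 : (0 < N)%N by near: N; exact: nbhs_infty_gt.
have e n : jcoef (cst c) n = if n == 0%N then c / (P 0).[0] else 0.
  rewrite /jcoef [X in X / _](_ : _ = c / (P 0).[0] * I (fun x => (P n).[x] * (P 0).[x])).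
    rewrite Rintegral_jacobi_product; case: eqP => [->|_]; last by rewrite mulr0 mul0r.
    by rewrite mulfK// gt_eqF.
  rewrite -RintegralZl//; last by apply: jacobi_integrable_mul_poly; exact: jacobi_integrable_poly.
  by apply: eq_Rintegral => y _; rewrite (jacobi0E y)/=; field; exact: jacobi0_neq0.
rewrite /series /= big_mkord (bigD1 (Ordinal N0))//= big1 ?addr0.
  by rewrite e eqxx a0 mul1r jacobi0E divfK// jacobi0_neq0.
move=> i; rewrite e => i0; rewrite ifN ?mul0r ?mulr0//.
Unshelve. all: by end_near. Qed.

Lemma jop_contraction a : summable_coef a -> a 0%N = 1 ->
  (forall x y, -1 <= x <= 1 -> -1 <= y <= 1 -> 0 <= jker a x y) ->
  positive_contraction mu D (jop a).
Proof.
move=> sa a0 ker0; split.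
- by move=> f fi; exact: L1_jop.
- by move=> f g fi gi x /in_D; exact: jop_addf.
- move=> f fi f0 x /in_D x1; rewrite -jkerE//; apply: Rintegral_ge0 => y Dy.
  by rewrite mulr_ge0 ?f0// ker0// in_D.
- by move=> f fi; exact: Rintegral_jop.
- by move=> c x _; exact: jop_cst.
Qed.

Lemma jop_poly a (d : nat -> R) N x :
  jop a (horner (\sum_(i < N) d i *: P i)) x = \sum_(i < N) a i * d i * (P i).[x].
Proof.
have e n : jcoef (horner (\sum_(i < N) d i *: P i)) n = if (n < N)%N then d n else 0.
  rewrite /jcoef.
  rewrite [X in X / _](_ : _ = I (horner (\sum_(i < N) (P n * (d i *: P i))))).
    rewrite (jacobi_integral_sum halpha hbeta (fun i => P n * (d i *: P i))).
    under eq_bigr => i _ do rewrite -scalerAr jacobi_integralZ//.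
    case: ltnP => nN.
      rewrite (bigD1 (Ordinal nN))//= -jacobi_hE big1 ?addr0.
        by rewrite mulfK// gt_eqF.
      by move=> i ni; rewrite jacobi_orth ?mulr0// eq_sym.
    rewrite big1 ?mul0r// => i _; rewrite jacobi_orth ?mulr0//.
    by rewrite gtn_eqF// (leq_trans (ltn_ord i)).
  by apply: eq_Rintegral => y _; rewrite -mulr_sumr hornerM.
apply/cvg_lim => //; apply: cvg_near_cst; near=> M.
have NM : (N <= M)%N by near: M; exact: nbhs_infty_ge.
rewrite /series /= (big_cat_nat (n := N))//= [X in _ + X]big1_seq ?addr0.
  by rewrite big_mkord; apply: eq_bigr => i _; rewrite e ltn_ord mulrA.
move=> i /andP[_]; rewrite mem_index_iota => /andP[Ni _].
by rewrite e ltnNge Ni /= mul0r mulr0.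
Unshelve. all: by end_near. Qed.

(* If k(x,y0) < 0, integrate k(x,.) against (1 - ((y-y0)/2)^2)^m, which concentrates
   at y0 exponentially fast in m. *)
Lemma jker_ge0 a : summable_coef a ->
  (forall q : {poly R}, (forall x, -1 <= x <= 1 -> 0 <= q.[x]) ->
    forall x, -1 <= x <= 1 -> 0 <= jop a (horner q) x) ->
  forall x y, -1 <= x <= 1 -> -1 <= y <= 1 -> 0 <= jker a x y.
Proof.
move=> sa pos x y0 x1 y01; rewrite leNgt; apply/negP => kneg.
set k := jker a x y0 in kneg.
(* The kernel is within [dl] of the polynomial [p], and [p] varies by at most [dl] within [eta] of
   y0; hence the kernel there is at most k + 3 dl = -dl. *)
pose dl := - k / 4; have dl0 : 0 < dl by rewrite /dl; lra.
pose V n := `|a n| * B n.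
have [N _ /(_ N (leqnn N))/= tailN] : \forall N \near \oo, `|limn (series V) - series V N| <= dl.
  by move/cvgrPdist_le : (sa : series V @ \oo --> limn (series V)); apply.
pose p : {poly R} := \sum_(0 <= n < N) (a n * ((P n).[x] / h n)) *: P n.
have pE y : p.[y] = series (fun n => a n * ((P n).[x] * (P n).[y] / h n)) N.
  rewrite /p horner_sum /series /=; apply: eq_bigr => n _.
  by rewrite hornerZ; ring.
have kp y : -1 <= y <= 1 -> `|jker a x y - p.[y]| <= dl.
  move=> y1; rewrite pE; apply: le_trans (le_trans (ler_norm _) tailN).
  have uV n : `|a n * ((P n).[x] * (P n).[y] / h n)| <= V n.
    by rewrite normrM ler_wpM2l//; exact: jacobi_product_le.
  exact: (series_tail_le uV sa N).
have [c c1 cmax] := horner_norm_max p^`().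
pose K := `|p^`().[c]| + 1; have K0 : 0 < K by rewrite ltr_wpDl.
have lip := @horner_lipschitz _ p K (fun t t1 => le_trans (cmax t t1) (_ : _ <= K)).
have {}lip u v : -1 <= u <= 1 -> -1 <= v <= 1 -> `|p.[u] - p.[v]| <= K * `|u - v|.
  by apply: lip; rewrite lerDl.
pose eta := Num.min 1 (dl / K).
have eta0 : 0 < eta by rewrite lt_min ltr01 divr_gt0.
have eta1 : eta <= 1 by rewrite ge_min lexx.
have etaK : K * eta <= dl by rewrite mulrC -ler_pdivlMr// ge_min lexx orbT.
have knear y : -1 <= y <= 1 -> `|y - y0| <= eta -> jker a x y <= - dl.
  move=> y1 yy0; have := kp y y1; have := kp y0 y01; have := lip y y0 y1 y01.
  have := ler_wpM2l (ltW K0) yy0; rewrite -/k /dl in etaK *.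
  rewrite !ler_norml /dl; lra.
pose S := coef_norm a; have S0 : 0 <= S by exact: coef_norm_ge0.
have kS y : -1 <= y <= 1 -> jker a x y <= S.
  by move=> y1; apply: le_trans (ler_norm _) _; exact: jker_le.
pose q1 : {poly R} := 1 - (2^-1 *: ('X - y0%:P)) ^+ 2.
have q1E y : q1.[y] = 1 - ((y - y0) / 2) ^+ 2.
  by rewrite /q1 hornerD hornerN horner_exp hornerZ hornerXsubC hornerC mulrC.
(* [q1] is at most [rho] farther than [eta] from y0 and at least [rho'] > [rho] within eta/2 of y0;
   the ratio of these bounds drives the concentration. *)
pose rho := 1 - (eta / 2) ^+ 2; pose rho' := 1 - (eta / 4) ^+ 2.
have q10 y : -1 <= y <= 1 -> 0 <= q1.[y] by move=> y1; rewrite q1E; nra.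
have rho0 : 0 <= rho by rewrite /rho; nra.
have rho'0 : 0 < rho' by rewrite /rho'; nra.
have rr : rho < rho' by rewrite /rho /rho'; nra.
have q1far y : -1 <= y <= 1 -> eta < `|y - y0| -> q1.[y] <= rho.
  move=> y1 yy; rewrite q1E /rho lerD2l lerN2 !expr_div_n ler_pM2r ?invr_gt0 ?exprn_gt0//.
  by rewrite -[leRHS]real_normK ?num_real// lerXn2r ?nnegrE ?(ltW eta0)// ltW.
have q1near y : `|y - y0| <= eta / 2 -> rho' <= q1.[y].
  by rewrite ler_norml => yy; rewrite q1E /rho'; nra.
have [cc [kk [cc0 hcc]]] := jacobi_measure_itv_ge halpha hbeta.
pose low := cc * (eta / 2) ^+ kk.
have low0 : 0 < low by rewrite mulr_gt0// exprn_gt0// divr_gt0.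
have Jlow m : rho' ^+ m * low <= I (horner (q1 ^+ m)).
  have q0 y : -1 <= y <= 1 -> 0 <= (q1 ^+ m).[y].
    by move=> y1; rewrite horner_exp exprn_ge0// q10.
  have [y00|y00] := leP 0 y0.
    rewrite /low {1}(_ : eta / 2 = y0 - (y0 - eta / 2)); last by ring.
    apply: jacobi_integral_ge => //; try lra; first by rewrite exprn_ge0// ltW.
      by apply: hcc; lra.
    move=> y yy; rewrite horner_exp lerXn2r// ?nnegrE ?(ltW rho'0)//; first by apply: q10; lra.
    by apply: q1near; rewrite ler_norml; lra.
  rewrite /low {1}(_ : eta / 2 = y0 + eta / 2 - y0); last by ring.
  apply: jacobi_integral_ge => //; try lra; first by rewrite exprn_ge0// ltW.
    by apply: hcc; lra.
  move=> y yy; rewrite horner_exp lerXn2r// ?nnegrE ?(ltW rho'0)//; first by apply: q10; lra.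
  by apply: q1near; rewrite ler_norml; lra.
(* Integrate k(x,y) q1^m <= (S + dl) rho^m - dl q1^m. The left side has nonnegative integral by
   assumption, and the integral of q1^m is at least rho'^m low; as m grows this forces dl low <=
   0. *)
have key m : dl * low * rho' ^+ m <= (S + dl) * fine (mu D) * rho ^+ m.
  have q0 y : -1 <= y <= 1 -> 0 <= (q1 ^+ m).[y].
    by move=> y1; rewrite horner_exp exprn_ge0// q10.
  have qi : L1 (horner (q1 ^+ m)) by exact: jacobi_integrable_poly.
  have ki : L1 (fun y => jker a x y * (q1 ^+ m).[y]) by exact: L1_jker.
  have h1 : 0 <= I (fun y => jker a x y * (q1 ^+ m).[y]).
    by rewrite jkerE//; exact: pos.
  have h2 : I (fun y => jker a x y * (q1 ^+ m).[y]) <=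
      I (fun y => (S + dl) * rho ^+ m - dl * (q1 ^+ m).[y]).
    apply: le_Rintegral => //.
      by apply: (L1B mD); [exact: jacobi_integrable_cst|exact: L1Z].
    move=> y /in_D y1; have [near|far] := leP `|y - y0| eta.
      apply: (@le_trans _ _ (- dl * (q1 ^+ m).[y])).
        by apply: ler_wpM2r; [exact: q0|exact: knear].
      by rewrite mulNr lerDr mulr_ge0 ?exprn_ge0// addr_ge0// ltW.
    rewrite lerBrDr -mulrDl; have [kd|kd] := leP 0 (jker a x y + dl).
      apply: ler_pM => //; [exact: q0|by rewrite lerD2r kS|].
      by rewrite horner_exp lerXn2r ?nnegrE ?q10 ?q1far.
    apply: (@le_trans _ _ 0); first by rewrite mulr_le0_ge0 ?q0// ltW.
    by rewrite mulr_ge0 ?exprn_ge0// addr_ge0// ltW.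
  move: h2; rewrite RintegralB//; [|exact: jacobi_integrable_cst|exact: L1Z].
  rewrite Rintegral_cst// RintegralZl// => h2.
  rewrite -mulrA [low * _]mulrC.
  apply: le_trans (ler_wpM2l (ltW dl0) (Jlow m)) _.
  rewrite [leRHS]mulrAC -subr_ge0; exact: le_trans h1 h2.
have r1 : `|rho / rho'| < 1.
  rewrite (ger0_norm (divr_ge0 rho0 (ltW rho'0))) (ltr_pdivrMr _ _ rho'0) mul1r.
  exact: rr.
have lim0 : (S + dl) * fine (mu D) * (rho / rho') ^+ m @[m --> \oo] --> 0.
  rewrite -[X in _ --> X](mulr0 ((S + dl) * fine (mu D))); apply: cvgMr; exact: cvg_expr.
have : dl * low <= 0.
  apply: (cvgr_to_ge lim0); near=> M.
  by rewrite /= (expr_div_n rho rho' M) [leRHS]mulrA ler_pdivlMr ?exprn_gt0.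
by rewrite leNgt mulr_gt0.
Unshelve. all: by end_near. Qed.

(** * Resolvents and positivity of the heat semigroup *)

Lemma jacobi_op_sum (d : nat -> R) N :
  jacobi_op alpha beta (\sum_(i < N) d i *: P i) = - \sum_(i < N) (d i * eig i) *: P i.
Proof.
have LD p q : jacobi_op alpha beta (p + q) = jacobi_op alpha beta p + jacobi_op alpha beta q.
  by rewrite /jacobi_op !derivD; ring.
have LZ c p : jacobi_op alpha beta (c *: p) = c *: jacobi_op alpha beta p.
  by rewrite /jacobi_op !derivZ -!mul_polyC; ring.
elim: N => [|N ih].
  by rewrite !big_ord0 oppr0; have := LZ 0 0; rewrite !scale0r.
rewrite !big_ord_recr /= LD ih LZ jacobi_opE// opprD; congr (_ + _).
by rewrite scalerA mulrN scaleNr.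
Qed.

(** The polynomial in the conclusion is (1 - eps L)^-1 applied to the given one, so the maximum
    principle [jacobi_op_max] applies to it. *)
Lemma resolvent_ge0 (d : nat -> R) N (eps : R) : 0 <= eps ->
  (forall x, -1 <= x <= 1 -> 0 <= (\sum_(i < N) d i *: P i).[x]) ->
  forall x, -1 <= x <= 1 ->
    0 <= (\sum_(i < N) (d i * (1 + eps * eig i)^-1) *: P i).[x].
Proof.
move=> eps0 d0; apply: (jacobi_op_max halpha hbeta eps0) => x x1.
rewrite (jacobi_op_sum (fun i => d i * (1 + eps * eig i)^-1)) scalerN opprK scaler_sumr -big_split/=.
rewrite (eq_bigr (fun i : 'I_N => d i *: P i)); first exact: d0.
move=> i _; rewrite scalerA -scalerDl; congr (_ *: _).
have e0 : 0 < 1 + eps * eig i by rewrite ltr_wpDr// mulr_ge0// jacobi_eig_ge0.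
by field; rewrite gt_eqF.
Qed.

(** With u = x / m, a squeeze between 1 + u <= exp u and 1/(1 + u) = 1 - u/(1 + u) <= exp(-u/(1 +
    u)), both raised to the power m. *)
Lemma cvg_resolvent (x : R) : 0 <= x ->
  (1 + x / m%:R)^-1 ^+ m @[m --> \oo] --> expR (- x).
Proof.
move=> x0.
have lo : expR (- x) @[m --> \oo] --> expR (- x) by exact: cvg_cst.
have hi : expR (- (x * (1 + x / m%:R)^-1)) @[m --> \oo] --> expR (- x).
  apply: continuous_cvg; first exact: continuous_expR.
  apply: cvgN; rewrite -[X in _ --> X]mulr1; apply: cvgMr.
  rewrite -[X in _ --> X]invr1; apply: cvgV; first exact: oner_neq0.
  rewrite -[X in _ --> X]addr0; apply: cvgD; first exact: cvg_cst.
  rewrite -[X in _ --> X](mulr0 x); apply: cvgMr.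
  have Mgt0 : \forall M \near \oo, 0 < M%:R :> R.
    by near=> M; rewrite ltr0n; near: M; exists 1%N.
  exact: (gtr0_cvgV0 Mgt0).2 cvgr_idn.
apply: (squeeze_cvgr _ lo hi); near=> m.
have m0 : 0 < m%:R :> R by rewrite ltr0n; near: m; exists 1%N.
have y0 : 0 <= x / m%:R by rewrite divr_ge0// ltW.
have y1 : 0 < 1 + x / m%:R by rewrite ltr_wpDr.
have ex (z : R) : expR (z / m%:R) ^+ m = expR z.
  have mn0 : m%:R != 0 :> R by rewrite gt_eqF.
  by rewrite -expRM_natl mulrCA mulfV ?mulr1.
apply/andP; split.
  rewrite exprVn expRN lef_pV2 ?posrE ?expR_gt0 ?exprn_gt0//.
  by rewrite -[leRHS]ex lerXn2r ?nnegrE ?expR_ge0 ?expR_ge1Dx// ltW.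
rewrite -(ex (- _)) lerXn2r ?nnegrE ?expR_ge0 ?invr_ge0 ?(ltW y1)//.
apply: le_trans (expR_ge1Dx _).
set u := x / m%:R in y1 *.
have -> : - (x / (1 + u)) / m%:R = - (u / (1 + u)) by rewrite /u; ring.
rewrite le_eqVlt; apply/orP; left; apply/eqP; field.
by rewrite gt_eqF.
Unshelve. all: by end_near. Qed.

Definition heat (s : R) (n : nat) : R := expR (- (s * eig n)).

(** The exponential formula: the heat operator is the limit of the m-th powers of the resolvents
    with eps = s / m. On a polynomial this is a finite sum, so the limit is taken
    coefficientwise. *)
Lemma heat_poly_ge0 (s : R) q : 0 <= s ->
  (forall x, -1 <= x <= 1 -> 0 <= q.[x]) ->
  forall x, -1 <= x <= 1 -> 0 <= jop (heat s) (horner q) x.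
Proof.
move=> s0 q0 x x1; have [d qE] := jacobi_basis hP (leqnn (size q)).
set N := size q in qE; rewrite qE jop_poly.
have it m : forall y, -1 <= y <= 1 -> forall eps, 0 <= eps ->
    0 <= (\sum_(i < N) (d i * (1 + eps * eig i)^-1 ^+ m) *: P i).[y].
  move=> y y1 eps eps0; elim: m y y1 => [|m ih] y y1.
    by under eq_bigr do rewrite expr0 mulr1; rewrite -qE q0.
  have := resolvent_ge0 (d := fun i => d i * (1 + eps * eig i)^-1 ^+ m) eps0 ih y1.
  by under eq_bigr do rewrite -mulrA -exprSr.
have lim : (\sum_(i < N) (d i * (1 + s / m%:R * eig i)^-1 ^+ m) *: P i).[x] @[m --> \oo]
    --> \sum_(i < N) heat s i * d i * (P i).[x].
  under eq_fun do rewrite horner_sum.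
  apply: cvg_big => [|i _]; first exact: add_continuous.
  under eq_fun do rewrite hornerZ [d i * _]mulrC.
  apply: cvgMl; apply: cvgMl.
  have := cvg_resolvent (mulr_ge0 s0 (jacobi_eig_ge0 halpha hbeta i)).
  by under eq_fun do rewrite mulrAC.
apply: (cvgr_to_ge lim); near=> m; apply: it => //.
by rewrite divr_ge0// ler0n.
Unshelve. all: by end_near. Qed.

Lemma heat_jker_ge0 (s : R) : 0 <= s -> summable_coef (heat s) ->
  forall x y, -1 <= x <= 1 -> -1 <= y <= 1 -> 0 <= jker (heat s) x y.
Proof. by move=> s0 ss; apply: jker_ge0 => // q; exact: heat_poly_ge0. Qed.

Lemma heat_contraction (s : R) : 0 <= s -> summable_coef (heat s) ->
  positive_contraction mu D (jop (heat s)).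
Proof.
move=> s0 ss; apply: jop_contraction => //; last exact: heat_jker_ge0.
by rewrite /heat /jacobi_eig mul0r mulr0 oppr0 expR0.
Qed.

(** Stated from the first iterate on: the zeroth one is f itself, which need not be the pointwise
    sum of its expansion. *)
Lemma heat_iter (s : R) f j : summable_coef (heat s) -> L1 f ->
  (forall i : nat, summable_coef (heat (s * i.+1%:R))) ->
  iter j.+1 (jop (heat s)) f = jop (heat (s * j.+1%:R)) f.
Proof.
move=> ss fi si; elim: j => [|j ih]; first by rewrite /= mulr1.
rewrite iterS ih; apply/funext => x; rewrite jop_comp//.
congr (jop _ f x); apply/funext => n; rewrite /heat -expRD; congr expR.
by rewrite -[j.+2]addn1 natrD; ring.
Qed.

Hypothesis B_geo : forall r : R, 0 <= r < 1 -> cvgn (series (fun n => r ^+ n * B n)).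

Lemma summable_expr (r : R) : 0 <= r < 1 -> summable_coef (fun n => r ^+ n).
Proof.
move=> r01; have := B_geo r01; rewrite /summable_coef.
rewrite (_ : (fun n => `|r ^+ n| * B n) = (fun n => r ^+ n * B n))//.
by apply/funext => n; rewrite ger0_norm// exprn_ge0//; case/andP: r01.
Qed.

Lemma summable_geo (c r : R) : 0 <= r < 1 -> summable_coef (fun n => c * r ^+ n).
Proof. by move=> r01; apply: summable_coefZ; exact: summable_expr. Qed.

(** For n >= 1, eig n >= n (alpha + beta + 2) with alpha + beta + 2 > 0, so the heat multipliers lie
    below a geometric sequence. *)
Lemma summable_heat (s : R) : 0 < s -> summable_coef (heat s).
Proof.
move=> s0; have a10 : 0 < alpha + 1 by rewrite -ltrBlDr sub0r.
have b10 : 0 < beta + 1 by rewrite -ltrBlDr sub0r.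
pose r := expR (- (s * (alpha + beta + 2))).
have r01 : 0 <= r < 1.
  by rewrite expR_ge0 expR_lt1 oppr_lt0 mulr_gt0//; lra.
apply: summable_coef_le (summable_expr r01) => n.
rewrite ger0_norm ?expR_ge0// /r -expRM_natl ler_expR mulrN lerN2 mulrCA.
rewrite ler_wpM2l ?(ltW s0)// /jacobi_eig.
case: n => [|n]; first by rewrite !mul0r.
rewrite ler_wpM2l ?ler0n//.
have : 0 <= n%:R :> R by rewrite ler0n.
rewrite -[n.+1]addn1 natrD; lra.
Qed.

(** * The weak-type estimate *)

Section weak_type.
Variables (w : R -> nat -> nat -> R) (C : R).
Hypothesis C0 : 0 <= C.
Hypothesis w_ge0 : forall t M i, 0 < t -> (0 < M)%N -> 0 <= w t M i.
Hypothesis w_sum : forall t M n (a : nat -> R) b, 0 < t -> (0 < M)%N -> 0 <= b ->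
  (forall i, 0 <= a i) ->
  (forall k, (k <= n)%N -> \sum_(0 <= i < k) a i <= k%:R * b) ->
  \sum_(0 <= i < n) w t M i * a i <= C * b.

Definition subordinated (t m : R) (M : nat) : R :=
  \sum_(0 <= i < (M ^ 2).-1) w t M i * expR (- (m ^+ 2 * (i.+1%:R / M%:R))).

Hypothesis w_cvg : forall t m, 0 < t -> 0 < m ->
  subordinated t m M @[M --> \oo] --> expR (- (t * m)).
Hypothesis w_dom : forall t m M, 0 < t -> 0 < m -> (0 < M)%N ->
  subordinated t m M <= expR (- (t * (m / Num.sqrt 2))).
Hypothesis w_le2 : forall t m M, 0 < t -> (0 < M)%N -> 0 <= subordinated t m M <= 2.

(* With a = jacobi_shift, (n + a)^2 = eig n + a^2: hence exp(-t n) = exp(t a) exp(-t (n + a))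
   is obtained by subordination from the heat multipliers as soon as n > 0. The term n = 0,
   where n + a may be negative, is treated apart. *)
Definition jacobi_shift : R := (alpha + beta + 1) / 2.

Let shift_gt n : (0 < n)%N -> 0 < n%:R + jacobi_shift.
Proof.
case: n => // n _; have a10 : 0 < alpha + 1 by rewrite -ltrBlDr sub0r.
have b10 : 0 < beta + 1 by rewrite -ltrBlDr sub0r.
have : 0 <= n%:R :> R by rewrite ler0n.
rewrite /jacobi_shift -[n.+1]addn1 natrD; lra.
Qed.

Definition sub_coef (t : R) (M n : nat) : R := subordinated t (n%:R + jacobi_shift) M.

Lemma sub_coefE t M n : (0 < M)%N -> sub_coef t M n =
  \sum_(0 <= i < (M ^ 2).-1) w t M i * expR (- (jacobi_shift ^+ 2 * (i.+1%:R / M%:R))) *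
    heat (M%:R^-1 * i.+1%:R) n.
Proof.
move=> M0; apply: eq_bigr => i _; rewrite -mulrA -expRD; congr (_ * expR _).
by rewrite /jacobi_eig /jacobi_shift; field; rewrite pnatr_eq0 -lt0n.
Qed.

Lemma jop_sub_coef t M f x : (0 < M)%N -> L1 f -> -1 <= x <= 1 ->
  jop (sub_coef t M) f x =
  \sum_(0 <= i < (M ^ 2).-1) w t M i * expR (- (jacobi_shift ^+ 2 * (i.+1%:R / M%:R))) *
    iter i.+1 (jop (heat M%:R^-1)) f x.
Proof.
move=> M0 fi x1.
have M'0 : 0 < M%:R^-1 :> R by rewrite invr_gt0 ltr0n.
have sh (i : nat) : summable_coef (heat (M%:R^-1 * i.+1%:R)).
  by apply: summable_heat; rewrite mulr_gt0// ltr0n.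
transitivity (\sum_(0 <= i < (M ^ 2).-1) w t M i * expR (- (jacobi_shift ^+ 2 * (i.+1%:R / M%:R))) *
    jop (heat (M%:R^-1 * i.+1%:R)) f x).
  rewrite -(jop_coef_sum _ (fun i => w t M i * expR (- (jacobi_shift ^+ 2 * (i.+1%:R / M%:R)))) sh)//.
  by congr (jop _ f x); apply/funext => n; exact: sub_coefE.
apply: eq_bigr => i _; rewrite heat_iter//; exact: summable_heat.
Qed.

Definition exceptional (M : nat) (f : R -> R) (lam : R) : set R :=
  [set x | D x /\ exists2 k, (0 < k <= M ^ 2)%N &
     lam * k%:R < ergodic_sum (jop (heat M%:R^-1)) (fun y => `|f y|) k x].

(** The weighted sum runs over the iterates 1, ..., k, whereas ergodic sums also contain the zeroth.
    Adding that nonnegative term gives the bound lam (k + 1) <= 2 lam k, whence the factor 2. *)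
Lemma jop_sub_coef_le t M f lam x : 0 < t -> (0 < M)%N -> 0 <= lam -> L1 f ->
  D x -> ~ exceptional M f lam x -> `|jop (sub_coef t M) f x| <= C * (2 * lam).
Proof.
move=> t0 M0 lam0 fi Dx nE; have x1 := in_D Dx.
have M'0 : 0 < M%:R^-1 :> R by rewrite invr_gt0 ltr0n.
have hT := heat_contraction (ltW M'0) (summable_heat M'0).
rewrite jop_sub_coef//; apply: le_trans (ler_norm_sum _ _ _) _.
set T := jop _ in hT *; pose g y := `|f y|.
have gi : L1 g by exact: L1_normr.
have g0 i : 0 <= iter i.+1 T g x by apply: (iter_contraction_ge0 hT) => // y _; exact: normr_ge0.
apply: (@le_trans _ _ (\sum_(0 <= i < (M ^ 2).-1) w t M i * iter i.+1 T g x)).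
  apply: ler_sum => i _; rewrite normrM; apply: ler_pM => //.
    rewrite ger0_norm ?mulr_ge0 ?expR_ge0 ?w_ge0// ler_piMr ?w_ge0//.
    by rewrite expR_le1 oppr_le0 mulr_ge0 ?sqr_ge0// divr_ge0 ?ler0n.
  exact: (iter_contraction_norm mD muD hT).
apply: w_sum => //; first by rewrite mulr_ge0.
move=> [|k] kM; first by rewrite big_nil mul0r.
have kM2 : (k.+2 <= M ^ 2)%N by rewrite -(prednK (_ : 0 < M ^ 2)%N) ?expn_gt0 ?M0.
have : ergodic_sum T g k.+2 x <= lam * k.+2%:R.
  rewrite leNgt; apply/negP => h'; apply: nE; split => //.
  by exists k.+2.
rewrite /ergodic_sum big_nat_recl//= => h'.
apply: le_trans (_ : _ <= lam * k.+2%:R) _; first by apply: le_trans h'; rewrite lerDr normr_ge0.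
have : 0 <= k%:R :> R by rewrite ler0n.
by rewrite -[k.+2]addn2 -[k.+1]addn1 !natrD; nra.
Qed.

(** The product with [B 0] bounds the n = 0 term of the approximation error; the final 1 bounds the
    sum of all the others once M is large. *)
Let weak_c1 : R := (1 + 2 * expR `|jacobi_shift|) * B 0 + 1.

(** For n > 0 the multipliers converge under a summable bound, so the weighted sum of their errors
    tends to 0; the n = 0 error is only bounded. The error is measured by [coef_norm], so M depends
    neither on f nor on x. *)
Lemma jop_sub_coef_approx t : 0 < t <= 1 -> \forall M \near \oo, forall f, L1 f ->
  forall x, -1 <= x <= 1 ->
  `|jop (fun n => expR (- t) ^+ n) f x - expR (t * jacobi_shift) * jop (sub_coef t M) f x|
    <= weak_c1 * N1 f.
Proof.
move=> /andP[t0 t1].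
pose dM M n := expR (- t) ^+ n - expR (t * jacobi_shift) * sub_coef t M n.
pose u M n := if n == 0%N then 0 else dM M n.
pose r1 := expR (- t); pose r2 := expR (- (t / Num.sqrt 2)).
have s20 : 0 < Num.sqrt 2 :> R by rewrite sqrtr_gt0.
have s21 : 1 <= Num.sqrt 2 :> R by rewrite -[leLHS]sqrtr1 ler_wsqrtr// ler1n.
have r11 : 0 <= r1 < 1 by rewrite expR_ge0 expR_lt1 oppr_lt0.
have r21 : 0 <= r2 < 1 by rewrite expR_ge0 expR_lt1 oppr_lt0 divr_gt0.
(* By [w_dom], the subordinated part is at most exp(-t n / sqrt 2) exp(t a - t a / sqrt 2) with a =
   [jacobi_shift]; the last exponent is at most 2 |a| because t <= 1. *)
pose v n := 1 * r1 ^+ n + expR (2 * `|jacobi_shift|) * r2 ^+ n.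
have sv : summable_coef v by apply: summable_coefD; exact: summable_geo.
have shift_le (c d : R) : 0 <= c <= 1 -> c * d <= `|d|.
  move=> c01; apply: (@le_trans _ _ (c * `|d|)).
    by rewrite ler_wpM2l ?ler_norm//; case/andP: c01.
  by rewrite ler_piMl//; case/andP: c01.
have uv M n : (0 < M)%N -> `|u M n| <= v n.
  move=> M0; have v0 : 0 <= v n by rewrite addr_ge0 ?mulr_ge0 ?exprn_ge0 ?expR_ge0.
  rewrite /u; case: eqP => [_|/eqP]; first by rewrite normr0.
  rewrite -lt0n => n0; rewrite /dM /v; apply: le_trans (ler_normB _ _) _.
  apply: lerD; first by rewrite mul1r ger0_norm// exprn_ge0// expR_ge0.
  have /andP[S0 _] := w_le2 (n%:R + jacobi_shift) t0 M0.
  rewrite ger0_norm; last by rewrite mulr_ge0 ?expR_ge0.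
  apply: (@le_trans _ _ (expR (t * jacobi_shift) * expR (- (t * ((n%:R + jacobi_shift) / Num.sqrt 2))))).
    by rewrite ler_wpM2l ?expR_ge0// w_dom// shift_gt.
  rewrite -expRM_natl -!expRD ler_expR.
  have -> : t * jacobi_shift - t * ((n%:R + jacobi_shift) / Num.sqrt 2) =
     t * jacobi_shift + (t / Num.sqrt 2) * - jacobi_shift + n%:R * - (t / Num.sqrt 2) by ring.
  rewrite lerD2r mulr2n mulrDl !mul1r; apply: lerD.
    by apply: shift_le; rewrite (ltW t0).
  rewrite -[leRHS]normrN; apply: shift_le.
  rewrite divr_ge0 ?(ltW t0) ?(ltW s20)//= ler_pdivrMr// mul1r.
  exact: le_trans t1 s21.
have cvB : cvgn (series (fun n => v n * B n)).
  have := sv; rewrite /summable_coef.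
  rewrite (_ : (fun n => `|v n| * B n) = (fun n => v n * B n))//.
  apply/funext => n; rewrite ger0_norm// addr_ge0 ?mulr_ge0 ?exprn_ge0 ?expR_ge0//.
have uB0 n : u M n * B n @[M --> \oo] --> 0.
  rewrite -(mul0r (B n)); apply: cvgMl; rewrite /u; case: eqP => [_|/eqP]; first exact: cvg_cst.
  rewrite -lt0n => n0.
  have -> : 0 = expR (- t) ^+ n - expR (t * jacobi_shift) * expR (- (t * (n%:R + jacobi_shift))).
    rewrite -expRM_natl -expRD; apply/esym/eqP; rewrite subr_eq0; apply/eqP.
    by congr expR; ring.
  apply: cvgB; first exact: cvg_cst.
  by apply: cvgMr; apply: w_cvg => //; exact: shift_gt.
have tan : limn (series (fun n => `|u M n * B n|)) @[M --> \oo] --> 0.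
  (* The domination holds only for M > 0, hence the shift of the index before [tannery]. *)
  rewrite -(cvg_shiftS (fun M => limn (series (fun n => `|u M n * B n|)))).
  apply: (tannery cvB) => [M n|n].
    by rewrite normrM (ger0_norm (B_ge0 n)) ler_wpM2r// uv.
  by have := uB0 n; rewrite -cvg_shiftS.
move/cvgr0Pnorm_le : tan => /(_ _ ltr01) tan; near=> M => f fi x x1.
have M0 : (0 < M)%N by near: M; exists 1%N.
have tanM : `|limn (series (fun n => `|u M n * B n|))| <= 1 by near: M.
have sr1 : summable_coef (fun n => r1 ^+ n) by exact: summable_expr.
have ss : summable_coef (sub_coef t M).
  have M'0 : 0 < M%:R^-1 :> R by rewrite invr_gt0 ltr0n.
  rewrite (_ : sub_coef t M = fun n => \sum_(0 <= i < (M ^ 2).-1)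
    (w t M i * expR (- (jacobi_shift ^+ 2 * (i.+1%:R / M%:R)))) * heat (M%:R^-1 * i.+1%:R) n).
    apply: summable_coef_sum => i; apply: summable_heat.
    by rewrite mulr_gt0// ltr0n.
  by apply/funext => n; exact: sub_coefE.
have sd : summable_coef (dM M).
  rewrite (_ : dM M = fun n => r1 ^+ n + - expR (t * jacobi_shift) * sub_coef t M n).
    by apply: summable_coefD => //; exact: summable_coefZ.
  by apply/funext => n; rewrite /dM mulNr.
have -> : jop (fun n => expR (- t) ^+ n) f x - expR (t * jacobi_shift) * jop (sub_coef t M) f x =
    jop (dM M) f x.
  rewrite -mulNr -jop_coefZ// -jop_coefD//; last exact: summable_coefZ.
  by congr (jop _ f x); apply/funext => n; rewrite /dM mulNr.
apply: le_trans (jop_le sd fi x1) _.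
apply: ler_wpM2r; first by apply: Rintegral_ge0.
have d0 : `|dM M 0%N| <= 1 + 2 * expR `|jacobi_shift|.
  rewrite /dM expr0; apply: le_trans (ler_normB _ _) _; rewrite normr1 lerD2l.
  have /andP[S0 S2] := w_le2 (0%:R + jacobi_shift) t0 M0.
  rewrite ger0_norm ?mulr_ge0 ?expR_ge0// mulrC ler_pM ?expR_ge0//.
  by rewrite ler_expR shift_le// (ltW t0).
have uBc : cvgn (series (fun n => `|u M n * B n|)).
  apply: (cvg_series_abs_le _ cvB) => n.
  by rewrite normr_id normrM (ger0_norm (B_ge0 n)) ler_wpM2r// uv.
have split_le K : series (fun n => `|dM M n| * B n) K <=
    `|dM M 0%N| * B 0 + series (fun n => `|u M n * B n|) K.
  rewrite /series /=; case: K => [|K].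
    by rewrite !big_nil addr0 mulr_ge0.
  rewrite !big_nat_recl//= {1}/u eqxx mul0r normr0 add0r lerD2l.
  by apply: ler_sum => i _; rewrite /u /= normrM (ger0_norm (B_ge0 _)).
apply: limr_le => //; near=> N.
apply: le_trans (split_le N) _; rewrite /weak_c1; apply: lerD.
  by rewrite ler_wpM2r.
apply: le_trans (series_le_lim N (fun n => normr_ge0 _) uBc) _.
exact: le_trans (ler_norm _) tanM.
Unshelve. all: by end_near. Qed.

Let weak_c2 : R := weak_c1 + coef_norm (fun n => expR (- 1) ^+ n).

(** The first summand is the ratio of lam to the level used in Hopf's inequality; the second covers
    small lam through the total mass. *)
Definition weak_const : R :=
  8 * expR `|jacobi_shift| * (C + 1) + 2 * weak_c2 * fine (mu D).

Let fin_mu (A : set R) : measurable (A : set (measurableTypeR R)) -> mu A \is a fin_num.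
Proof.
move=> mA; rewrite ge0_fin_numE//; apply: le_lt_trans muD.
by rewrite -jacobi_measure_setT le_measure// inE.
Qed.

Let abel_level (r lam : R) (f : R -> R) : set R :=
  [set x | D x /\ lam < `|jop (fun n => r ^+ n) f x|].

Let measurable_abel_level r lam f : 0 < r < 1 -> L1 f -> measurable (abel_level r lam f : set (measurableTypeR R)).
Proof.
move=> /andP[r0 r1] fi; have sr : summable_coef (fun n => r ^+ n).
  by apply: summable_expr; rewrite (ltW r0).
have mj := measurable_jop sr fi.
have mn : measurable_fun D (fun x => `|jop (fun n => r ^+ n) f x|).
  exact: measurableT_comp mj.
rewrite (_ : abel_level r lam f = D `&` (fun x => `|jop (fun n => r ^+ n) f x|) @^-1` `]lam, +oo[).
  by apply: mn.
apply/seteqP; split => x [Dx hx]; split => //.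
  by rewrite /preimage /= in_itv/= hx.
by move: hx; rewrite /preimage /= in_itv/= andbT.
Qed.

(** With finitely many radii one M serves them all, and one application of Hopf's inequality to the
    heat operator of time 1/M covers the whole union. The bound does not depend on N. *)
Lemma weak_type_finite (r : nat -> R) f lam N : (forall i, 0 < r i < 1) -> L1 f ->
  0 < lam -> fine (mu (\bigcup_(i < N) abel_level (r i) lam f)) <= weak_const / lam * N1 f.
Proof.
move=> r01 fi lam0.
set U := \bigcup_(i < N) _.
have mU : measurable (U : set (measurableTypeR R)).
  by apply: bigcup_measurable => i _; exact: measurable_abel_level.
have UD : U `<=` D by move=> x [i _ []].
have N0 : 0 <= N1 f by apply: Rintegral_ge0.
have e11 : 0 <= expR (- 1 : R) < 1 by rewrite expR_ge0 expR_lt1 oppr_lt0 ltr01.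
have se := summable_expr e11.
have c10 : 0 <= weak_c1 by rewrite addr_ge0// mulr_ge0// addr_ge0// mulr_ge0// expR_ge0.
have ce0 := coef_norm_ge0 se.
have c20 : 0 <= weak_c2 by rewrite addr_ge0.
have muD0 : 0 <= fine (mu D) by rewrite fine_ge0.
have X0 : 0 <= 8 * expR `|jacobi_shift| * (C + 1) by rewrite !mulr_ge0 ?expR_ge0// addr_ge0.
(* For lam below 2 weak_c2 times the norm, the finite total mass gives the bound. Otherwise weak_c2
   times the norm is at most lam / 2, which absorbs the error terms. *)
have [small|large] := ltP lam (2 * weak_c2 * N1 f).
  apply: (@le_trans _ _ (fine (mu D))).
    by apply: fine_le; rewrite ?fin_mu// le_measure// inE.
  rewrite mulrAC ler_pdivlMr//.
  apply: (@le_trans _ _ (fine (mu D) * (2 * weak_c2 * N1 f))).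
    by rewrite ler_wpM2l// ltW.
  rewrite /weak_const [leRHS]mulrDl.
  have -> : fine (mu D) * (2 * weak_c2 * N1 f) = 2 * weak_c2 * fine (mu D) * N1 f.
    by rewrite mulrCA mulrA.
  by rewrite lerDr mulr_ge0.
(* Chosen so that exp(|jacobi_shift|) C (2 lam') <= lam / 4; with C + 1 instead of C the quotient
   makes sense for C = 0. Outside the exceptional set the total is then at most lam/4 + lam/2. *)
pose lam' := lam / (8 * expR `|jacobi_shift| * (C + 1)).
have Y0 : 0 < 8 * expR `|jacobi_shift| * (C + 1) by rewrite !mulr_gt0 ?expR_gt0// ltr_wpDl.
have lam'0 : 0 < lam' by rewrite divr_gt0.
have good i : expR (- 1) <= r i -> \forall M \near \oo, forall f, L1 f ->
    forall x, -1 <= x <= 1 ->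
    `|jop (fun n => r i ^+ n) f x - expR (- ln (r i) * jacobi_shift) * jop (sub_coef (- ln (r i)) M) f x|
      <= weak_c1 * N1 f.
  have /andP[r0 r1] := r01 i.
  move=> er; have t01 : 0 < - ln (r i) <= 1.
    rewrite oppr_gt0 ln_lt0 ?r0//= lerNl -ler_expR lnK//.
  by have := jop_sub_coef_approx t01; rewrite opprK lnK.
have all_good : \forall M \near \oo, forall i, (i < N)%N -> expR (- 1) <= r i ->
    forall x, -1 <= x <= 1 ->
    `|jop (fun n => r i ^+ n) f x - expR (- ln (r i) * jacobi_shift) * jop (sub_coef (- ln (r i)) M) f x|
      <= weak_c1 * N1 f.
  elim: (N) => [|k ih]; first by near=> M.
  have [er|er] := leP (expR (- 1)) (r k); last first.
    near=> M => i; rewrite ltnS leq_eqVlt => /predU1P[->|ik]; first by rewrite leNgt er.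
    by move: i ik; near: M.
  have gk := good k er; near=> M => i; rewrite ltnS leq_eqVlt => /predU1P[->|ik].
    by move=> _; move: (f) fi; near: M.
  by move: i ik; near: M.
have [M [M0 HM]] : exists M, (0 < M)%N /\ forall i, (i < N)%N -> expR (- 1) <= r i ->
    forall x, -1 <= x <= 1 ->
    `|jop (fun n => r i ^+ n) f x - expR (- ln (r i) * jacobi_shift) * jop (sub_coef (- ln (r i)) M) f x|
      <= weak_c1 * N1 f.
  move: all_good => [m _ /(_ m.+1 (leqnSn m))] h'; by exists m.+1.
have M'0 : 0 < M%:R^-1 :> R by rewrite invr_gt0 ltr0n.
have hT := heat_contraction (ltW M'0) (summable_heat M'0).
have fn0 x : D x -> 0 <= `|f x| by [].
have [mE hE] := hopf_maximal mD muD hT (M ^ 2) lam' (L1_normr mD fi) fn0.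
have UE : U `<=` exceptional M f lam'.
  move=> x [i /= iN [Dx lx]]; apply: contrapT => nE; have x1 := in_D Dx.
  move: lx; apply/negP; rewrite -leNgt.
  have /andP[r0 r1] := r01 i.
  (* Radii below exp(-1), that is t > 1: the kernel is bounded by the coefficient norm at r =
     exp(-1), without any maximal inequality. *)
  have [er|er] := leP (expR (- 1)) (r i); last first.
    apply: le_trans (jop_le _ fi x1) _.
      by apply: summable_expr; rewrite (ltW r0).
    apply: (@le_trans _ _ (weak_c2 * N1 f)); last by lra.
    apply: ler_wpM2r => //; apply: (@le_trans _ _ (coef_norm (fun n => expR (- 1) ^+ n))).
      apply: lim_series_le => //.
        by apply: summable_expr; rewrite (ltW r0).
      move=> n; rewrite ler_wpM2r// !ger0_norm ?exprn_ge0 ?expR_ge0 ?(ltW r0)//.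
      by rewrite lerXn2r ?nnegrE ?expR_ge0 ?(ltW r0) ?(ltW er).
    by rewrite /weak_c2 lerDr.
  have t01 : 0 < - ln (r i) <= 1.
    by rewrite oppr_gt0 ln_lt0 ?r0//= lerNl -ler_expR lnK.
  have h1 := HM i iN er x x1.
  have h2 := jop_sub_coef_le (proj1 (andP t01)) M0 (ltW lam'0) fi Dx nE.
  set J1 := jop _ f x in h1 *; set J2 := jop _ f x in h1 h2.
  have h3 : `|expR (- ln (r i) * jacobi_shift) * J2| <= expR `|jacobi_shift| * (C * (2 * lam')).
    rewrite normrM (ger0_norm (expR_ge0 _)) ler_pM ?expR_ge0// ler_expR.
    apply: le_trans (ler_norm _) _; rewrite normrM (ger0_norm (ltW (proj1 (andP t01)))).
    by rewrite ler_piMl//; case/andP: t01.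
  have h4 : expR `|jacobi_shift| * (C * (2 * lam')) <= lam / 4.
    have -> : expR `|jacobi_shift| * (C * (2 * lam')) = lam / 4 * (C / (C + 1)).
      rewrite /lam'; field; rewrite (gt_eqF (expR_gt0 _))/= gt_eqF//.
      by rewrite ltr_wpDl.
    by rewrite ler_piMr ?divr_ge0 ?(ltW lam0)// ler_pdivrMr ?ltr_wpDl// mul1r lerDl.
  have h5 : weak_c1 * N1 f <= lam / 2.
    have : weak_c1 * N1 f <= weak_c2 * N1 f by rewrite ler_wpM2r// lerDl.
    lra.
  have := ler_normD (J1 - expR (- ln (r i) * jacobi_shift) * J2) (expR (- ln (r i) * jacobi_shift) * J2).
  rewrite subrK; lra.
apply: (@le_trans _ _ (fine (mu (exceptional M f lam')))).
  by apply: fine_le; rewrite ?fin_mu// le_measure// inE.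
have : fine (mu (exceptional M f lam')) <= (8 * expR `|jacobi_shift| * (C + 1)) / lam * N1 f.
  rewrite -(ler_pM2l lam'0); apply: le_trans hE _.
  have XY : lam' * (8 * expR `|jacobi_shift| * (C + 1) / lam) = 1.
    by rewrite /lam' mulrA divfK ?gt_eqF// divff ?gt_eqF.
  by rewrite [leRHS]mulrA XY mul1r.
move=> /le_trans; apply; apply: ler_wpM2r => //.
by rewrite ler_pM2r ?invr_gt0// /weak_const lerDl !mulr_ge0.
Unshelve. all: by end_near. Qed.

(** Continuity in the radius, approached from below so that r^n B n dominates the differences |q_j^n
    - r^n| B n. *)
Lemma cvg_jop_expr (r : R) (q : nat -> R) f x : 0 < r < 1 ->
  (forall j, 0 <= q j <= r) -> q j @[j --> \oo] --> r -> L1 f -> -1 <= x <= 1 ->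
  jop (fun n => q j ^+ n) f x @[j --> \oo] --> jop (fun n => r ^+ n) f x.
Proof.
move=> /andP[r0 r1] qr cq fi x1.
have r01 : 0 <= r < 1 by rewrite (ltW r0).
have sr := summable_expr r01.
have sq j : summable_coef (fun n => q j ^+ n).
  by apply: summable_expr; have /andP[-> /le_lt_trans ->] := qr j.
pose u j n := (q j ^+ n - r ^+ n) * B n.
have sd j : summable_coef (fun n => q j ^+ n - r ^+ n).
  rewrite (_ : (fun n => _) = (fun n => q j ^+ n + -1 * r ^+ n)).
    by apply: summable_coefD => //; exact: summable_coefZ.
  by apply/funext => n; rewrite mulN1r.
have dE j : jop (fun n => q j ^+ n) f x - jop (fun n => r ^+ n) f x =
    jop (fun n => q j ^+ n - r ^+ n) f x.
  rewrite -[X in _ + X]mulN1r -jop_coefZ// -jop_coefD//; last exact: summable_coefZ.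
  by congr (jop _ f x); apply/funext => n; rewrite mulN1r.
have tan : limn (series (fun n => `|u j n|)) @[j --> \oo] --> 0.
  apply: (tannery (B_geo r01)) => [j n|n].
    rewrite /u normrM (ger0_norm (B_ge0 n)) ler_wpM2r//.
    have /andP[q0 qr'] := qr j; have h1 : 0 <= q j ^+ n by rewrite exprn_ge0.
    have h2 : q j ^+ n <= r ^+ n by rewrite lerXn2r ?nnegrE ?(ltW r0).
    by rewrite distrC ger0_norm ?subr_ge0// gerBl.
  rewrite -(mul0r (B n)); apply: cvgMl; rewrite -(subrr (r ^+ n)).
  apply: cvgB; last exact: cvg_cst.
  exact: cvg_comp cq (@exprn_continuous R n r).
apply/cvgrPdist_le => e e0.
have N0 : 0 <= N1 f by apply: Rintegral_ge0.
have N10 : 0 < N1 f + 1 by rewrite ltr_wpDl.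
have e'0 : 0 < e / (N1 f + 1) by rewrite divr_gt0.
move/cvgr0Pnorm_le : tan => /(_ _ e'0) tan; near=> j.
rewrite distrC dE; apply: le_trans (jop_le (sd j) fi x1) _.
have h1 : `|limn (series (fun n => `|u j n|))| <= e / (N1 f + 1) by near: j.
have cE : coef_norm (fun n => q j ^+ n - r ^+ n) = limn (series (fun n => `|u j n|)).
  congr (limn (series _)); apply/funext => n.
  by rewrite /u normrM (ger0_norm (B_ge0 n)).
rewrite cE; apply: (@le_trans _ _ (e / (N1 f + 1) * (N1 f + 1))); last by rewrite divfK// gt_eqF.
apply: ler_pM => //; last by rewrite lerDl.
  by rewrite -cE; exact: coef_norm_ge0.
exact: le_trans (ler_norm _) h1.
Unshelve. all: by end_near. Qed.

Lemma unit_itv_dense_seq : exists r : nat -> R, (forall i, 0 < r i < 1) /\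
  forall u v : R, 0 <= u -> u < v -> v <= 1 -> exists i, u < r i < v.
Proof.
pose r (i : nat) : R := if @unpickle rat i is Some q then
  if 0 < (ratr q : R) < 1 then ratr q else 2^-1 else 2^-1.
have half : 0 < (2^-1 : R) < 1 by lra.
exists r; split.
  by move=> i; rewrite /r; case: unpickle => // q; case: ifP.
move=> u v u0 uv v1; have [q] := rat_in_itvoo uv.
rewrite in_itv/= => /andP[uq qv]; exists (pickle q).
by rewrite /r pickleK (le_lt_trans u0 uq) (lt_le_trans qv v1) uq qv.
Qed.

(** By continuity in the radius, a value above lam at some radius gives one at a radius of the dense
    sequence. The level set is thus an increasing union of the measurable sets of
    [weak_type_finite], and the uniform bound passes to the limit. *)
Theorem weak_type_jacobi_maximal f lam : L1 f -> 0 < lam ->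
  (mu [set x | (-1 <= x <= 1)%R /\ lam%:E < jacobi_maximal alpha beta P f x]
     <= (weak_const / lam)%:E *
        \int[mu]_(x in `[(-1)%R, 1%R]) `|f x|%:E)%E.
Proof.
move=> fi lam0; have [r [r01 rdense]] := unit_itv_dense_seq.
have intE s x : 0 < s < 1 -> -1 <= x <= 1 ->
    (\int[mu]_(y in D) (watson_kernel alpha beta P s x y * f y)%:E)%E =
    (jop (fun n => s ^+ n) f x)%:E.
  move=> /andP[s0 s1] x1; have ss : summable_coef (fun n => s ^+ n).
    by apply: summable_expr; rewrite (ltW s0).
  rewrite -jkerE// /Rintegral fineK//.
  exact: integrable_fin_num (L1_jker ss fi x1).
have -> : [set x | (-1 <= x <= 1)%R /\ (lam%:E < jacobi_maximal alpha beta P f x)%E] =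
    \bigcup_n \bigcup_(i < n) abel_level (r i) lam f.
  apply/seteqP; split => x.
    move=> [x1 /ereal_sup_gt[_ [s /= + <-]]]; rewrite in_itv/= => s01.
    rewrite intE//= lte_fin => lx.
    suff [i hi] : exists i, lam < `|jop (fun n => r i ^+ n) f x|.
      by exists i.+1 => //; exists i => //=; split => //; rewrite /= in_itv.
    apply: contrapT => /forallNP noi.
    have /andP[s0 s1] := s01.
    (* Members of the dense sequence squeezed between s (1 - 1/(k+2)) and s approximate s from
       below. *)
    have /choice[j jP] : forall k : nat, exists i, s * (1 - k.+2%:R^-1) < r i < s.
      move=> k; apply: rdense; last exact: ltW.
        by rewrite mulr_ge0 ?(ltW s0)// subr_ge0 invf_le1// ler1n.
      by rewrite gtr_pMr// gtrBl invr_gt0 ltr0n.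
    have cj : r (j k) @[k --> \oo] --> s.
      have lo : s * (1 - k.+2%:R^-1) @[k --> \oo] --> s.
        rewrite -[X in _ --> X]mulr1; apply: cvgMr.
        rewrite -[X in _ --> X]subr0; apply: cvgB; first exact: cvg_cst.
        have := @cvg_harmonic R; rewrite -cvg_shiftS.
        by apply: cvg_trans; apply: near_eq_cvg; near=> n.
      have hi : s @[k --> \oo] --> s by exact: cvg_cst.
      apply: (squeeze_cvgr _ lo hi); near=> k.
      by have /andP[/ltW -> /ltW ->] := jP k.
    have := cvg_jop_expr s01 _ cj fi x1 => cl.
    have {}cl : jop (fun n => r (j k) ^+ n) f x @[k --> \oo] --> jop (fun n => s ^+ n) f x.
      apply: cl => k; have /andP[/ltW h1 _] := r01 (j k).
      by have /andP[_ /ltW h2] := jP k; rewrite h1 h2.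
    move: lx; apply/negP; rewrite -leNgt.
    apply: (cvgr_to_le (cvg_norm cl)); near=> k.
    by rewrite leNgt; apply/negP; exact: noi.
  move=> [n _ [i _ [Dx lx]]]; have x1 := in_D Dx; split => //.
  apply: (@lt_le_trans _ _ (`|jop (fun n => r i ^+ n) f x|%:E)%E); first by rewrite lte_fin.
  apply: ereal_sup_ubound; exists (r i); first by rewrite /= in_itv/=.
  by rewrite intE.
pose F n := \bigcup_(i < n) abel_level (r i) lam f.
have mF n : measurable (F n : set (measurableTypeR R)).
  by apply: bigcup_measurable => i _; exact: measurable_abel_level.
have ndF : nondecreasing_seq F.
  apply/nondecreasing_seqP => n; apply/subsetPset => x [i /= ni h'].
  by exists i => //=; exact: ltnW.
have cF := @nondecreasing_cvg_mu _ _ _ mu F mF (bigcup_measurable (fun n _ => mF n)) ndF.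
apply: (cvge_to_le cF); near=> n.
have N1E : (\int[mu]_(x in `[(-1)%R, 1%R]) `|f x|%:E)%E = (N1 f)%:E.
  by rewrite /Rintegral fineK//; exact: integrable_fin_num (L1_normr mD fi).
rewrite N1E -EFinM /= -[leLHS]fineK ?fin_mu// lee_fin.
exact: weak_type_finite.
Unshelve. all: by end_near. Qed.

End weak_type.

End expansion.

Theorem mainTheorem7 (R : realType) (alpha beta : R)
    (halpha : -1 < alpha) (hbeta : -1 < beta) :
  exists C : R,
  forall P : nat -> {poly R}, jacobi_polynomials alpha beta P ->
  forall f : R -> R,
    (jacobi_measure alpha beta).-integrable `[-1, 1]%classic (EFin \o f) ->
  forall lam : R, 0 < lam ->
    (jacobi_measure alpha beta
       [set x | (-1 <= x <= 1)%R /\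
                lam%:E < jacobi_maximal alpha beta P f x]
     <= (C / lam)%:E *
        \int[jacobi_measure alpha beta]_(x in `[(-1)%R, 1%R]) `|f x|%:E)%E.
Proof.
have [A [k [A0 hA]]] := jacobi_bound halpha hbeta.
have [w [C C0 [w_ge0 w_sum [w_cvg w_dom w_le2]]]] := half_stable_subordination R.
pose B (n : nat) : R := A * n.+1%:R ^+ k.
(* This constant involves the polynomials only through [B], that is through [A] and [k], so it can
   be given before [P]. *)
exists (weak_const alpha beta B C) => P hP f fi lam lam0.
have hB := hA P hP.
have B_geo (r : R) : 0 <= r < 1 -> cvgn (series (fun n => r ^+ n * B n)).
  move=> r01; rewrite (_ : (fun n => _) = A *: (fun n => n.+1%:R ^+ k * r ^+ n)).
    exact/is_cvg_seriesZ/cvg_series_poly_geometric.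
  by apply/funext => n; rewrite /B mulrC -mulrA.
apply: (weak_type_jacobi_maximal halpha hbeta hP _ _ B_geo C0 w_ge0 w_sum w_cvg w_dom w_le2) => //.
  by move=> n; have [] := hB n.
by move=> n x x1; have [_] := hB n; apply.
Qed.
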